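(* Let $n\ge 2$ and $V\in\Omega_n$. (1) If $V\in\mathcal C_n$, then $g_{\Omega_n}(V,M)=g_{\mathbb G_n}(\sigma(V),\sigma(M))$ for every $M\in\Omega_n$. (2) If $V\notin\mathcal C_n$, then there exist an eigenvalue $\lambda$ of $V$ with $m(\lambda)<n(\lambda)$ and a matrix $X\in\mathcal M_n\setminus\{0\}$ such that, as $\zeta\to 0$ in $\mathbb C$, $$g_{\Omega_n}(V,V+\zeta X)\ \ge\ m(\lambda)\log|\zeta|+O(1),\qquad g_{\mathbb G_n}(\sigma(V),\sigma(V+\zeta X))\ \le\ n(\lambda)\log|\zeta|+O(1).$$
   Context: $\mathcal M_n$ is the space of complex $n\times n$ matrices with a fixed operator norm $\|\cdot\|$; $\rho(A)$ is the spectral radius and $\Omega_n=\{A\in\mathcal M_n:\rho(A)<1\}$ is the spectral ball. Write $\det(tI-A)=t^n+\sum_{j=1}^n(-1)^j\sigma_j(A)t^{n-j}$, $\sigma=(\sigma_1,\dots,\sigma_n):\mathcal M_n\to\mathbb C^n$, and $\mathbb G_n=\sigma(\Omega_n)$ (the symmetrized polydisk). $\mathcal C_n$ is the set of cyclic (non-derogatory) matrices, i.e. those admitting a cyclic vector. For a domain $D\subset\mathbb C^N$ and $p\in D$, the Green function is $g_D(p,z)=\sup\{u(z): u$ negative plurisubharmonic on $D$, $u(w)\le\log\|w-p\|+O(1)$ as $w\to p\}$. For an eigenvalue $\lambda$ of $V$, $V_\lambda$ denotes the restriction of $V$ to $\ker(V-\lambda I_n)^n$, $n(\lambda)=\dim\ker(V-\lambda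 I_n)^n$, and $m(\lambda)=\min\{k:(V_\lambda-\lambda I_{n(\lambda)})^k=0\}$. (For $\zeta$ small, $V+\zeta X\in\Omega_n$.) *)

(* Defs.v *)
From HB Require Import structures.
From mathcomp Require Import all_boot all_order all_algebra.
From mathcomp Require Import complex.
From mathcomp Require Import all_classical all_reals.
From mathcomp Require Import ereal topology normedtype sequences exp trigo measure
  lebesgue_measure lebesgue_integral.

Set Implicit Arguments.
Unset Strict Implicit.
Unset Printing Implicit Defensive.

Import Order.TTheory GRing.Theory Num.Theory.
Local Open Scope ring_scope.
Local Open Scope classical_set_scope.

Section Defs.
Variable R : realType.
Local Notation C := (R[i]).

Definition cabs (z : C) : R :=
  Num.sqrt (complex.Re z ^+ 2 + complex.Im z ^+ 2).

(* a fixed norm on C^(p x q) (max of moduli of entries); C^N = 'rV_N,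
   M_n = 'M_n.  All norms on a finite-dim space are equivalent, so the
   Green function does not depend on this choice. *)
Definition mxnorm (p q : nat) (A : 'M[C]_(p, q)) : R :=
  \big[Num.max/0]_(i < p) \big[Num.max/0]_(j < q) cabs (A i j).

Definition spectral_radius (n : nat) (A : 'M[C]_n) : R :=
  sup [set cabs l | l in [set l : C | eigenvalue A l]].

Definition spectral_ball (n : nat) : set 'M[C]_n :=
  [set A | spectral_radius A < 1].

(* det(tI - A) = t^n + sum_j (-1)^j sigma_j(A) t^(n-j); entry j : 'I_n is sigma_(j+1) *)
Definition sigma (n : nat) (A : 'M[C]_n) : 'rV[C]_n :=
  \row_(j < n) ((-1) ^+ j.+1 * (char_poly A)`_(n - j.+1)).

Definition symm_polydisc (n : nat) : set 'rV[C]_n :=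
  [set sigma A | A in @spectral_ball n].

Definition cyclic_mx (n : nat) (A : 'M[C]_n) : Prop :=
  exists v : 'cV[C]_n, \matrix_(i < n, k < n) ((A ^+ k *m v) i ord0) \in unitmx.

Definition circ (r t : R) : C := ((r * cos t) +i* (r * sin t))%C.

Definition usc_on (p q : nat) (D : set 'M[C]_(p, q)) (u : 'M[C]_(p, q) -> \bar R) :=
  (forall x, D x -> u x < +oo)%E /\
  forall x, D x -> forall c : R, (u x < c%:E)%E ->
    exists2 d : R, 0 < d & forall y, D y -> mxnorm (y - x) < d -> (u y < c%:E)%E.

Definition psh_on (p q : nat) (D : set 'M[C]_(p, q)) (u : 'M[C]_(p, q) -> \bar R) :=
  usc_on D u /\
  forall (a b : 'M[C]_(p, q)) (r : R), D a -> 0 < r ->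
    (forall z : C, cabs z <= r -> D (a + z *: b)) ->
    (u a <= ((2 * pi)^-1)%:E *
       \int[@lebesgue_measure R]_(t in `[0%R, (2 * pi)%R]) u (a + circ r t *: b)%R)%E.

Definition green_class (p q : nat) (D : set 'M[C]_(p, q)) (P : 'M[C]_(p, q))
    (u : 'M[C]_(p, q) -> \bar R) : Prop :=
  (forall x, D x -> u x < 0)%E /\ psh_on D u /\
  exists c : R, exists2 d : R, 0 < d & forall w, D w -> w != P ->
    mxnorm (w - P) < d -> (u w <= (ln (mxnorm (w - P)) + c)%:E)%E.

Definition green (p q : nat) (D : set 'M[C]_(p, q)) (P z : 'M[C]_(p, q)) : \bar R :=
  ereal_sup [set u z | u in green_class D P].

(* n(lambda) = dim ker (V - lambda I)^n  (kernel for the action on column vectors) *)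
Definition nlam (n : nat) (V : 'M[C]_n) (l : C) : nat :=
  \rank (kermx (((V - l%:M) ^+ n)^T)).

Definition mlam_pred (n : nat) (V : 'M[C]_n) (l : C) : pred nat :=
  fun k => `[< forall x : 'cV[C]_n,
              (V - l%:M) ^+ n *m x = 0 -> (V - l%:M) ^+ k *m x = 0 >].

Lemma mlam_ex (n : nat) (V : 'M[C]_n) (l : C) : exists k, mlam_pred V l k.
Proof. by exists n; apply/asboolP. Qed.

(* m(lambda) = min { k : (V_lambda - lambda I)^k = 0 }, V_lambda the restriction
   of V to ker (V - lambda I)^n *)
Definition mlam (n : nat) (V : 'M[C]_n) (l : C) : nat := ex_minn (mlam_ex V l).

End Defs.

Arguments spectral_ball {R} n.
Arguments symm_polydisc {R} n.

(* Main.v *)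
(** Plurisubharmonicity is tested on affine discs, while [sigma] maps an affine disc to a
    polynomial one.  The submean inequality along a polynomial disc follows from a
    maximum principle for finite families of polynomial discs (the rotates of the given
    one), proved by doubling variables, and from Fatou's lemma.

    A negative psh function on the spectral ball is constant on the fibres of [sigma]:
    conjugating a diagonal matrix by [1 + N], with [N] strictly triangular and
    [N D N = 0] for all diagonal [D], moves it along a complex line contained in its fibre,
    where Liouville applies; such matrices and the diagonal ones generate GL_n.  Hence
    competitors on the two domains correspond through [u o sigma] and through the
    companion section [sigma_mx], which for cyclic [V] passes through [V] up to
    conjugation by a fixed invertible matrix.

    If [V] is not cyclic, then some [l] has [m(l)] smaller than its multiplicity [k], and
    [q = (X - l)^m(l) * chi'] annihilates [V], where [chi = (X - l)^k * chi'].  The function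
    [log rho (q M)], with [rho] the spectral radius, has a pole at [V].  Placing the [k]-th
    roots of unity on the [l]-entries of a triangular form of [V] gives [X] with
    [sigma (V + z X) = sigma V + z^k b], while [q (V + z X)] has the eigenvalue
    [q (l + z)], of order [m(l)] in [z]. *)
Require Import Defs.
From HB Require Import structures.
From mathcomp Require Import all_boot all_order all_algebra.
From mathcomp Require Import complex perm spectral mxred.
From mathcomp Require Import all_classical all_reals.
From mathcomp Require Import ereal topology normedtype sequences exp trigo measure
  lebesgue_measure lebesgue_integral.
From mathcomp Require Import derive ftc measurable_realfun numfun.
From mathcomp Require Import ring lra.
Import Order.TTheory GRing.Theory Num.Theory.
Import numFieldNormedType.Exports.
Local Open Scope ring_scope.
Local Open Scope classical_set_scope.

Set Implicit Arguments.
Unset Strict Implicit.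
Unset Printing Implicit Defensive.

(** * Moduli, circles and the max norm *)

(** Functions here are only upper semicontinuous, may take the value [-oo], and satisfy an integral
    inequality. The integral is traded for a test by majorants: a function dominated on a circle by
    [A + Re (x w + y w^2)] is at most [A] at the centre. Comparison functions then enter only
    through their second-order Taylor expansion, and the cubic remainder is beaten by a term
    [d |z|^2] once the circle is small. No supremum needs to be attained: every value of the
    competing set lies below the desired bound or a fixed amount below the supremum.

    A Green function is a supremum over competitors, each with its own pole constant. An upper bound
    must therefore be free of that constant; a Schwarz-type lemma on discs through the pole removes
    it.

    In the derogatory case the two exponents have different origins. Since [q] kills [V] and
    [M |-> q M] is Lipschitz near [V], [log rho (q M)] is at most [log |M - V| + O(1)], hence
    admissible, yet along [X] it is no smaller than [m(l) log |z| + O(1)]. On the symmetrized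
    polydisk the image runs inside the complex line through [sigma V] in direction [b], at parameter
    [z^k], and a pole of order one on that line gives [k log |z|]. *)

Section Modulus.
Variable R : realType.
Local Notation C := (R[i]).
Local Notation Re := complex.Re.
Local Notation Im := complex.Im.
Implicit Types (x y z : C) (r s t : R).

Lemma cabsE z : cabs z = Normc.normc z.
Proof. by case: z. Qed.

Lemma cabs_ge0 z : 0 <= cabs z.
Proof. exact: sqrtr_ge0. Qed.

Lemma cabs0 : cabs (0 : C) = 0.
Proof. by rewrite cabsE Normc.normc0. Qed.

Lemma cabs1 : cabs (1 : C) = 1.
Proof. by rewrite cabsE Normc.normc1. Qed.

Lemma cabs_eq0 z : (cabs z == 0) = (z == 0).
Proof.
apply/eqP/eqP => [|->]; last exact: cabs0.
by rewrite cabsE => /Normc.eq0_normc.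
Qed.

Lemma cabs_gt0 z : (0 < cabs z) = (z != 0).
Proof. by rewrite lt_def cabs_ge0 cabs_eq0 andbT. Qed.

Lemma cabsM x y : cabs (x * y) = cabs x * cabs y.
Proof. by rewrite !cabsE Normc.normcM. Qed.

Lemma cabsV x : cabs x^-1 = (cabs x)^-1.
Proof. by rewrite !cabsE Normc.normcV. Qed.

Lemma cabsN x : cabs (- x) = cabs x.
Proof. by rewrite !cabsE normcN. Qed.

Lemma cabsB x y : cabs (x - y) = cabs (y - x).
Proof. by rewrite -cabsN opprB. Qed.

Lemma cabsX x k : cabs (x ^+ k) = cabs x ^+ k.
Proof. by elim: k => [|k IH]; rewrite ?expr0 ?cabs1// !exprS cabsM IH. Qed.

Lemma ler_cabsD x y : cabs (x + y) <= cabs x + cabs y.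
Proof. by rewrite !cabsE le_normcD. Qed.

Lemma ler_cabsB x y : cabs (x - y) <= cabs x + cabs y.
Proof. by rewrite (le_trans (ler_cabsD _ _))// cabsN. Qed.

Lemma ler_distcabs x y : cabs x - cabs y <= cabs (x - y).
Proof. by rewrite lerBlDr (le_trans _ (ler_cabsD _ _))// subrK. Qed.

Lemma ler_cabs_sum (I : Type) (s : seq I) (P : pred I) (F : I -> C) :
  cabs (\sum_(i <- s | P i) F i) <= \sum_(i <- s | P i) cabs (F i).
Proof.
elim/big_rec2: _ => [|i y z _ H]; first by rewrite cabs0.
by rewrite (le_trans (ler_cabsD _ _))// lerD2l.
Qed.

Lemma cabs_prod (I : Type) (s : seq I) (P : pred I) (F : I -> C) :
  cabs (\prod_(i <- s | P i) F i) = \prod_(i <- s | P i) cabs (F i).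
Proof. by apply: (big_morph _ cabsM cabs1). Qed.

Lemma cabs_real r : cabs (r%:C)%C = `|r|.
Proof. by rewrite /cabs /= expr0n /= addr0 sqrtr_sqr. Qed.

Lemma cabs_nat k : cabs (k%:R : C) = k%:R.
Proof.
by rewrite -(rmorph_nat (real_complex R)) cabs_real ger0_norm.
Qed.

Lemma cabs_sqr z : cabs z ^+ 2 = Re z ^+ 2 + Im z ^+ 2.
Proof. by rewrite /cabs sqr_sqrtr// addr_ge0 ?sqr_ge0. Qed.

Lemma normr_Re z : `|Re z| <= cabs z.
Proof.
rewrite -ler_sqr ?nnegrE ?cabs_ge0 ?normr_ge0// cabs_sqr real_normK ?num_real//.
by rewrite lerDl sqr_ge0.
Qed.

Lemma normr_Im z : `|Im z| <= cabs z.
Proof.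
rewrite -ler_sqr ?nnegrE ?cabs_ge0 ?normr_ge0// cabs_sqr real_normK ?num_real//.
by rewrite lerDr sqr_ge0.
Qed.

Lemma cabs_leD z : cabs z <= `|Re z| + `|Im z|.
Proof.
rewrite -ler_sqr ?nnegrE ?cabs_ge0 ?addr_ge0 ?normr_ge0// cabs_sqr.
rewrite sqrrD !real_normK ?num_real// addrAC lerDl mulrn_wge0// mulr_ge0//.
Qed.

Lemma cReD x y : Re (x + y) = Re x + Re y. Proof. by case: x y => ? ? []. Qed.
Lemma cImD x y : Im (x + y) = Im x + Im y. Proof. by case: x y => ? ? []. Qed.
Lemma cReN x : Re (- x) = - Re x. Proof. by case: x. Qed.
Lemma cImN x : Im (- x) = - Im x. Proof. by case: x. Qed.
Lemma cReM x y : Re (x * y) = Re x * Re y - Im x * Im y.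
Proof. by case: x y => ? ? []. Qed.
Lemma cImM x y : Im (x * y) = Re x * Im y + Im x * Re y.
Proof. by case: x y => ? ? [? ?] /=; rewrite mulrC. Qed.

Lemma cRe_sum (I : Type) (s : seq I) (P : pred I) (F : I -> C) :
  Re (\sum_(i <- s | P i) F i) = \sum_(i <- s | P i) Re (F i).
Proof. by apply: (big_morph _ cReD). Qed.

Lemma cabs_sqrD x y :
  cabs (x + y) ^+ 2 = cabs x ^+ 2 + 2 * Re (x^*%C * y) + cabs y ^+ 2.
Proof.
rewrite !cabs_sqr cReD cImD cReM.
by case: x y => a b [c d] /=; ring.
Qed.

Lemma cabs_conj x : cabs (x^*%C) = cabs x.
Proof. by rewrite /cabs; case: x => a b /=; rewrite sqrrN. Qed.

Lemma cplxP x y : Re x = Re y -> Im x = Im y -> x = y.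
Proof. by case: x y => ? ? [? ?] /= -> ->. Qed.

Lemma Re_circ r t : Re (circ r t) = r * cos t. Proof. by []. Qed.
Lemma Im_circ r t : Im (circ r t) = r * sin t. Proof. by []. Qed.

Lemma cabs_circ r t : 0 <= r -> cabs (circ r t) = r.
Proof.
move=> r0; apply/eqP; rewrite -(eqrXn2 (n:=2))// ?cabs_ge0// cabs_sqr /=.
by rewrite !exprMn -mulrDr cos2Dsin2 mulr1.
Qed.

Lemma circM r s t u : circ r t * circ s u = circ (r * s) (t + u).
Proof.
by apply: cplxP; rewrite ?cReM ?cImM !(Re_circ, Im_circ) ?cosD ?sinD; ring.
Qed.

Lemma circ_real r : circ r 0 = (r%:C)%C.
Proof. by apply: cplxP => /=; rewrite ?cos0 ?sin0 ?mulr1 ?mulr0. Qed.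

Lemma circZ r s t : (r%:C)%C * circ s t = circ (r * s) t.
Proof. by rewrite -circ_real circM add0r. Qed.

Lemma circX r t k : circ r t ^+ k = circ (r ^+ k) (t *+ k).
Proof.
elim: k => [|k IH]; first by rewrite !expr0 mulr0n circ_real.
by rewrite !exprS IH circM mulrS.
Qed.

Lemma circ_2pi r t k : circ r (t + 2 * pi * k%:R) = circ r t.
Proof.
have P u : circ r (u + 2 * pi) = circ r u.
  rewrite mulr_natl.
  by apply: cplxP; rewrite ?(Re_circ, Im_circ) ?cosD2pi ?sinD2pi.
elim: k => [|k IH]; first by rewrite mulr0 addr0.
by rewrite -[k.+1%:R]natr1 mulrDr mulr1 addrA P.
Qed.

Lemma polar z : exists2 t, 0 <= t <= 2 * pi & z = circ (cabs z) t.
Proof.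
have [->|z0] := eqVneq z 0.
  exists 0; first by rewrite lexx mulr_ge0// pi_ge0.
  by rewrite cabs0; apply: cplxP => /=; rewrite mul0r.
have c0 : 0 < cabs z by rewrite cabs_gt0.
set x := Re z / cabs z; set y := Im z / cabs z.
have xy : x ^+ 2 + y ^+ 2 = 1.
  by rewrite /x /y !expr_div_n -mulrDl -cabs_sqr divff// expf_neq0// gt_eqF.
have x1 : -1 <= x <= 1.
  rewrite -ler_norml -ler_sqr ?nnegrE// real_normK ?num_real// expr1n -xy.
  by rewrite lerDl sqr_ge0.
have sy : sin (acos x) = `|y|.
  by rewrite sin_acos// -[RHS]sqrtr_sqr -xy addrAC subrr add0r.
have ax : 0 <= acos x <= pi by rewrite acos_ge0 ?acos_lepi.
have [y0|y0] := leP 0 y.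
  exists (acos x).
    by case/andP: ax => -> H; rewrite (le_trans H)// ler_peMl ?pi_ge0// ler1n.
  apply: cplxP; rewrite ?(Re_circ, Im_circ) ?acosK ?sy ?(ger0_norm y0)//;
  by rewrite mulrC divfK// gt_eqF.
exists (2 * pi - acos x).
  by case/andP: ax => a0 ap; have := pi_ge0 R; lra.
have -> : circ (cabs z) (2 * pi - acos x) = circ (cabs z) (- acos x).
  by have := circ_2pi (cabs z) (- acos x) 1; rewrite mulr1 addrC.
apply: cplxP; rewrite ?(Re_circ, Im_circ) ?cosN ?sinN ?acosK ?sy ?(ltr0_norm y0)//.
  by rewrite mulrC divfK// gt_eqF.
by rewrite opprK mulrC divfK// gt_eqF.
Qed.

Lemma cos_lip s t : `|cos s - cos t| <= `|s - t|.
Proof.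
wlog: s t / s <= t => [H|st].
  by have [/H//|/ltW/H] := leP s t; rewrite distrC (distrC t).
rewrite distrC (distrC s).
have [c _ ->] : exists2 c, c \in `[s, t]%R & cos t - cos s = - sin c * (t - s).
  apply: (@MVT_segment _ cos (fun v => - sin v) s t) => //.
  by apply: continuous_subspaceT => x; apply: continuous_cos.
rewrite normrM ler_piMl// normrN; apply/ler_normlP.
by rewrite lerNl sin_geN1 sin_le1.
Qed.

Lemma sin_lip s t : `|sin s - sin t| <= `|s - t|.
Proof.
wlog: s t / s <= t => [H|st].
  by have [/H//|/ltW/H] := leP s t; rewrite distrC (distrC t).
rewrite distrC (distrC s).
have [c _ ->] : exists2 c, c \in `[s, t]%R & sin t - sin s = cos c * (t - s).
  apply: (@MVT_segment _ sin cos s t) => //.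
  by apply: continuous_subspaceT => x; apply: continuous_sin.
rewrite normrM ler_piMl//; apply/ler_normlP.
by rewrite lerNl cos_geN1 cos_le1.
Qed.

Lemma circ_lip r s t : 0 <= r -> cabs (circ r s - circ r t) <= 2 * r * `|s - t|.
Proof.
move=> r0; rewrite (le_trans (cabs_leD _))// cReD cImD cReN cImN !(Re_circ, Im_circ).
rewrite -!mulrBr !normrM (ger0_norm r0) -mulrDr mulrAC [leRHS]mulrC ler_wpM2l//.
by rewrite mulr_natl mulr2n lerD ?cos_lip ?sin_lip.
Qed.

Lemma circB r s t : circ r t - circ s t = circ (r - s) t.
Proof. by apply: cplxP; rewrite /= mulrBl. Qed.

End Modulus.

Section MaxNorm.
Variable R : realType.
Local Notation C := (R[i]).

Lemma mxnorm_ge0 p q (A : 'M[C]_(p, q)) : 0 <= mxnorm A.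
Proof.
rewrite /mxnorm; elim/big_ind: _ => // [x y x0 y0|i _]; first by rewrite le_max x0.
by elim/big_ind: _ => // [x y x0 y0|j _]; rewrite ?le_max ?x0// cabs_ge0.
Qed.

Lemma mxnormP p q (A : 'M[C]_(p, q)) (c : R) : 0 <= c ->
  mxnorm A <= c <-> (forall i j, cabs (A i j) <= c).
Proof.
move=> c0; split=> [H i j|H].
  apply: le_trans H; rewrite /mxnorm (bigD1 i)//= le_max; apply/orP; left.
  by rewrite (bigD1 j)//= le_max lexx.
rewrite /mxnorm; elim/big_ind: _ => // [x y xc yc|i _]; first by rewrite ge_max xc.
by elim/big_ind: _ => // x y xc yc; rewrite ge_max xc.
Qed.

Lemma mxnorm_le p q (A : 'M[C]_(p, q)) (c : R) : 0 <= c ->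
  (forall i j, cabs (A i j) <= c) -> mxnorm A <= c.
Proof. by move=> c0 H; apply/mxnormP. Qed.

Lemma cabs_mxnorm p q (A : 'M[C]_(p, q)) i j : cabs (A i j) <= mxnorm A.
Proof. by have /mxnormP := mxnorm_ge0 A; move/(_ _ _ A) => [+ _]; apply. Qed.

Lemma mxnorm0 p q : mxnorm (0 : 'M[C]_(p, q)) = 0.
Proof.
by apply/le_anti; rewrite mxnorm_ge0 andbT mxnorm_le// => i j; rewrite mxE cabs0.
Qed.

Lemma mxnorm_eq0 p q (A : 'M[C]_(p, q)) : (mxnorm A == 0) = (A == 0).
Proof.
apply/eqP/eqP => [A0|->]; last exact: mxnorm0.
apply/matrixP => i j; rewrite mxE; apply/eqP; rewrite -cabs_eq0.
by rewrite eq_le cabs_ge0 andbT -A0 cabs_mxnorm.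
Qed.

Lemma mxnorm_gt0 p q (A : 'M[C]_(p, q)) : (0 < mxnorm A) = (A != 0).
Proof. by rewrite lt_def mxnorm_ge0 mxnorm_eq0 andbT. Qed.

Lemma ler_mxnormD p q (A B : 'M[C]_(p, q)) : mxnorm (A + B) <= mxnorm A + mxnorm B.
Proof.
apply: mxnorm_le => [|i j]; first by rewrite addr_ge0 ?mxnorm_ge0.
by rewrite mxE (le_trans (ler_cabsD _ _))// lerD ?cabs_mxnorm.
Qed.

Lemma mxnormZ p q (c : C) (A : 'M[C]_(p, q)) : mxnorm (c *: A) = cabs c * mxnorm A.
Proof.
apply/le_anti/andP; split.
  apply: mxnorm_le => [|i j]; first by rewrite mulr_ge0 ?mxnorm_ge0 ?cabs_ge0.
  by rewrite mxE cabsM ler_wpM2l ?cabs_ge0 ?cabs_mxnorm.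
have [->|c0] := eqVneq c 0; first by rewrite cabs0 mul0r mxnorm_ge0.
have cp : 0 < cabs c by rewrite cabs_gt0.
rewrite mulrC -ler_pdivlMr//.
apply: mxnorm_le => [|i j]; first by rewrite divr_ge0 ?mxnorm_ge0 ?cabs_ge0.
rewrite ler_pdivlMr// mulrC -cabsM.
by have := cabs_mxnorm (c *: A) i j; rewrite mxE.
Qed.

Lemma ler_mxnormM p q r (A : 'M[C]_(p, q)) (B : 'M[C]_(q, r)) :
  mxnorm (A *m B) <= q%:R * (mxnorm A * mxnorm B).
Proof.
apply: mxnorm_le => [|i j]; first by rewrite !mulr_ge0 ?mxnorm_ge0.
rewrite mxE (le_trans (ler_cabs_sum _ _ _))//.
rewrite (@le_trans _ _ (\sum_(k < q) mxnorm A * mxnorm B))//; last first.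
  by rewrite sumr_const card_ord mulr_natl.
by apply: ler_sum => k _; rewrite cabsM ler_pM ?cabs_ge0 ?cabs_mxnorm.
Qed.

End MaxNorm.

(** * Means over circles *)

Section CircleMean.
Variable R : realType.
Local Notation C := (R[i]).
Local Notation Re := complex.Re.
Local Notation Im := complex.Im.
Local Notation mu := (@lebesgue_measure R).

(** The second harmonics [cos (2 t)] and [sin (2 t)] are kept expanded, so that the match with
    [Re (y * circ r t ^+ 2)] and the check of the antiderivative are both settled by [ring]. *)
Definition trig (A b c d e t : R) : R :=
  A + (b * cos t + c * sin t)
    + (d * (cos t * cos t - sin t * sin t) + e * (2 * (sin t * cos t))).

Lemma continuous_trig A b c d e : continuous (trig A b c d e).
Proof.
move=> t.
have c1 := @continuous_cos R t; have s1 := @continuous_sin R t.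
exact: (cvgD (cvgD (cvg_cst _) (cvgD (cvgM (cvg_cst _) c1) (cvgM (cvg_cst _) s1)))
  (cvgD (cvgM (cvg_cst _) (cvgB (cvgM c1 c1) (cvgM s1 s1)))
     (cvgM (cvg_cst _) (cvgM (cvg_cst _) (cvgM s1 c1))))).
Qed.

Lemma integral_trig (A b c d e : R) :
  (\int[mu]_(t in `[0%R, (2 * pi)%R]) (trig A b c d e t)%:E = (2 * pi * A)%:E)%E.
Proof.
pose F : R -> R := fun t =>
  A * t + (b * sin t + (- c) * cos t) + (d * (sin t * cos t) + e * (sin t * sin t)).
have dF (t : R) : is_derive t 1 F (trig A b c d e t).
  rewrite /F; apply: is_derive_eq; rewrite /trig /GRing.scale /=; ring.
have cF : continuous F.
  move=> t; have := dF t => -[/derivable1_diffP/differentiable_continuous H _].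
  exact: H.
rewrite (@continuous_FTC2 _ _ F).
- rewrite /F !mulr0 -EFinB; congr (_%:E).
  rewrite mulr_natl cos2pi sin2pi cos0 sin0; ring.
- by rewrite mulr_gt0// pi_gt0.
- by apply: continuous_subspaceT; apply: continuous_trig.
- split.
  + by move=> t _; case: (dF t).
  + by apply: cvg_at_right_filter; apply: cF.
  + by apply: cvg_at_left_filter; apply: cF.
- by move=> t _; rewrite derive1E; have [_ ->] := dF t.
Qed.

Lemma Re_circ_trig (A r t : R) (x y : C) :
  A + Re (x * circ r t + y * circ r t ^+ 2) =
  trig A (r * Re x) (- (r * Im x)) (r ^+ 2 * Re y) (- (r ^+ 2 * Im y)) t.
Proof. by rewrite expr2 cReD !cReM !cImM !(Re_circ, Im_circ) /trig; ring. Qed.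

Lemma trig_bound (r t : R) (x y : C) : 0 <= r ->
  `|Re (x * circ r t + y * circ r t ^+ 2)| <= cabs x * r + cabs y * r ^+ 2.
Proof.
move=> r0; rewrite (le_trans (normr_Re _))// (le_trans (ler_cabsD _ _))//.
by rewrite (cabsM x) (cabsM y) cabsX !cabs_circ.
Qed.

End CircleMean.

Lemma sumeN_le0 (R : realType) (I : Type) (s : seq I) (f : I -> \bar R) :
  (forall i, f i <= 0)%E -> (\sum_(i <- s) - f i = - \sum_(i <- s) f i)%E.
Proof.
move=> f0; rewrite -[LHS]oppeK -sumeN; first by under [in RHS]eq_bigr do rewrite -[f _]oppeK.
by move=> i j _ _; apply: ge0_adde_def; rewrite inE oppe_ge0 f0.
Qed.

Section Submean.
Variable R : realType.
Local Notation C := (R[i]).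
Local Notation Re := complex.Re.
Local Notation Im := complex.Im.
Local Notation mu := (@lebesgue_measure R).
Variables (p q : nat) (D : set 'M[C]_(p, q)) (u : 'M[C]_(p, q) -> \bar R).
(** Along a Lipschitz curve [- u] is lower semicontinuous. The sign is chosen so that negative [u]
    gives nonnegative integrands. *)
Lemma measurable_curve (g : R -> 'M[C]_(p, q)) (L : R) :
  usc_on D u -> (forall t, D (g t)) -> (forall s t, mxnorm (g s - g t) <= L * `|s - t|) ->
  measurable_fun setT (fun t => - u (g t))%E.
Proof.
move=> [_ usc] Dg lipg; apply: lower_semicontinuous_measurable => t c.
rewrite lteNr -EFinN => cu.
have [d d0 dP] := usc _ (Dg t) _ cu.
have L0 : 0 < `|L| + 1 by rewrite ltr_wpDl.
exists (ball t (d / (`|L| + 1))); first by apply: nbhsx_ballx; rewrite divr_gt0.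
move=> s; rewrite /ball/= ltr_pdivlMr// => st; rewrite lteNr -EFinN; apply: dP => //.
rewrite (le_lt_trans (lipg _ _))// (le_lt_trans _ st)// mulrC distrC ler_wpM2l//.
by rewrite (le_trans (ler_norm _))// lerDl.
Qed.

Hypothesis pshu : psh_on D u.
Hypothesis u0 : forall x, D x -> (u x <= 0)%E.

Lemma circle_lip (a b : 'M[C]_(p, q)) (r s t : R) : 0 <= r ->
  mxnorm ((a + circ r s *: b) - (a + circ r t *: b)) <= 2 * r * mxnorm b * `|s - t|.
Proof.
move=> r0; rewrite opprD addrACA subrr add0r -scalerBl mxnormZ mulrAC.
by rewrite ler_wpM2r ?mxnorm_ge0// circ_lip.
Qed.

(** Both harmonics have mean zero over the circle, so only [A] survives integration. The maximum
    principles below use the submean inequality in this integral-free form; a finite sum is allowed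
    because [family_max] treats several discs at once. *)
Lemma submean_sum (I : finType) (a b : I -> 'M[C]_(p, q)) (r A : R) (x y : C) :
  0 < r -> (forall j z, cabs z <= r -> D (a j + z *: b j)) ->
  (forall t, \sum_j u (a j + circ r t *: b j)%R
             <= (A + Re (x * circ r t + y * circ r t ^+ 2))%:E)%E ->
  (\sum_j u (a j) <= A%:E)%E.
Proof.
move=> r0 Dab H; have r0' := ltW r0.
have Dc j t : D (a j + circ r t *: b j) by apply: Dab; rewrite cabs_circ.
have Da j : D (a j) by have := Dab j 0; rewrite scale0r addr0 cabs0; apply.
pose J := `[0%R, (2 * pi)%R] : set R.
have mJ : measurable J by exact: measurable_itv.
have pi2 : 0 < 2 * pi :> R by rewrite mulr_gt0// pi_gt0.
pose k : R := (2 * pi)^-1; have k0 : 0 < k by rewrite invr_gt0.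
pose G j t := (k%:E * - u (a j + circ r t *: b j)%R)%E.
have mu0 j : measurable_fun J (fun t => - u (a j + circ r t *: b j)%R)%E.
  apply: measurable_funTS; apply: measurable_curve => // [|s t]; first by case: pshu.
  exact: circle_lip.
have mG j : measurable_fun J (G j) by apply: measurable_funeM; apply: mu0.
have uN0 j t : (0 <= - u (a j + circ r t *: b j)%R)%E by rewrite oppe_ge0 u0.
have G0 j t : (0 <= G j t)%E by rewrite mule_ge0// lee_fin ltW.
pose X j := (\int[mu]_(t in J) G j t)%E.
have uX j : (X j <= - u (a j))%E.
  rewrite leeNr; have [_ /(_ (a j) (b j) r (Da j) r0 (Dab j))] := pshu.
  move=> /le_trans; apply.
  rewrite /X ge0_integralZl_EFin//; [|exact: mu0|exact: ltW].
  rewrite -muleN lee_pmul2l// -integral_ge0N; last by move=> t _; apply: uN0.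
  rewrite le_eqVlt; apply/orP; left; apply/eqP.
  by apply: eq_integral => t _; rewrite oppeK.
suff AX : ((- A)%:E <= \sum_j X j)%E.
  have -> : (\sum_j u (a j) = - \sum_j (- u (a j)))%E.
    by rewrite sumeN_le0 ?oppeK// => j; apply: u0.
  by rewrite leeNl -EFinN (le_trans AX)// lee_sum.
rewrite /X -ge0_integral_sum//.
pose S t := (\sum_j G j t)%E.
have S0 t : (0 <= S t)%E by apply: sume_ge0.
have mS : measurable_fun J S by apply: emeasurable_sum.
(* [M] is large enough to make the shifted majorant [h] nonnegative. Integrals are then compared
   between nonnegative functions, without knowing that [u] is integrable on the circle, and [M]
   cancels at the end. *)
pose B := `|A| + (cabs x * r + cabs y * r ^+ 2).
have [M ME] : exists M, M = k * B by exists (k * B).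
have B0 : 0 <= B by rewrite !addr_ge0 ?mulr_ge0 ?cabs_ge0 ?exprn_ge0.
have M0 : 0 <= M by rewrite ME mulr_ge0// ltW.
pose h t := trig (M - k * A) (r * Re (- k%:C%C * x)) (- (r * Im (- k%:C%C * x)))
   (r ^+ 2 * Re (- k%:C%C * y)) (- (r ^+ 2 * Im (- k%:C%C * y))) t.
have hE t : h t = M - k * (A + Re (x * circ r t + y * circ r t ^+ 2)).
  rewrite /h -Re_circ_trig -!mulrA -mulrDr cReM cReN cImN /=; ring.
have h0 t : 0 <= h t.
  rewrite hE subr_ge0 ME ler_pM2l// (le_trans (ler_norm _))//.
  by rewrite (le_trans (ler_normD _ _))// lerD2l trig_bound.
have hS t : ((h t)%:E <= S t + M%:E)%E.
  rewrite hE addrC EFinD leeD2r//.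
  have -> : (S t = k%:E * - (\sum_j u (a j + circ r t *: b j)%R))%E.
    by rewrite -sumeN_le0 ?ge0_sume_distrr// => j; apply: u0.
  by rewrite -mulrN EFinM lee_pmul2l// EFinN leeN2.
have mh : measurable_fun J (EFin \o h).
  apply/measurable_EFinP; apply: measurable_funTS.
  by apply: continuous_measurable_fun; apply: continuous_trig.
have : (\int[mu]_(t in J) (h t)%:E <= \int[mu]_(t in J) (S t + M%:E))%E.
  apply: ge0_le_integral => //; first by move=> t _; rewrite lee_fin.
  by apply: emeasurable_funD.
rewrite ge0_integralD//.
have -> : (\int[mu]_(_ in J) M%:E = (2 * pi * M)%:E)%E.
  by rewrite -(integral_trig M 0 0 0 0); apply: eq_integral => t _; rewrite /trig !mul0r !addr0.
rewrite integral_trig.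
have -> : 2 * pi * (M - k * A) = - A + 2 * pi * M.
  by rewrite mulrBr mulrA mulfV ?gt_eqF// mul1r addrC.
by rewrite EFinD leeD2rE.
Qed.

End Submean.

(** * Maximum principles and Liouville *)

Section Logarithm.
Variable R : realType.
Local Notation C := (R[i]).
Local Notation Re := complex.Re.
Local Notation Im := complex.Im.

(** As a function of [y = 1 + x], right side minus left side has derivative [(y - 1)^3 / y], hence
    its minimum at [y = 1], where it vanishes. *)
Lemma ln1D_le3 (x : R) : -1 < x -> ln (1 + x) <= x - x ^+ 2 / 2 + x ^+ 3 / 3.
Proof.
move=> x1.
pose g : R -> R := fun y => (y - 1) - 2^-1 * ((y - 1) * (y - 1))
  + 3^-1 * ((y - 1) * ((y - 1) * (y - 1))) - ln y.
have dg (y : R) : 0 < y -> is_derive y 1 g ((y - 1) * ((y - 1) * (y - 1)) / y).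
  move=> y0; have dln := is_derive1_ln y0.
  by rewrite /g; apply: is_derive_eq; rewrite /GRing.scale /=; field; rewrite gt_eqF.
have cg (y : R) : 0 < y -> {for y, continuous g}.
  by move=> y0; have := dg _ y0 => -[/derivable1_diffP/differentiable_continuous].
have g1 : g 1 = 0 by rewrite /g ln1 !subrr; ring.
have cw (a b : R) : 0 < a -> {within `[a, b], continuous g}.
  move=> a0; apply: continuous_in_subspaceT => y /[!inE] /=; rewrite in_itv/= => /andP[ay _].
  by apply: cg; apply: lt_le_trans ay.
suff : 0 <= g (1 + x).
  rewrite /g subr_ge0 => /le_trans; apply; rewrite [1 + x]addrC addrK; lra.
have [x0|x0] := leP 0 x.
  have [|||c] := @MVT_segment _ g (fun y => (y - 1) * ((y - 1) * (y - 1)) / y) 1 (1 + x).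
  - by rewrite lerDl.
  - by move=> y; rewrite in_itv/= => /andP[y1 _]; apply: dg; apply: lt_trans y1.
  - exact: cw.
  rewrite in_itv/= => /andP[c1 _]; rewrite g1 subr0 => ->.
  rewrite mulr_ge0 ?divr_ge0 ?mulr_ge0 ?subr_ge0//; last by rewrite lerDl.
  by rewrite (le_trans _ c1).
have [|||c] := @MVT_segment _ g (fun y => (y - 1) * ((y - 1) * (y - 1)) / y) (1 + x) 1.
- by rewrite gerDl ltW.
- move=> y; rewrite in_itv/= => /andP[y1 _]; apply: dg; apply: lt_trans y1; lra.
- by apply: cw; lra.
rewrite in_itv/= => /andP[c0 c1]; rewrite g1 sub0r => /eqP; rewrite eqr_oppLR => /eqP ->.
have cp : 0 < c by lra.
rewrite -mulrN mulr_le0// ?oppr_le0 ?subr_ge0; last lra.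
rewrite mulr_le0_ge0 ?invr_ge0 ?(ltW cp)// mulr_le0_ge0 ?subr_le0//.
by rewrite -expr2 sqr_ge0.
Qed.

(** [ln1D_le3] is applied to [|1 + w|^2 - 1 = 2 Re w + |w|^2]. After halving, the cubic terms amount
    to [9/2 + 1]; the constant 10 is a round bound. *)
Lemma ln_cabs1D (w : C) : cabs w <= 1 / 2 ->
  ln (cabs (1 + w)) <= Re w - Re (w ^+ 2) / 2 + 10 * cabs w ^+ 3.
Proof.
move=> w2; set m := cabs w in w2 *; have m0 : 0 <= m by apply: cabs_ge0.
have w1 : 0 < cabs (1 + w).
  by have := ler_distcabs 1 (- w); rewrite opprK cabsN cabs1 -/m; lra.
set a := Re w; set s := m ^+ 2.
have am : `|a| <= m by apply: normr_Re.
have [am1 am2] : - m <= a /\ a <= m by move: am; rewrite ler_norml => /andP.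
have E : cabs (1 + w) ^+ 2 = 1 + (2 * a + s).
  by rewrite cabs_sqr cReD cImD /s cabs_sqr /=; ring.
have R2 : Re (w ^+ 2) = 2 * a ^+ 2 - s.
  by rewrite /s cabs_sqr expr2 cReM -/a; ring.
have := @ln1D_le3 (2 * a + s); rewrite -E lnXn// R2 => H.
have {}H := H _.
have : -1 < 2 * a + s.
  by rewrite -subr_gt0 opprK addrC -E exprn_gt0.
move/H => {}H; have s0 : 0 <= s by rewrite exprn_ge0.
have sm : s <= m by rewrite /s expr2; nra.
have x3 : (2 * a + s) ^+ 3 <= (3 * m) ^+ 3.
  have [x0|x0] := leP 0 (2 * a + s).
    by rewrite lerXn2r ?nnegrE ?mulr_ge0//; lra.
  rewrite (@le_trans _ _ 0) ?exprn_ge0 ?mulr_ge0// exprS mulr_le0_ge0 ?sqr_ge0//.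
  exact: ltW.
have as_ : - (a * s) <= m ^+ 3.
  by rewrite exprSr -/s -mulNr mulrC ler_wpM2l//; lra.
have s2 : 0 <= s ^+ 2 by rewrite sqr_ge0.
have m3 : 0 <= m ^+ 3 by rewrite exprn_ge0.
have : ln (cabs (1 + w)) *+ 2 <=
  2 * a + s - (2 * a + s) ^+ 2 / 2 + (3 * m) ^+ 3 / 3.
  by rewrite (le_trans H)// lerD2l ler_pM2r.
have -> : (2 * a + s) ^+ 2 = 4 * a ^+ 2 + 4 * (a * s) + s ^+ 2 by ring.
have -> : (3 * m) ^+ 3 = 27 * m ^+ 3 by ring.
rewrite mulr2n; lra.
Qed.

End Logarithm.

Section OneVariable.
Variable R : realType.
Local Notation C := (R[i]).
Local Notation Re := complex.Re.
Local Notation Im := complex.Im.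

(** The one-variable form of what [submean_sum] delivers: only majorants that are a constant plus
    the real part of a quadratic polynomial in the displacement are tested. *)
Definition submean_at (f : C -> \bar R) (z : C) (r : R) : Prop :=
  forall (A : R) (x y : C),
    (forall t, f (z + circ r t)%R <= (A + Re (x * circ r t + y * circ r t ^+ 2))%:E)%E ->
    (f z <= A%:E)%E.

Lemma lee_addr (x y : \bar R) :
  (forall e : R, 0 < e -> (x <= y + e%:E)%E) -> (x <= y)%E.
Proof. by move=> H; apply/lee_addgt0Pr. Qed.

Lemma lee_real_above (x y : \bar R) : (x < +oo)%E ->
  (forall c : R, (x < c%:E)%E -> (y <= c%:E)%E) -> (y <= x)%E.
Proof.
case: x => [x| |]// _ H.
  by apply: lee_addr => e e0; rewrite -EFinD; apply: H; rewrite lte_fin ltrDl.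
case: y H => [y| |]// H.
  have := H (y - 1) (ltNyr _); rewrite lee_fin => yy; exfalso; lra.
by have := H 0 (ltNyr _); rewrite leye_eq.
Qed.

(* A strict submean gain of order r^2 at every point away from the collars
   forces the supremum of f - h + d|z|^2 to be approached on the collars, so
   no maximum needs to be attained. *)
Lemma annulus_max (f : C -> \bar R) (a b r1 r2 e : R) :
  0 <= a -> 0 < r1 -> 0 < e ->
  (forall z, r1 <= cabs z <= r2 -> (f z <= 0)%E) ->
  (forall (z : C) (r : R), 0 < r -> r1 <= cabs z - r -> cabs z + r <= r2 -> submean_at f z r) ->
  (forall z, r1 <= cabs z <= r1 + e -> (f z <= (a * ln (cabs z) + b)%:E)%E) ->
  (forall z, r2 - e <= cabs z <= r2 -> (f z <= (a * ln (cabs z) + b)%:E)%E) ->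
  forall z, r1 <= cabs z <= r2 -> (f z <= (a * ln (cabs z) + b)%:E)%E.
Proof.
move=> a0 r10 e0 f0 fsub Hin Hout z0 z0r.
apply: lee_addr => d' d'0.
have r20 : 0 < r2 by case/andP: z0r => ? H; apply: lt_le_trans r10 (le_trans _ H).
have [d d0 dr2] : exists2 d, 0 < d & d * r2 ^+ 2 = d'.
  exists (d' / r2 ^+ 2); first by rewrite divr_gt0// exprn_gt0.
  by rewrite divfK// gt_eqF// exprn_gt0.
have a20 : 0 < 20 * a + 1 by rewrite ltr_wpDl ?mulr_ge0.
case fz0: (f z0) => [v| |]; [|by have := f0 _ z0r; rewrite fz0|by rewrite leNye].
pose E : set R := fun x => exists z, r1 <= cabs z <= r2 /\
  f z = (x + a * ln (cabs z) + b - d * cabs z ^+ 2)%:E.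
have lnr1 z : r1 <= cabs z -> ln r1 <= ln (cabs z).
  by move=> zr; rewrite ler_ln ?posrE//; apply: lt_le_trans zr.
have dz z : r1 <= cabs z <= r2 -> d * cabs z ^+ 2 <= d'.
  case/andP => _ zr; rewrite -dr2 ler_pM2l// lerXn2r ?nnegrE ?cabs_ge0//.
  exact: ltW.
have subE : has_ubound E.
  exists (d' - a * ln r1 - b) => x [z [zr fz]].
  have := f0 _ zr; rewrite fz lee_fin => H.
  have := dz _ zr; case/andP: zr => /lnr1 zr _.
  have := ler_wpM2l a0 zr; lra.
pose S := sup E.
have inE0 : E (v - a * ln (cabs z0) - b + d * cabs z0 ^+ 2).
  by exists z0; split=> //; rewrite fz0; congr (_%:E); ring.
have HS z : r1 <= cabs z <= r2 ->
    (f z <= (S + a * ln (cabs z) + b - d * cabs z ^+ 2)%:E)%E.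
  move=> zr; case fz: (f z) => [x| |]; [|by have := f0 _ zr; rewrite fz|by rewrite leNye].
  have /(ub_le_sup subE) : E (x - a * ln (cabs z) - b + d * cabs z ^+ 2).
    by exists z; split=> //; rewrite fz; congr (_%:E); ring.
  rewrite -/S lee_fin; lra.
(* The bound [e] keeps the circle inside the annulus, [r1 / 2] gives [|w / z| <= 1/2] as [ln_cabs1D]
   requires, and the third bound makes the cubic error at most half of the gain [d r^2]. *)
pose r := Num.min e (Num.min (r1 / 2) (d * r1 ^+ 3 / (20 * a + 1))).
have r0 : 0 < r.
  rewrite !lt_min e0 divr_gt0//=.
  by apply: divr_gt0 => //; apply: mulr_gt0 => //; rewrite exprn_gt0.
have re : r <= e by rewrite ge_min lexx.
have rr1 : r <= r1 / 2 by rewrite !ge_min lexx orbT.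
have rd : r * (20 * a + 1) <= d * r1 ^+ 3.
  by rewrite -ler_pdivlMr// !ge_min lexx !orbT.
have gain : 10 * a * (r / r1) ^+ 3 <= d * r ^+ 2 / 2.
  rewrite expr_div_n exprSr !mulrA ler_pdivrMr ?exprn_gt0//.
  have r2p : 0 < r ^+ 2 by rewrite exprn_gt0.
  have : r ^+ 2 * (r * (20 * a)) <= r ^+ 2 * (d * r1 ^+ 3).
    by rewrite ler_pM2l// (le_trans _ rd)// ler_pM2l// lerDl.
  lra.
have step x : E x -> x <= Num.max (S - d * r ^+ 2 / 2) d'.
  move=> [z [zr fz]]; rewrite le_max; apply/orP.
  have [zin|zin] := leP (cabs z) (r1 + e).
    right; have zc : r1 <= cabs z <= r1 + e by rewrite zin andbT; case/andP: zr.
    have := Hin _ zc; have := dz _ zr; rewrite fz lee_fin; lra.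
  have [zout|zout] := leP (r2 - e) (cabs z).
    right; have zc : r2 - e <= cabs z <= r2 by rewrite zout; case/andP: zr.
    have := Hout _ zc; have := dz _ zr; rewrite fz lee_fin; lra.
  left; have /andP[z1 z2] := zr.
  have cz0 : 0 < cabs z by apply: lt_le_trans z1.
  have zn0 : z != 0 by rewrite -cabs_gt0.
  have zrr : r1 <= cabs z - r by lra.
  have zrr2 : cabs z + r <= r2 by lra.
  have : (f z <= (S + a * ln (cabs z) + b - d * cabs z ^+ 2 - d * r ^+ 2
      + 10 * a * (r / cabs z) ^+ 3)%:E)%E.
    (* The coefficients are those of the holomorphic linear and quadratic terms in [w] of
       [a ln |z + w| - d |z + w|^2]. What is left at second order is [- d |w|^2], constant on the
       circle: this is the gain. *)
    apply: (fsub z r r0 zrr zrr2 _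
      (a%:C%C / z - (2 * d)%:C%C * z^*%C) (- (a / 2)%:C%C / z ^+ 2)).
    move=> t; set w := circ r t; have cw : cabs w = r by rewrite cabs_circ// ltW.
    have zw : r1 <= cabs (z + w) <= r2.
      apply/andP; split; last by rewrite (le_trans (ler_cabsD _ _))// cw.
      by have := ler_distcabs z (- w); rewrite opprK cabsN cw; lra.
    apply: (le_trans (HS _ zw)); rewrite lee_fin cabs_sqrD cw.
    have wz : cabs (w / z) = r / cabs z by rewrite cabsM cabsV cw.
    have -> : z + w = z * (1 + w / z) by rewrite mulrDr mulr1 mulrCA divff// mulr1.
    have wz2 : cabs (w / z) <= 1 / 2.
      by rewrite wz ler_pdivrMr// mul1r mulrC ler_pdivlMr//; lra.
    have c1 : 0 < cabs (1 + w / z).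
      by have := ler_distcabs 1 (- (w / z)); rewrite opprK cabsN cabs1; lra.
    rewrite cabsM lnM ?posrE//.
    have := ler_wpM2l a0 (ln_cabs1D wz2); rewrite wz.
    have -> : Re ((a%:C%C / z - (2 * d)%:C%C * z^*%C) * w + - (a / 2)%:C%C / z ^+ 2 * w ^+ 2)
       = a * Re (w / z) - 2 * d * Re (z^*%C * w) - a * (Re ((w / z) ^+ 2) / 2).
      have RZ (k : R) (w' : C) : Re (k%:C%C * w') = k * Re w'.
        by rewrite cReM /= mul0r subr0.
      rewrite mulrBl cReD cReD cReN.
      have -> : a%:C%C / z * w = a%:C%C * (w / z) by rewrite mulrAC mulrA.
      have -> : - (a / 2)%:C%C / z ^+ 2 * w ^+ 2 = - ((a / 2)%:C%C * (w / z) ^+ 2).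
        by rewrite expr_div_n; move: (z ^+ 2)^-1 (w ^+ 2) => Z2 W2; ring.
      by rewrite -[_ * z^*%C * w]mulrA cReN !RZ; lra.
    rewrite mulrDr; lra.
  rewrite fz lee_fin => H.
  have : 10 * a * (r / cabs z) ^+ 3 <= 10 * a * (r / r1) ^+ 3.
    rewrite ler_wpM2l ?mulr_ge0// lerXn2r ?nnegrE ?divr_ge0 ?(ltW r0) ?(ltW r10) ?(ltW cz0)//.
    by rewrite ler_pM2l// lef_pV2 ?posrE.
  lra.
have Smax : S <= Num.max (S - d * r ^+ 2 / 2) d' by apply: ge_sup => //; exists (v - a * ln (cabs z0) - b + d * cabs z0 ^+ 2).
have Sd : S <= d'.
  move: Smax; rewrite le_max => /orP[|//].
  have : 0 < d * r ^+ 2 by rewrite mulr_gt0 ?exprn_gt0.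
  lra.
have := HS _ z0r; rewrite fz0 -EFinD !lee_fin.
have : 0 <= d * cabs z0 ^+ 2 by rewrite mulr_ge0 ?exprn_ge0 ?cabs_ge0 ?ltW.
lra.
Qed.

(** On a large annulus [f] is compared with [c + e (ln |z| - ln r1)]. Semicontinuity at 0 controls
    the inner collar, [f <= 0] the outer one, and [e] tends to 0. *)
Lemma liouville_le (f : C -> \bar R) :
  (forall z, (f z <= 0)%E) -> (forall (z : C) (r : R), 0 < r -> submean_at f z r) ->
  (forall c : R, (f 0%R < c%:E)%E ->
     exists2 d : R, 0 < d & forall z, cabs z < d -> (f z < c%:E)%E) ->
  forall z, (f z <= f 0%R)%E.
Proof.
move=> f0 fsub fusc z0; apply: lee_real_above.
  by rewrite (le_lt_trans (f0 _)).
move=> c /fusc [d d0 fd].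
have [z0d|z0d] := ltP (cabs z0) d; first exact: ltW (fd _ z0d).
pose r1 := d / 2; have r10 : 0 < r1 by rewrite divr_gt0.
have z0p : 0 < cabs z0 by apply: lt_le_trans z0d.
have r1z0 : r1 <= cabs z0 by apply: le_trans z0d; rewrite /r1; lra.
pose L := ln (cabs z0) - ln r1.
have L0 : 0 <= L by rewrite subr_ge0 ler_ln.
apply: lee_addr => e' e'0.
pose e := e' / (L + 1).
have e0 : 0 < e by rewrite divr_gt0// ltr_wpDl.
have eL : e * L <= e'.
  by rewrite -[leRHS](@divfK _ (L + 1)) ?gt_eqF ?ltr_wpDl// -/e ler_pM2l// lerDl.
(* [expR K] is the radius beyond which the comparison function is nonnegative. *)
pose K := ln r1 - c / e.
pose r2 := Num.max (cabs z0) (expR K) + d / 4.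
have d4 : 0 < d / 4 by rewrite divr_gt0.
have H : (f z0 <= (e * ln (cabs z0) + (c - e * ln r1))%:E)%E.
  apply: (@annulus_max f e _ r1 r2 (d / 4)) => //.
  - exact: ltW.
  - by move=> z r r0 _ _; apply: fsub.
  - move=> z /andP[z1 z2]; rewrite (le_trans (ltW (fd _ _)))//.
      by apply: le_lt_trans z2 _; rewrite /r1; lra.
    have : e * ln r1 <= e * ln (cabs z).
      by rewrite ler_pM2l// ler_ln ?posrE//; apply: lt_le_trans z1.
    rewrite lee_fin; lra.
  - move=> z; rewrite /r2 addrK => /andP[z1 _]; apply: (le_trans (f0 _)).
    have Kz : K <= ln (cabs z).
      rewrite -[K]expRK ler_ln ?posrE ?expR_gt0//.
        by apply: le_trans z1; rewrite le_max lexx orbT.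
      by apply: lt_le_trans z1; rewrite lt_max z0p.
    have := Kz; rewrite -(ler_pM2l e0) /K mulrBr mulrCA divff ?gt_eqF// mulr1.
    rewrite lee_fin; lra.
  - rewrite r1z0 /r2 (@le_trans _ _ (Num.max (cabs z0) (expR K)))//.
      by rewrite le_max lexx.
    by rewrite lerDl ltW.
apply: (le_trans H); rewrite -EFinD lee_fin.
by move: eL; rewrite /L mulrBr; lra.
Qed.

(** A Schwarz lemma, by comparison with [(1 - e) ln |z|]: close to 0 the missing [e ln |z|] absorbs
    [c], and on the collar between radii 1 and [R0] the comparison function is nonnegative. The
    conclusion involves neither [c] nor [d], which depend on the competitor, so it survives the
    supremum in [green]. *)
Lemma log_pole_bound (f : C -> \bar R) (c d R0 : R) :
  1 < R0 -> 0 < d ->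
  (forall z, cabs z <= R0 -> (f z <= 0)%E) ->
  (forall (z : C) (r : R), 0 < r -> cabs z + r <= R0 -> submean_at f z r) ->
  (forall z, 0 < cabs z < d -> (f z <= (ln (cabs z) + c)%:E)%E) ->
  forall z, 0 < cabs z <= 1 -> (f z <= (ln (cabs z))%:E)%E.
Proof.
move=> R1 d0 f0 fsub fpole z0 /andP[z00 z01].
have L0 : ln (cabs z0) <= 0 by apply: ln_le0.
apply: lee_addr => e' e'0.
pose e := Num.min (1 / 2) (e' / (1 - ln (cabs z0))).
have L1 : 0 < 1 - ln (cabs z0) by lra.
have e0 : 0 < e by rewrite lt_min divr_gt0//= divr_gt0.
have e1 : e <= 1 / 2 by rewrite ge_min lexx.
have eL : e * (1 - ln (cabs z0)) <= e' by rewrite -ler_pdivlMr// ge_min lexx orbT.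
pose r1 := Num.min (Num.min (d / 4) (expR (- c / e) / 2)) (cabs z0).
have r10 : 0 < r1 by rewrite !lt_min !divr_gt0 ?expR_gt0.
have r1d : r1 <= d / 4 by rewrite !ge_min lexx.
have r1c : r1 <= expR (- c / e) / 2 by rewrite !ge_min lexx orbT.
have H : (f z0 <= ((1 - e) * ln (cabs z0) + 0)%:E)%E.
  apply: (@annulus_max f _ _ r1 R0 (Num.min r1 (R0 - 1))) => //.
  - by lra.
  - by rewrite lt_min r10 subr_gt0.
  - by move=> z /andP[_]; apply: f0.
  - by move=> z r r0 _; apply: fsub.
  - move=> z /andP[z1 z2].
    have zr : cabs z <= r1 + r1 by apply: (le_trans z2); rewrite lerD2l ge_min lexx.
    have zp : 0 < cabs z by apply: lt_le_trans z1.
    apply: (le_trans (fpole _ _)); first by rewrite zp /=; lra.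
    have : ln (cabs z) <= - c / e.
      by rewrite -[leRHS]expRK ler_ln ?posrE ?expR_gt0//; lra.
    by rewrite ler_pdivlMr// lee_fin; lra.
  - move=> z /andP[z1 z2]; apply: (le_trans (f0 _ z2)).
    have z11 : 1 <= cabs z.
      have : Num.min r1 (R0 - 1) <= R0 - 1 by rewrite ge_min lexx orbT.
      lra.
    by rewrite lee_fin addr0 mulr_ge0 ?ln_ge0//; lra.
  - by rewrite !ge_min lexx orbT /=; lra.
apply: (le_trans H); rewrite -EFinD lee_fin; lra.
Qed.

End OneVariable.

(** * Negative plurisubharmonic functions along complex lines *)

Section PshLines.
Variable R : realType.
Local Notation C := (R[i]).
Variables (p q : nat) (D : set 'M[C]_(p, q)) (u : 'M[C]_(p, q) -> \bar R).
Hypothesis pshu : psh_on D u.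
Hypothesis u0 : forall x, D x -> (u x <= 0)%E.

Lemma psh_submean_at (a b : 'M[C]_(p, q)) (z : C) (r : R) :
  0 < r -> (forall w, cabs w <= r -> D (a + (z + w) *: b)) ->
  submean_at (fun z => u (a + z *: b)) z r.
Proof.
move=> r0 Dab A x y H.
have := @submean_sum R p q D u pshu u0 'I_1 (fun _ => a + z *: b) (fun _ => b) r A x y r0.
rewrite big_ord1; apply=> [_ w wr|t]; first by rewrite -addrA -scalerDl; apply: Dab.
by rewrite big_ord1 -addrA -scalerDl; apply: H.
Qed.

Lemma usc_line (a b : 'M[C]_(p, q)) (c : R) :
  (forall z, D (a + z *: b)) -> (u a < c%:E)%E ->
  exists2 d : R, 0 < d & forall z, cabs z < d -> (u (a + z *: b)%R < c%:E)%E.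
Proof.
move=> Dab uc; have [[_ usc] _] := pshu.
have Da : D a by have := Dab 0; rewrite scale0r addr0.
have [d d0 dP] := usc _ Da _ uc.
have e0 : 0 < mxnorm b + 1 by rewrite ltr_wpDl// mxnorm_ge0.
exists (d / (mxnorm b + 1)); first by rewrite divr_gt0.
move=> z; rewrite ltr_pdivlMr// => zd; apply: dP => //.
rewrite addrAC subrr add0r mxnormZ (le_lt_trans _ zd)// ler_wpM2l ?cabs_ge0//.
by rewrite lerDl.
Qed.

Lemma psh_line_le (a b : 'M[C]_(p, q)) :
  (forall z, D (a + z *: b)) -> (u (a + b)%R <= u a)%E.
Proof.
move=> Dab; have := @liouville_le R (fun z => u (a + z *: b)) _ _ _ 1.
rewrite scale0r addr0 scale1r; apply.
- by move=> z; apply: u0.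
- by move=> z r r0; apply: psh_submean_at.
- by move=> c; apply: usc_line.
Qed.

(** The same line read from [a + b] back to [a] gives the reverse inequality. *)
Lemma psh_line_eq (a b : 'M[C]_(p, q)) :
  (forall z, D (a + z *: b)) -> u (a + b) = u a.
Proof.
move=> Dab; apply/le_anti; rewrite psh_line_le//=.
have {1}-> : a = a + b + - b by rewrite addrK.
apply: psh_line_le => z; have := Dab (1 - z).
by rewrite scalerBl scale1r scalerN addrA.
Qed.

End PshLines.

(** On the disc [P + z b] the norm of [b] only changes the pole constant, which [log_pole_bound]
    then removes. *)
Lemma green_class_pole (R : realType) (p q : nat) (D : set 'M[R[i]]_(p, q)) P u b (R0 : R) :
  green_class D P u -> b != 0 -> 1 < R0 ->
  (forall z : R[i], cabs z <= R0 -> D (P + z *: b)) ->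
  forall z : R[i], 0 < cabs z <= 1 -> (u (P + z *: b)%R <= (ln (cabs z))%:E)%E.
Proof.
move=> [uneg [pshu [c [d d0 pole]]]] b0 R1 Db z z1.
have u0 x : D x -> (u x <= 0)%E by move=> /uneg/ltW.
have nb : 0 < mxnorm b by rewrite mxnorm_gt0.
apply: (@log_pole_bound R (fun z => u (P + z *: b)) (ln (mxnorm b) + c)
  (Num.min R0 (d / mxnorm b)) R0) => //.
- by rewrite lt_min divr_gt0// andbT (lt_trans _ R1).
- by move=> w wR; apply/u0/Db.
- move=> w r r0 wr; apply: (psh_submean_at pshu) => // v vr; apply: Db.
  by rewrite (le_trans (ler_cabsD _ _))// (le_trans _ wr)// lerD2l.
- move=> w /andP[w0]; rewrite lt_min => /andP[wR wd].
  have := pole (P + w *: b); rewrite addrAC subrr add0r mxnormZ lnM ?posrE// addrA.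
  apply.
  + by apply: Db; apply: ltW.
  + by rewrite -subr_eq0 addrAC subrr add0r scaler_eq0 (negbTE b0) orbF -cabs_gt0.
  + by rewrite -ltr_pdivlMr.
Qed.

(** * Triangular forms, companion matrices and cyclic vectors *)

Section Triangular.
Variable F : fieldType.

Lemma trig_mulmx n (A B : 'M[F]_n) : is_trig_mx A -> is_trig_mx B ->
  is_trig_mx (A *m B) /\ forall i, (A *m B) i i = A i i * B i i.
Proof.
move=> /is_trig_mxP tA /is_trig_mxP tB; split.
  apply/is_trig_mxP => i j ij; rewrite mxE big1// => k _.
  by have [ik|ki] := ltnP i k; [rewrite tA ?mul0r|rewrite tB ?mulr0// (leq_ltn_trans ki)].
move=> i; rewrite mxE (bigD1 i)//= big1 ?addr0// => k ki.
have [ik|ik] := ltnP i k; first by rewrite tA ?mul0r.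
by rewrite tB ?mulr0// ltn_neqAle ki ik.
Qed.

Lemma horner_trig n (T : 'M[F]_n.+1) (p : {poly F}) : is_trig_mx T ->
  is_trig_mx (horner_mx T p) /\ forall i, (horner_mx T p) i i = p.[T i i].
Proof.
move=> tT; elim/poly_ind: p => [|p c [tp dp]].
  by rewrite rmorph0; split=> [|i]; rewrite ?mx0_is_trig// mxE horner0.
have [tM dM] := trig_mulmx tp tT.
rewrite rmorphD rmorphM /= horner_mx_X horner_mx_C -[_ * T]/(_ *m T); split.
  apply/is_trig_mxP => i j ij; rewrite mxE (is_trig_mxP _ _)// add0r mxE.
  by rewrite -val_eqE/= ltn_eqF.
by move=> i; rewrite mxE dM dp !mxE eqxx hornerD hornerM hornerX hornerC.
Qed.

Lemma mxrank_sum_le m n (I : Type) (s : seq I) (P : pred I) (A : I -> 'M[F]_(m, n)) :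
  (\rank (\sum_(i <- s | P i) A i)%R <= \sum_(i <- s | P i) \rank (A i))%N.
Proof.
elim/big_rec2: _ => [|i k B _ kB]; first by rewrite mxrank0.
by rewrite (leq_trans (mxrank_add _ _))// leq_add2l.
Qed.

(** Putting ones at the zero diagonal entries makes [T] invertible, and this correction has rank at
    most the number of those entries; subadditivity of the rank concludes. *)
Lemma trig_rank_ge n (T : 'M[F]_n) : is_trig_mx T ->
  (#|[pred i | T i i != 0%R]| <= \rank T)%N.
Proof.
move=> tT; pose D := \sum_(i < n | T i i == 0) delta_mx i i : 'M[F]_n.
have DE i j : D i j = ((i == j) && (T i i == 0))%:R.
  rewrite summxE; have [<-|ij] /= := eqVneq i j; last first.
    rewrite big1// => k _; rewrite mxE; case: eqP => //= <-.
    by rewrite eq_sym (negbTE ij).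
  rewrite (eq_bigr (fun k => (k == i)%:R)); last first.
    by move=> k _; rewrite mxE andbb eq_sym.
  have [Ti|Ti] := eqVneq (T i i) 0.
    rewrite (bigD1 i) ?Ti ?eqxx//= big1 ?addr0// => k /andP[_ /negbTE ->].
    by [].
  by rewrite big1// => k; case: (k =P i) => [->|//]; rewrite (negbTE Ti).
have tTD : is_trig_mx (T + D).
  have /is_trig_mxP tT' := tT.
  apply/is_trig_mxP => i j ij; rewrite mxE tT'// DE.
  by rewrite -val_eqE/= ltn_eqF// addr0.
have uTD : T + D \in unitmx.
  rewrite unitmxE det_trig// unitfE; apply/prodf_neq0 => i _.
  rewrite mxE DE eqxx/=; case: (eqVneq (T i i) 0) => [->|Ti]; first by rewrite add0r oner_eq0.
  by rewrite addr0.
have rD : (\rank D <= #|[pred i | T i i == 0%R]|)%N.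
  rewrite (leq_trans (mxrank_sum_le _ _ _))// -sum1_card leq_sum// => i _.
  by rewrite mxrank_delta.
have := mxrank_add T D; rewrite mxrank_unit//.
rewrite -[X in (X <= _)%N](card_ord n) -(cardC [pred i | T i i == 0]) addnC => H.
rewrite -(leq_add2r (\rank D)) (leq_trans _ H)// leq_add//.
Qed.

Lemma char_poly_tr n (A : 'M[F]_n) : char_poly A^T = char_poly A.
Proof.
rewrite /char_poly -det_tr; congr (\det _).
by apply/matrixP => i j; rewrite !mxE eq_sym.
Qed.

Lemma char_poly_conj n (P A : 'M[F]_n) : P \in unitmx ->
  char_poly (invmx P *m A *m P) = char_poly A.
Proof.
move=> uP; rewrite /char_poly.
have -> : char_poly_mx (invmx P *m A *m P) =
  map_mx polyC (invmx P) *m char_poly_mx A *m map_mx polyC P.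
  have QQ : map_mx polyC (invmx P) *m map_mx polyC P = 1%:M.
    by rewrite -map_mxM mulVmx// map_mx1.
  rewrite /char_poly_mx mulmxBr mulmxBl !map_mxM scalar_mxC.
  by rewrite -[_%:M *m _ *m _]mulmxA QQ mulmx1.
by rewrite !det_mulmx mulrAC -det_mulmx -map_mxM mulVmx// map_mx1 det1 mul1r.
Qed.

End Triangular.

(** * Generators of the general linear group *)

Section Generation.
Variable F : fieldType.

(* The condition [N i k * N k j = 0] is stable under bordering by a zero row and
   column, and gives [N *m D *m N = 0] for every diagonal [D]. *)
Inductive gl_gen : forall n, 'M[F]_n -> Prop :=
| gen_diag n (d : 'rV[F]_n) : (forall i, d 0 i != 0) -> gl_gen (diag_mx d)
| gen_low n (N : 'M[F]_n) : (forall i j : 'I_n, (i <= j)%N -> N i j = 0) ->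
    (forall i k j, N i k * N k j = 0) -> gl_gen (1%:M + N)
| gen_up n (N : 'M[F]_n) : (forall i j : 'I_n, (j <= i)%N -> N i j = 0) ->
    (forall i k j, N i k * N k j = 0) -> gl_gen (1%:M + N)
| gen_mul n (A B : 'M[F]_n) : gl_gen A -> gl_gen B -> gl_gen (A *m B).

Lemma gl_gen_lift n (A : 'M[F]_n) : gl_gen A -> gl_gen (lift0_mx A : 'M_(1 + n)).
Proof.
have L m (N : 'M[F]_m) : lift0_mx (1%:M + N) = 1%:M + block_mx 0 0 0 N :> 'M_(1 + m).
  by rewrite (@scalar_mx_block _ 1 m) add_block_mx !addr0.
have Z m (N : 'M[F]_m) : (forall i k j, N i k * N k j = 0) ->
    forall i k j, (block_mx 0 0 0 N : 'M_(1 + m)) i k * (block_mx 0 0 0 N : 'M_(1 + m)) k j = 0.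
  move=> HN i k j; case: (split_ordP i) => i' ->; case: (split_ordP k) => k' ->;
  case: (split_ordP j) => j' ->; rewrite ?(block_mxEul, block_mxEur, block_mxEdl, block_mxEdr) ?mxE ?mul0r ?mulr0//.
elim=> {n A} [n d d0|n N lN HN|n N lN HN|n A B _ IHA _ IHB].
- have -> : lift0_mx (diag_mx d) = diag_mx (row_mx 1%:M d) :> 'M_(1 + n).
    by rewrite diag_mx_row; congr block_mx; apply/matrixP => i j; rewrite !mxE !ord1.
  apply: gen_diag => i; case: (split_ordP i) => i' ->; rewrite ?row_mxEl ?row_mxEr//.
  by rewrite mxE ord1 oner_eq0.
- rewrite L; apply: gen_low; last exact: Z.
  move=> i j; case: (split_ordP i) => i' ->; case: (split_ordP j) => j' ->;
    rewrite ?(block_mxEul, block_mxEur, block_mxEdl, block_mxEdr) ?mxE//= => ij.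
  exact: lN.
- rewrite L; apply: gen_up; last exact: Z.
  move=> i j; case: (split_ordP i) => i' ->; case: (split_ordP j) => j' ->;
    rewrite ?(block_mxEul, block_mxEur, block_mxEdl, block_mxEdr) ?mxE//= => ij.
  exact: lN.
- have -> : lift0_mx (A *m B) = lift0_mx A *m lift0_mx B :> 'M_(1 + n).
    by rewrite mulmx_block !mulmx0 !mul0mx !addr0 !add0r mulmx1.
  exact: gen_mul.
Qed.

(** Block elimination with the Schur complement [B] of the pivot. Each triangular factor is the
    identity plus a single off-diagonal block, so in a product [N i k * N k j] one of the factors
    always vanishes. *)
Lemma gl_gen_pivot n (A : 'M[F]_(1 + n)) :
  (forall B : 'M[F]_n, B \in unitmx -> gl_gen B) ->
  A 0 0 != 0 -> A \in unitmx -> gl_gen A.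
Proof.
move=> IH A0 uA.
set a := ulsubmx A; set r := ursubmx A; set c := dlsubmx A.
have ua : a \in unitmx.
  by rewrite unitmxE det_mx11 unitfE /a !mxE; have -> : lshift n (0 : 'I_1) = (0 : 'I_(1 + n)) by apply: ord_inj.
pose B := drsubmx A - c *m invmx a *m r.
have AE : A = (1%:M + block_mx 0 0 (c *m invmx a) 0 : 'M_(1 + n)) *m
    diag_mx (row_mx (const_mx (a 0 0)) (const_mx 1)) *m lift0_mx B *m
    (1%:M + block_mx 0 (invmx a *m r) 0 0 : 'M_(1 + n)).
  rewrite diag_mx_row.
  have -> : diag_mx (const_mx (a 0 0)) = a :> 'M_1.
    by apply/matrixP => i j; rewrite !mxE !ord1 eqxx.
  rewrite diag_const_mx (@scalar_mx_block _ 1 n) !add_block_mx !addr0 !add0r.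
  rewrite !mulmx_block !mulmx0 !mul0mx !mulmx1 !mul1mx !addr0 !add0r.
  rewrite mul0mx addr0 mul1mx mulKVmx// mulmxKV// mulmxA [_ + B]addrC subrK.
  by rewrite submxK.
have uB : B \in unitmx.
  move: uA; rewrite AE !unitmx_mul => /andP[/andP[_ +] _].
  by rewrite !unitmxE det_lblock det1 mul1r.
have Z0 m1 m2 (x : 'I_m1) (y : 'I_m2) : (0 : 'M[F]_(m1, m2)) x y = 0 by rewrite mxE.
rewrite AE; apply: gen_mul; [apply: gen_mul; [apply: gen_mul|]|].
- apply: gen_low => [i j|i k j].
    case: (split_ordP i) => i' ->; case: (split_ordP j) => j' ->;
    rewrite ?(block_mxEul, block_mxEur, block_mxEdl, block_mxEdr);
    by first [rewrite Z0 | rewrite (ord1 j')].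
  case: (split_ordP k) => k' ->; case: (split_ordP i) => i' ->; case: (split_ordP j) => j' ->;
    by rewrite ?(block_mxEul, block_mxEur, block_mxEdl, block_mxEdr) ?mxE ?mul0r ?mulr0.
- apply: gen_diag => i; case: (split_ordP i) => i' ->; rewrite ?row_mxEl ?row_mxEr mxE ?oner_eq0//.
  by move: ua; rewrite unitmxE det_mx11 unitfE.
- by apply: gl_gen_lift; apply: IH.
- apply: gen_up => [i j|i k j].
    case: (split_ordP i) => i' ->; case: (split_ordP j) => j' ->;
    rewrite ?(block_mxEul, block_mxEur, block_mxEdl, block_mxEdr);
    by first [rewrite Z0 | rewrite (ord1 i')].
  case: (split_ordP k) => k' ->; case: (split_ordP i) => i' ->; case: (split_ordP j) => j' ->;
    by rewrite ?(block_mxEul, block_mxEur, block_mxEdl, block_mxEdr) ?Z0 ?mul0r ?mulr0.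
Qed.

(** Induction on the size. A zero pivot is repaired by adding to the first row a row with nonzero
    leading entry; the elementary matrix [E] has square zero, so [1 - E] undoes the operation and is
    again a generator. *)
Lemma unitmx_gl_gen n (A : 'M[F]_n) : A \in unitmx -> gl_gen A.
Proof.
elim: n A => [|n IH] A uA.
  by have -> : A = diag_mx 0; [apply/matrixP => -[]|apply: gen_diag => -[]].
have [A0|A0] := eqVneq (A 0 0) 0; last exact: (@gl_gen_pivot n).
have [i Ai] : exists i, A i 0 != 0.
  apply/existsP; apply: contraT; rewrite negb_exists => /forallP H.
  have : A *m delta_mx 0 0 = 0 :> 'cV_n.+1.
    apply/matrixP => i j; rewrite mxE big1 => [|k _]; first by rewrite mxE.
    by rewrite !mxE; case: eqP => [->|_] /=; rewrite ?mulr0// (eqP (negPn (H i))) mul0r.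
  move/(congr1 (mulmx (invmx A))); rewrite mulKmx// mulmx0 => /matrixP/(_ 0 0)/eqP.
  by rewrite !mxE eqxx oner_eq0.
have i0 : i != 0 by apply: contraNneq Ai => ->; rewrite A0.
pose E := delta_mx 0 i : 'M[F]_n.+1.
have EE (x : F) a b c : (x *: E) a b * (x *: E) b c = 0.
  rewrite !mxE; case: (b =P i) => [->|]; last by rewrite andbF mulr0 mul0r.
  by rewrite (negbTE i0) mulr0 mulr0.
have Eup (x : F) (a b : 'I_n.+1) : (b <= a)%N -> (x *: E) a b = 0.
  rewrite !mxE; case: eqP => [->|]; last by rewrite mulr0.
  case: eqP => [->|_]; last by rewrite mulr0.
  by rewrite leqn0 => /eqP i00; move: i0; rewrite -val_eqE/= i00.
have EEm : E *m E = 0.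
  by apply/matrixP => a c; rewrite mxE big1 ?mxE// => b _; have := EE 1 a b c; rewrite scale1r.
have -> : A = (1%:M + (-1) *: E) *m ((1%:M + 1 *: E) *m A).
  have inv : (1%:M - E) *m (1%:M + E) = 1%:M.
    by rewrite mulmxDr mulmx1 mulmxBl mul1mx EEm subr0 subrK.
  by rewrite scaleN1r scale1r mulmxA inv mul1mx.
have uE (x : F) : gl_gen (1%:M + x *: E) by apply: gen_up; [apply: Eup|apply: EE].
apply: gen_mul => //; apply: (@gl_gen_pivot n) => //.
  rewrite mulmxDl mul1mx scale1r mxE A0 add0r mxE (bigD1 i)//= big1 => [|k ki].
    by rewrite mxE !eqxx mul1r addr0.
  by rewrite mxE (negbTE ki) andbF mul0r.
rewrite unitmx_mul uA andbT unitmxE -det_tr det_trig; last first.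
  apply/is_trig_mxP => a b ab; rewrite !mxE [b == a]eq_sym -val_eqE /= ltn_eqF//.
  by have := Eup 1 b a (ltnW ab); rewrite !mxE => ->; rewrite addr0.
rewrite big1 ?unitr1// => k _.
by have := Eup 1 k k (leqnn k); rewrite !mxE eqxx => ->; rewrite addr0.
Qed.

Lemma gen_conj_diag n (d : 'rV[F]_n) (N : 'M[F]_n) :
  (forall i k j, N i k * N k j = 0) ->
  (1%:M + N \in unitmx) /\
  invmx (1%:M + N) *m diag_mx d *m (1%:M + N) =
    diag_mx d + (diag_mx d *m N - N *m diag_mx d).
Proof.
move=> HN; set D := diag_mx d.
have NN : N *m N = 0.
  by apply/matrixP => i j; rewrite mxE big1 ?mxE// => k _; rewrite HN.
have NDN : N *m D *m N = 0.
  apply/matrixP => i j; rewrite mxE big1 ?mxE// => k _.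
  by rewrite mul_mx_diag !mxE mulrAC HN mul0r.
have inv : (1%:M - N) *m (1%:M + N) = 1%:M.
  by rewrite mulmxDr mulmx1 mulmxBl mul1mx NN subr0 subrK.
have [uN _] := mulmx1_unit (mulmx1C inv); split=> //.
have -> : invmx (1%:M + N) = 1%:M - N.
  by rewrite -[RHS](mulmxK uN) inv mul1mx.
by rewrite mulmxBl mul1mx mulmxDr mulmx1 mulmxBl NDN subr0 addrAC -addrA.
Qed.

Lemma char_poly_diag_low n (d : 'rV[F]_n) (N : 'M[F]_n) (z : F) :
  (forall i j : 'I_n, (i <= j)%N -> N i j = 0) ->
  char_poly (diag_mx d + z *: (diag_mx d *m N - N *m diag_mx d)) = char_poly (diag_mx d).
Proof.
move=> lN.
have E (i j : 'I_n) : (i <= j)%N -> (z *: (diag_mx d *m N - N *m diag_mx d)) i j = 0.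
  by move=> ij; rewrite mul_mx_diag mul_diag_mx !mxE lN// mulr0 mul0r subr0 mulr0.
rewrite !char_poly_trig ?diag_mx_is_trig//; last first.
  apply/is_trig_mxP => i j ij; rewrite mxE E ?(ltnW ij)// addr0 mxE.
  by rewrite -val_eqE/= ltn_eqF.
by apply: eq_bigr => i _; rewrite mxE E// addr0.
Qed.

Lemma char_poly_diag_up n (d : 'rV[F]_n) (N : 'M[F]_n) (z : F) :
  (forall i j : 'I_n, (j <= i)%N -> N i j = 0) ->
  char_poly (diag_mx d + z *: (diag_mx d *m N - N *m diag_mx d)) = char_poly (diag_mx d).
Proof.
move=> uN; rewrite -char_poly_tr linearD linearZ linearB /= !trmx_mul tr_diag_mx.
rewrite -opprB scalerN -scaleNr; apply: char_poly_diag_low => i j ij.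
by rewrite mxE uN.
Qed.

Lemma diag_perm n (d e : 'rV[F]_n) :
  perm_eq [seq e 0 i | i <- enum 'I_n] [seq d 0 i | i <- enum 'I_n] ->
  exists2 S : 'M[F]_n, S \in unitmx & diag_mx e = invmx S *m diag_mx d *m S.
Proof.
have -> : [seq d 0 i | i <- enum 'I_n] = [tuple d 0 i | i < n] by [].
move/tuple_permP => [p pe].
have ep j : e 0 j = d 0 (p j).
  have := congr1 (fun s => nth 0 s j) pe.
  rewrite (nth_map j) ?size_enum_ord// nth_ord_enum (nth_map j) ?size_enum_ord//.
  by rewrite nth_ord_enum tnth_mktuple.
exists (perm_mx p^-1%g); first exact: unitmx_perm.
suff H : perm_mx p^-1 *m diag_mx e = diag_mx d *m perm_mx p^-1.
  by rewrite -mulmxA -H mulKmx// unitmx_perm.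
apply/matrixP => i j; rewrite mul_mx_diag mul_diag_mx !mxE ep.
case: (_ =P j) => [<-|_]; last by rewrite mul0r mulr0.
by rewrite permKV mul1r mulr1.
Qed.

End Generation.

(** * Companion matrices and Krylov matrices *)

Section Companion.
Variable F : fieldType.

(** Entry [j] of [s] stands for sigma_(j+1), so the coefficient [(-1)^(n-k) sigma_(n-k)] of [t^k] is
    read at index [n - k - 1], which is [rev_ord k]. *)
Definition sigma_coef n (s : 'rV[F]_n) (k : 'I_n) : F :=
  (-1) ^+ (n - k) * s 0 (rev_ord k).

Definition sigma_poly n (s : 'rV[F]_n) : {poly F} :=
  'X^n + \poly_(k < n) (if insub k is Some i then sigma_coef s i else 0).

(** The transpose of [companionmx]: with the coefficients in the last column, this is the matrix of
    a cyclic [V] in the basis [V^k v]. It is affine in [s]. *)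
Definition sigma_mx n (s : 'rV[F]_n.+1) : 'M[F]_n.+1 :=
  \matrix_(i, j) if j == ord_max then - sigma_coef s i else (i == j.+1 :> nat)%:R.

Lemma coef_sigma_poly n (s : 'rV[F]_n) (k : 'I_n) : (sigma_poly s)`_k = sigma_coef s k.
Proof.
rewrite coefD coefXn coef_poly ltn_ord ltn_eqF// add0r.
by case: insubP => [i _ /ord_inj ->|]; rewrite ?ltn_ord.
Qed.

Lemma size_sigma_poly n (s : 'rV[F]_n) : size (sigma_poly s) = n.+1.
Proof. by rewrite size_polyDl size_polyXn// ltnS size_poly. Qed.

Lemma sigma_poly_monic n (s : 'rV[F]_n) : sigma_poly s \is monic.
Proof.
by rewrite monicE lead_coefDl ?lead_coefXn// size_polyXn ltnS size_poly.
Qed.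

Lemma char_poly_sigma_mx n (s : 'rV[F]_n.+1) : char_poly (sigma_mx s) = sigma_poly s.
Proof.
have sz := size_sigma_poly s.
rewrite -(companionmxK (sigma_poly_monic s)) -char_poly_tr.
have cast m1 m2 (e : m1 = m2) (A : 'M[F]_m1) (B : 'M[F]_m2) :
    (forall i j, A i j = B (cast_ord e i) (cast_ord e j)) -> char_poly A = char_poly B.
  case: m2 / e B => B AB; congr char_poly; apply/matrixP => i j.
  by rewrite AB !cast_ord_id.
have e : n.+1 = (size (sigma_poly s)).-1 by rewrite sz.
apply: (cast _ _ e) => i j; rewrite !mxE /= sz /= -coef_sigma_poly.
by rewrite -val_eqE /= [j == _ :> nat]eq_sym.
Qed.

(** [V] shifts the columns [V^k v] of [K] by one, and Cayley-Hamilton expresses the image of the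
    last column through the others. *)
Lemma cyclic_sigma_mx n (V : 'M[F]_n.+1) (v : 'cV[F]_n.+1) (s : 'rV[F]_n.+1) :
  char_poly V = sigma_poly s ->
  let K := \matrix_(i < n.+1, k < n.+1) ((V ^+ k *m v) i ord0) in
  V *m K = K *m sigma_mx s.
Proof.
move=> Vs K.
have VK i j : (V *m K) i j = (V ^+ j.+1 *m v) i 0.
  rewrite exprS -[V * _]/(V *m _) -mulmxA mxE [RHS]mxE.
  by apply: eq_bigr => k _; rewrite [K k j]mxE.
have CH : V ^+ n.+1 = - \sum_(k < n.+1) sigma_coef s k *: V ^+ k.
  move: (Cayley_Hamilton V); rewrite Vs rmorphD /= rmorphXn /= horner_mx_X.
  rewrite poly_def linear_sum /= => /eqP; rewrite addr_eq0 => /eqP ->.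
  congr (- _); apply: eq_bigr => k _.
  rewrite linearZ /= rmorphXn /= horner_mx_X; congr (_ *: _).
  by case: insubP => [i _ /ord_inj ->|]; rewrite ?ltn_ord.
apply/matrixP => i j; rewrite VK [RHS]mxE.
have [->|jmax] := eqVneq j ord_max.
  rewrite /= CH mulNmx mulmx_suml mxE summxE -sumrN; apply: eq_bigr => k _.
  by rewrite -scalemxAl [in LHS]mxE [K i k]mxE [sigma_mx _ _ _]mxE eqxx mulrN mulrC.
have jn : (j.+1 < n.+1)%N.
  by rewrite ltnS ltn_neqAle -ltnS ltn_ord andbT.
rewrite (bigD1 (Ordinal jn))//= big1 => [|k kj].
  by rewrite [K i _]mxE [sigma_mx s _ j]mxE (negbTE jmax) /= eqxx mulr1 addr0.
by rewrite [sigma_mx s _ j]mxE (negbTE jmax) -val_eqE /= in kj *; rewrite (negbTE kj) mulr0.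
Qed.

End Companion.

Lemma eventually_all (T : eqType) (L : seq T) (P : nat -> T -> bool) :
  (forall x s t, x \in L -> ~~ P s x -> ~~ P t x -> s = t) ->
  exists N, forall s, (N <= s)%N -> forall x, x \in L -> P s x.
Proof.
elim: L => [|y L IH] H; first by exists 0%N.
have [|N HN] := IH; first by move=> x s t xL; apply: H; rewrite inE xL orbT.
have [[s0 bad]|ok] := pselect (exists s, ~~ P s y).
  exists (maxn N s0.+1) => s; rewrite geq_max => /andP[Ns s0s] x.
  rewrite inE => /predU1P[->|]; last exact: HN.
  apply: contraT => bads; have := H y s s0 (mem_head _ _) bads bad.
  by move=> ss; rewrite ss ltnn in s0s.
exists N => s Ns x; rewrite inE => /predU1P[->|]; last exact: HN.
by apply: contraT => bads; case: ok; exists s.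
Qed.

(** A space over an infinite field is not a finite union of proper subspaces. On the line [v + s w]
    every kernel is met for at most one natural number [s], so a large [s] avoids them all. *)
Lemma mulmx_avoid (F : numFieldType) m n (Bs : seq 'M[F]_(m, n)) :
  (forall B, B \in Bs -> B != 0) ->
  exists v : 'cV[F]_n, forall B, B \in Bs -> B *m v != 0.
Proof.
elim: Bs => [|B Bs IH] H; first by exists 0.
have [v Hv] := IH (fun B' HB => H B' (mem_behead (s := B :: Bs) HB)).
have [w Bw] : exists w : 'cV[F]_n, B *m w != 0.
  have /matrix0Pn[i [j Bij]] := H B (mem_head _ _).
  exists (delta_mx j 0); apply: contraNneq Bij => /matrixP/(_ i 0).
  rewrite !mxE (bigD1 j)//= mxE !eqxx mulr1 big1 ?addr0 => [->//|k kj].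
  by rewrite mxE (negbTE kj) mulr0.
have [|N HN] := @eventually_all _ (B :: Bs) (fun s B' => B' *m (v + s%:R *: w) != 0).
  move=> B' s t HB; rewrite !negbK !mulmxDr -!scalemxAr => /eqP es /eqP et.
  apply/eqP; apply: contraT => st.
  have : (s%:R - t%:R) *: (B' *m w) = 0.
    by rewrite scalerBl -[s%:R *: _](addKr (B' *m v)) es -[t%:R *: _](addKr (B' *m v)) et subrr.
  move/eqP; rewrite scaler_eq0 => /orP[|/eqP w0].
    by rewrite subr_eq0 eqr_nat (negbTE st).
  move: HB; rewrite inE => /predU1P[BB|/Hv]; first by rewrite -BB w0 eqxx in Bw.
  by move: es; rewrite w0 scaler0 addr0 => ->; rewrite eqxx.
by exists (v + N%:R *: w) => B' HB; apply: HN HB.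
Qed.

(** * Eigenvalues with multiplicity, and a criterion for cyclicity *)

Section Eigenvalues.
Variable F : numClosedFieldType.

(** Built from the characteristic polynomial alone, so two matrices in the same fibre of [sigma]
    have literally equal lists. *)
Definition eigs n (A : 'M[F]_n) : seq F := sval (closed_field_poly_normal (char_poly A)).

Lemma char_poly_eigs n (A : 'M[F]_n) : char_poly A = \prod_(l <- eigs A) ('X - l%:P).
Proof.
rewrite /eigs; case: closed_field_poly_normal => s /= {1}->.
by rewrite (eqP (char_poly_monic A)) scale1r.
Qed.

Lemma mem_eigs n (A : 'M[F]_n) l : (l \in eigs A) = root (char_poly A) l.
Proof. by rewrite char_poly_eigs root_prod_XsubC. Qed.

Lemma size_eigs n (A : 'M[F]_n) : size (eigs A) = n.
Proof.
by have := size_char_poly A; rewrite char_poly_eigs size_prod_XsubC => -[].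
Qed.

Lemma triangularize n (A : 'M[F]_n.+1) : exists P T : 'M[F]_n.+1,
  [/\ P \in unitmx, is_trig_mx T & A = invmx P *m T *m P].
Proof.
have [P /unitarymx_unit uP tA] := Schur A (ltn0Sn n).
exists P, (conjmx P A); split=> //.
by rewrite conjumx// !mulmxA mulVmx// mul1mx mulmxKV.
Qed.

Lemma eigs_trig n (A P T : 'M[F]_n) : P \in unitmx -> is_trig_mx T ->
  A = invmx P *m T *m P -> perm_eq (eigs A) [seq T i i | i <- enum 'I_n].
Proof.
move=> uP tT AE; apply: prod_XsubC_eq.
rewrite -char_poly_eigs AE char_poly_conj// char_poly_trig// big_map.
by rewrite big_enum.
Qed.

Lemma eigs_horner n (A : 'M[F]_n.+1) (q : {poly F}) :
  perm_eq (eigs (horner_mx A q)) [seq q.[l] | l <- eigs A].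
Proof.
have [P [T [uP tT AE]]] := triangularize A.
have [tq dq] := horner_trig q tT.
have /eigs_trig := uP => /(_ _ _ tq) H.
rewrite (permPl (H (horner_mx A q) _)); last by rewrite AE horner_mx_uconjC.
have -> : [seq horner_mx T q i i | i <- enum 'I_n.+1] =
  [seq q.[l] | l <- [seq T i i | i <- enum 'I_n.+1]].
  by rewrite -[RHS]map_comp; apply: eq_map => i; rewrite /= dq.
by rewrite perm_sym perm_map// (eigs_trig uP tT AE).
Qed.

Lemma mxtrace_eigs n (A : 'M[F]_n.+1) : \tr A = \sum_(l <- eigs A) l.
Proof.
have [P [T [uP tT AE]]] := triangularize A.
rewrite (perm_big _ (eigs_trig uP tT AE)) big_map big_enum /=.
by rewrite AE -mulmxA mxtrace_mulC mulmxK.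
Qed.

(** Take [v] outside the kernels of all [(chi / (X - l)) (V)]. If the Krylov matrix of [v] were
    singular, a nonzero [P] of degree at most [n] would satisfy [P(V) v = 0], and so would
    [g = gcd(P, chi)]. For degree reasons [chi / g] has a root [l], so [g] divides [chi / (X - l)],
    against the choice of [v]. *)
Lemma cyclic_criterion n (V : 'M[F]_n.+1) :
  (forall l r, char_poly V = ('X - l%:P) * r -> horner_mx V r != 0) ->
  exists v : 'cV[F]_n.+1, \matrix_(i < n.+1, k < n.+1) ((V ^+ k *m v) i ord0) \in unitmx.
Proof.
move=> H; set chi := char_poly V in H *.
have [|v Hv] := @mulmx_avoid F _ _ [seq horner_mx V (chi %/ ('X - l%:P)) | l <- eigs V].
  move=> B /mapP[l]; rewrite mem_eigs => /factor_theorem [r]; rewrite -/chi => rE ->.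
  by rewrite rE mulpK ?polyXsubC_eq0//; apply: (H l); rewrite rE mulrC.
exists v; set K := (X in X \in unitmx); apply: contraT => nuK.
have chi0 : chi != 0 by apply: monic_neq0; apply: char_poly_monic.
have [c c0 Kc] : exists2 c : 'cV[F]_n.+1, c != 0 & K *m c = 0.
  have : \det K^T = 0 by apply/eqP; move: nuK; rewrite unitmxE unitfE negbK det_tr.
  move/eqP/det0P => [c c0 Kc]; exists c^T; first by rewrite trmx_eq0.
  by apply: trmx_inj; rewrite trmx_mul trmxK Kc trmx0.
pose P := \poly_(k < n.+1) (c (inord k) 0).
have PV : horner_mx V P *m v = 0.
  rewrite /P poly_def linear_sum /= mulmx_suml; apply/matrixP => i j; rewrite ord1.
  move/matrixP/(_ i 0): Kc; rewrite mxE => Kc; rewrite summxE -[RHS]Kc.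
  apply: eq_bigr => k _; rewrite linearZ /= rmorphXn /= horner_mx_X -scalemxAl mxE.
  by rewrite inord_val [K i k]mxE mulrC.
have P0 : P != 0.
  have [i ci] : exists i, c i 0 != 0.
    by have /matrix0Pn[i [j]] := c0; rewrite ord1; exists i.
  apply: contraNneq ci => P0; have := coef_poly n.+1 (fun k => c (inord k) 0) i.
  by rewrite -/P P0 coef0 ltn_ord inord_val => <-.
pose g := gcdp P chi.
have gv : horner_mx V g *m v = 0.
  have [[a b]] := Bezoutp P chi; rewrite /= => /eqpP [[c1 c2] /= /andP[c10 c20] E].
  have : c2 *: (horner_mx V g *m v) = 0.
    rewrite scalemxAl -linearZ /= -E linearZ /= rmorphD !rmorphM /=.
    rewrite Cayley_Hamilton mulr0 addr0 -scalemxAl -[_ * _]/(_ *m _) -mulmxA PV.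
    by rewrite mulmx0 scaler0.
  by move/eqP; rewrite scaler_eq0 (negbTE c20) => /eqP.
have gchi : g %| chi by apply: dvdp_gcdr.
have hg := divpK gchi; set h := chi %/ g in hg.
have sg : (size g <= n.+1)%N.
  by rewrite (leq_trans (leq_gcdpl _ P0))// size_poly.
have [l hl] : exists l, root h l.
  apply/closed_rootP; apply: contraTneq sg => sh.
  have h0 : h != 0 by rewrite -size_poly_eq0 sh.
  have g0 : g != 0 by apply: contraNneq chi0 => g0; rewrite -hg g0 mulr0.
  by rewrite -ltnNge -(size_char_poly V) -/chi -hg size_mul// sh add1n.
have /factor_theorem [h' hE] := hl.
have chiE : chi = h' * g * ('X - l%:P) by rewrite -hg hE mulrAC.
have leig : l \in eigs V by rewrite mem_eigs -/chi chiE rootM root_XsubC eqxx orbT.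
have /Hv : horner_mx V (chi %/ ('X - l%:P)) \in
  [seq horner_mx V (chi %/ ('X - l%:P)) | l <- eigs V] by apply/mapP; exists l.
rewrite chiE mulpK ?polyXsubC_eq0// rmorphM /= -[_ * _]/(_ *m _) -mulmxA gv mulmx0.
by rewrite eqxx.
Qed.

End Eigenvalues.

(** * Families of polynomial discs *)

Section PolyEstimates.
Variable R : realType.
Local Notation C := (R[i]).

Lemma uniform_bound (I : finType) (P : I -> R -> Prop) :
  (forall i a b, a <= b -> P i a -> P i b) -> (forall i, exists K, P i K) ->
  exists2 K : R, 0 <= K & forall i, P i K.
Proof.
move=> mono /boolp.choice [f fP]; exists (\sum_i `|f i|); first exact: sumr_ge0.
move=> i; apply: mono (fP i); rewrite (le_trans (ler_norm _))//.
by rewrite (bigD1 i)//= lerDl sumr_ge0.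
Qed.

Lemma poly_bound (p : {poly C}) (r : R) :
  exists2 K : R, 0 <= K & forall z, cabs z <= r -> cabs p.[z] <= K.
Proof.
elim/poly_ind: p => [|p c [K K0 HK]].
  by exists 0 => // z _; rewrite horner0 cabs0.
exists (K * `|r| + cabs c); first by rewrite addr_ge0 ?mulr_ge0 ?cabs_ge0.
move=> z zr; rewrite hornerD hornerM hornerX hornerC (le_trans (ler_cabsD _ _))//.
rewrite lerD2r cabsM ler_pM ?cabs_ge0 ?HK//.
exact: le_trans zr (ler_norm _).
Qed.

Lemma poly_lip (p : {poly C}) (r : R) :
  exists2 L : R, 0 <= L & forall x y, cabs x <= r -> cabs y <= r ->
    cabs (p.[x] - p.[y]) <= L * cabs (x - y).
Proof.
elim/poly_ind: p => [|p c [L L0 HL]].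
  by exists 0 => // x y _ _; rewrite !horner0 subrr cabs0 mul0r.
have [K K0 HK] := poly_bound p r.
exists (K + `|r| * L); first by rewrite addr_ge0 ?mulr_ge0.
move=> x y xr yr; rewrite !(hornerD, hornerM, hornerX, hornerC).
have -> : p.[x] * x + c - (p.[y] * y + c) = p.[x] * (x - y) + y * (p.[x] - p.[y]) by ring.
rewrite (le_trans (ler_cabsD _ _))// !cabsM mulrDl lerD//.
  by rewrite ler_wpM2r ?cabs_ge0 ?HK.
rewrite -mulrA ler_pM ?cabs_ge0 ?HL//.
exact: le_trans yr (ler_norm _).
Qed.

(** The witnesses are the derivative and half of the second derivative, produced by the product rule
    along the Horner recursion. *)
Lemma poly_taylor2 (p : {poly C}) (r : R) : exists p1 p2 : {poly C}, exists2 K : R, 0 <= K &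
  forall z w, cabs z <= r -> cabs w <= 1 ->
    cabs (p.[z + w] - p.[z] - w * p1.[z] - w ^+ 2 * p2.[z]) <= K * cabs w ^+ 3.
Proof.
elim/poly_ind: p => [|p c [p1 [p2 [K K0 HK]]]].
  exists 0, 0, 0 => // z w _ _.
  by rewrite !horner0 !mulr0 !subr0 cabs0 mul0r.
have [K2 K20 HK2] := poly_bound p2 r.
exists (p1 * 'X + p), (p2 * 'X + p1), ((`|r| + 1) * K + K2).
  by rewrite addr_ge0 ?mulr_ge0 ?addr_ge0.
move=> z w zr w1; rewrite !(hornerD, hornerM, hornerX, hornerC).
have -> : p.[z + w] * (z + w) + c - (p.[z] * z + c) - w * (p1.[z] * z + p.[z])
    - w ^+ 2 * (p2.[z] * z + p1.[z]) =
  (z + w) * (p.[z + w] - p.[z] - w * p1.[z] - w ^+ 2 * p2.[z]) + p2.[z] * w ^+ 3 by ring.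
have -> : ((`|r| + 1) * K + K2) * cabs w ^+ 3 =
  (`|r| + 1) * (K * cabs w ^+ 3) + K2 * cabs w ^+ 3 by ring.
rewrite (le_trans (ler_cabsD _ _))// (cabsM (z + w)) (cabsM p2.[z]) cabsX lerD//.
  rewrite ler_pM ?cabs_ge0 ?HK// (le_trans (ler_cabsD _ _))// lerD//.
  exact: le_trans zr (ler_norm _).
by rewrite ler_wpM2r ?exprn_ge0 ?cabs_ge0// HK2.
Qed.

Definition mxeval p q (F : 'M[{poly C}]_(p, q)) (z : C) : 'M[C]_(p, q) :=
  \matrix_(i, j) (F i j).[z].

Lemma mxeval_lip p q (F : 'M[{poly C}]_(p, q)) (r : R) :
  exists2 L : R, 0 <= L & forall x y, cabs x <= r -> cabs y <= r ->
    mxnorm (mxeval F x - mxeval F y) <= L * cabs (x - y).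
Proof.
have [||L L0 HL] := @uniform_bound ('I_p * 'I_q)%type (fun ij L => forall x y, cabs x <= r ->
   cabs y <= r -> cabs ((F ij.1 ij.2).[x] - (F ij.1 ij.2).[y]) <= L * cabs (x - y)).
- move=> ij a b ab H x y xr yr; apply: le_trans (H x y xr yr) _.
  by rewrite ler_wpM2r ?cabs_ge0.
- by move=> ij; have [L _ HL] := poly_lip (F ij.1 ij.2) r; exists L.
exists L => // x y xr yr; apply: mxnorm_le => [|i j]; first by rewrite mulr_ge0 ?cabs_ge0.
by rewrite !mxE; apply: (HL (i, j)).
Qed.

End PolyEstimates.

Section MaxPrinciple.
Variable R : realType.
Local Notation C := (R[i]).
Local Notation Re := complex.Re.
Variables (p q : nat) (D : set 'M[C]_(p, q)) (u : 'M[C]_(p, q) -> \bar R).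
Hypothesis pshu : psh_on D u.
Hypothesis u0 : forall x, D x -> (u x <= 0)%E.

(* Doubling of variables: maximize [sum_j u (w j) + d |z|^2 - k sum_j |w j - F j z|^2].
   Moving [z] by [s] and each [w j] by [s * (F j)' z] changes the penalty only by
   the real part of a multiple of [s^2] plus O(s^3), which averages out on small
   circles, so near-maximizers must have [z] close to the boundary. *)
Lemma family_max (I : finType) (F : I -> 'M[{poly C}]_(p, q)) (r eta eps G : R) :
  0 < r -> 0 < eta -> 0 < eps ->
  (forall j z w, cabs z <= r -> mxnorm (w - mxeval (F j) z) <= eta -> D w) ->
  (forall z (w : I -> 'M[C]_(p, q)), r - eps <= cabs z <= r ->
     (forall j, mxnorm (w j - mxeval (F j) z) <= eps) -> (\sum_j u (w j) <= G%:E)%E) ->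
  (\sum_j u (mxeval (F j) 0%R) <= G%:E)%E.
Proof.
move=> r0 eta0 eps0 tube bdry.
have [e e0 [eeps eeta e1]] : exists2 e : R, 0 < e & [/\ e <= eps, e <= eta / 2 & e <= 1].
  exists (Num.min eps (Num.min (eta / 2) 1)); last by rewrite !ge_min !lexx !orbT.
  by rewrite !lt_min eps0 divr_gt0//=.
have tube0 j z : cabs z <= r -> D (mxeval (F j) z).
  by move=> zr; apply: (tube j z) => //; rewrite subrr mxnorm0 ltW.
have sum0 (w : I -> 'M[C]_(p, q)) : (forall j, D (w j)) -> (\sum_j u (w j) <= 0)%E.
  by move=> Dw; apply: sume_le0 => j _; apply: u0.
apply: lee_addr => d' d'0.
have [d d0 dr2] : exists2 d : R, 0 < d & d * r ^+ 2 = d'.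
  exists (d' / r ^+ 2); first by rewrite divr_gt0// exprn_gt0.
  by rewrite divfK// gt_eqF// exprn_gt0.
have c00 : cabs (0 : C) <= r by rewrite cabs0 ltW.
have := sum0 _ (fun j => tube0 j _ c00).
case vE : (\sum_j u (mxeval (F j) 0%R))%E => [v| |]; [|by rewrite leye_eq|by move=> _; rewrite leNye].
rewrite lee_fin => v0.
pose T := (I * ('I_p * 'I_q))%type.
pose dif (w : I -> 'M[C]_(p, q)) z (t : T) : C := w t.1 t.2.1 t.2.2 - (F t.1 t.2.1 t.2.2).[z].
pose Q w z : R := \sum_(t : T) cabs (dif w z t) ^+ 2.
have Q0 w z : 0 <= Q w z by apply: sumr_ge0 => t _; rewrite exprn_ge0 ?cabs_ge0.
have difE w z j a b : (w j - mxeval (F j) z) a b = dif w z (j, (a, b)) by rewrite !mxE.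
(* With this [k], since the sum of the [u (w j)] is at most 0, a point with [Q >= e^2] has value at
   most [v - 1 <= S - 1]. Near-maximizers thus stay within [e] of the discs. *)
have [k k0 ke] : exists2 k : R, 0 < k & k * e ^+ 2 = d' - v + 1.
  exists ((d' - v + 1) / e ^+ 2); first by rewrite divr_gt0 ?exprn_gt0//; lra.
  by rewrite divfK// gt_eqF// exprn_gt0.
pose adm z w := cabs z <= r /\ forall j, mxnorm (w j - mxeval (F j) z) <= eta.
have admD z w j : adm z w -> D (w j) by case=> zr /(_ j); apply: tube.
pose E : set R := fun x => exists z w, adm z w /\
  (\sum_j u (w j) = (x - d * cabs z ^+ 2 + k * Q w z)%:E)%E.
have dz (z : C) : cabs z <= r -> d * cabs z ^+ 2 <= d'.
  by move=> zr; rewrite -dr2 ler_pM2l// lerXn2r ?nnegrE ?cabs_ge0// ltW.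
have ubE : has_ubound E.
  exists d' => x [z [w [zw uE]]]; have := sum0 w (fun j => admD _ _ j zw).
  rewrite uE lee_fin; have := dz z zw.1; have := mulr_ge0 (ltW k0) (Q0 w z); lra.
have Ev : E v.
  exists 0, (fun j => mxeval (F j) 0); split.
    by split=> // j; rewrite subrr mxnorm0 ltW.
  rewrite vE cabs0 expr0n mulr0 subr0 /Q big1 ?mulr0 ?addr0// => t _.
  by rewrite /dif mxE subrr cabs0 expr0n.
pose S := sup E.
have vS : v <= S by apply: ub_le_sup.
have HS z w : adm z w -> (\sum_j u (w j) <= (S - d * cabs z ^+ 2 + k * Q w z)%:E)%E.
  move=> zw; have := sum0 w (fun j => admD _ _ j zw).
  case uE : (\sum_j u (w j))%E => [x| |]; [move=> _|by rewrite leye_eq|by move=> _; rewrite leNye].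
  have /(ub_le_sup ubE) : E (x + d * cabs z ^+ 2 - k * Q w z).
    by exists z, w; split=> //; rewrite uE; congr (_%:E); ring.
  rewrite -/S lee_fin; lra.
have /boolp.choice [T1 HT1] (t : T) := poly_taylor2 (F t.1 t.2.1 t.2.2) r.
have /boolp.choice [T2 HT2] := HT1.
have [||K K0 HK] := @uniform_bound _ T (fun t K =>
  (forall z, cabs z <= r -> cabs (T1 t).[z] <= K) /\
  (forall z, cabs z <= r -> cabs (T2 t).[z] <= K) /\
  (forall z w, cabs z <= r -> cabs w <= 1 ->
    cabs ((F t.1 t.2.1 t.2.2).[z + w] - (F t.1 t.2.1 t.2.2).[z] - w * (T1 t).[z]
      - w ^+ 2 * (T2 t).[z]) <= K * cabs w ^+ 3)).
- move=> t a b ab [H1 [H2 H3]]; split; [|split] => z; first by move/H1/le_trans; apply.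
    by move/H2/le_trans; apply.
  move=> w zr w1; apply: le_trans (H3 z w zr w1) _.
  by rewrite ler_wpM2r ?exprn_ge0 ?cabs_ge0.
- move=> t; have [K3 K30 HK3] := HT2 t.
  have [K1 K10 HK1] := poly_bound (T1 t) r; have [K2 K20 HK2] := poly_bound (T2 t) r.
  exists (K1 + K2 + K3); split; [|split] => z.
  + by move/HK1/le_trans; apply; lra.
  + by move/HK2/le_trans; apply; lra.
  + move=> w zr w1; apply: le_trans (HK3 z w zr w1) _.
    by rewrite ler_wpM2r ?exprn_ge0 ?cabs_ge0//; lra.
have [M ME] : exists M, M = k * (#|{: T}|%:R * (2 * K + 4 * K ^+ 2)) by eexists.
have M0 : 0 <= M by rewrite ME !mulr_ge0 ?addr_ge0 ?mulr_ge0 ?exprn_ge0// ltW.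
(* The three bounds keep [z + x] in the disc of radius [r], keep the displaced points in the tube of
   width [eta], and make the cubic error at most half of the gain [d s^2]. *)
have [s s0 [se sK sM]] : exists2 s : R, 0 < s & [/\ s <= e, 2 * K * s <= eta / 2 & M * s <= d / 2].
  exists (Num.min e (Num.min (eta / 2 / (2 * K + 1)) (d / 2 / (M + 1)))).
    by rewrite !lt_min e0 !divr_gt0 ?ltr_wpDl ?mulr_ge0.
  split; first by rewrite ge_min lexx.
    rewrite (@le_trans _ _ (2 * K * (eta / 2 / (2 * K + 1))))//.
      by rewrite ler_wpM2l ?mulr_ge0// !ge_min lexx orbT.
    rewrite mulrCA ler_piMr ?divr_ge0 ?(ltW eta0)// ler_pdivrMr ?ltr_wpDl ?mulr_ge0//.
    by rewrite mul1r lerDl.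
  rewrite (@le_trans _ _ (M * (d / 2 / (M + 1))))//.
    by rewrite ler_wpM2l// !ge_min lexx !orbT.
  rewrite mulrCA ler_piMr ?divr_ge0 ?(ltW d0)// ler_pdivrMr ?ltr_wpDl//.
  by rewrite mul1r lerDl.
have s1 : s <= 1 by apply: le_trans se e1.
(* The three alternatives are: far from the discs (large penalty), [z] close to the boundary circle
   (hypothesis [bdry]), and the interior, where the submean inequality yields the gain. *)
have step y0 : E y0 -> y0 <= Num.max (Num.max (S - 1) (G + d')) (S - d * s ^+ 2 / 2).
  move=> [z [w [zw uE]]]; have [zr wz] := zw; rewrite !le_max.
  have [eQ|Qe] := leP (e ^+ 2) (Q w z).
    have := sum0 w (fun j => admD _ _ j zw); rewrite uE lee_fin.
    have := dz z zr; have : k * e ^+ 2 <= k * Q w z by rewrite ler_pM2l.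
    rewrite ke => H1 H2 H3; apply/orP; left; apply/orP; left; lra.
  have difle t : cabs (dif w z t) <= e.
    rewrite -ler_sqr ?nnegrE ?cabs_ge0 ?(ltW e0)// (le_trans _ (ltW Qe))//.
    by rewrite /Q (bigD1 t)//= lerDl sumr_ge0// => t' _; rewrite exprn_ge0 ?cabs_ge0.
  have wle j : mxnorm (w j - mxeval (F j) z) <= e.
    by apply: mxnorm_le => [|a b]; [exact: ltW|rewrite difE].
  have [zb|zi] := leP (r - e) (cabs z).
    apply/orP; left; apply/orP; right.
    have : (\sum_j u (w j) <= G%:E)%E.
      by apply: (bdry z w) => [|j]; [rewrite zr andbT; lra|exact: le_trans (wle j) eeps].
    rewrite uE lee_fin; have := dz z zr; have := mulr_ge0 (ltW k0) (Q0 w z); lra.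
  apply/orP; right.
  pose b j : 'M[C]_(p, q) := \matrix_(a, c) (T1 (j, (a, c))).[z].
  (* Below, each [dif] changes to [dif - g], where [g] has no linear term in the displacement [x].
     Hence the penalty changes by [Re (Y x^2)] up to third order. *)
  pose Y : C := \sum_(t : T) - 2 * ((dif w z t)^*%C * (T2 t).[z]).
  have nb j : mxnorm (b j) <= K.
    by apply: mxnorm_le => // a c; rewrite mxE; have [H _] := HK (j, (a, c)); apply: H.
  have : (\sum_j u (w j) <=
      (S - d * cabs z ^+ 2 - d * s ^+ 2 + k * Q w z + M * s ^+ 3)%:E)%E.
    apply: (submean_sum pshu u0 (b := b) (r := s) (x := - (2 * d)%:C%C * z^*%C)
      (y := k%:C%C * Y)) => // [j x xs|t].
      apply: (tube j z) => //; rewrite addrAC (le_trans (ler_mxnormD _ _))// mxnormZ.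
      have : cabs x * mxnorm (b j) <= s * K by rewrite ler_pM ?cabs_ge0 ?mxnorm_ge0.
      have := wle j; have := mulr_ge0 (ltW s0) K0; lra.
    set x := circ s t; have xs : cabs x = s by rewrite cabs_circ// ltW.
    have x1 : cabs x <= 1 by rewrite xs.
    pose g t' := x ^+ 2 * (T2 t').[z] + ((F t'.1 t'.2.1 t'.2.2).[z + x]
      - (F t'.1 t'.2.1 t'.2.2).[z] - x * (T1 t').[z] - x ^+ 2 * (T2 t').[z]).
    have gle t' : cabs (g t') <= 2 * K * s ^+ 2.
      have [_ [H2 H3]] := HK t'.
      rewrite (le_trans (ler_cabsD _ _))// (cabsM (x ^+ 2)) cabsX xs.
      have := H3 z x zr x1; rewrite xs => H.
      have : s ^+ 2 * cabs (T2 t').[z] <= s ^+ 2 * K by rewrite ler_wpM2l ?sqr_ge0 ?H2.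
      have : K * s ^+ 3 <= K * s ^+ 2.
        by rewrite ler_wpM2l// exprSr ler_piMr ?sqr_ge0.
      lra.
    have difx t' : dif (fun j => w j + x *: b j) (z + x) t' = dif w z t' - g t'.
      by rewrite /dif /g !mxE -!surjective_pairing; ring.
    have s2s : s ^+ 2 <= s by rewrite expr2 ler_piMr// ltW.
    have adm' : adm (z + x) (fun j => w j + x *: b j).
      split; first by rewrite (le_trans (ler_cabsD _ _))// xs; lra.
      move=> j; apply: mxnorm_le => [|a c]; first exact: ltW.
      rewrite (difE (fun j => w j + x *: b j)) difx (le_trans (ler_cabsB _ _))//.
      have := gle (j, (a, c)); have := difle (j, (a, c)).
      have : 2 * K * s ^+ 2 <= 2 * K * s by rewrite ler_wpM2l ?mulr_ge0.
      lra.
    apply: (le_trans (HS _ _ adm')); rewrite lee_fin cabs_sqrD xs.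
    have Qx : Q (fun j => w j + x *: b j) (z + x) <=
        Q w z + Re (Y * x ^+ 2) + #|{: T}|%:R * (2 * K + 4 * K ^+ 2) * s ^+ 3.
      rewrite /Y mulr_suml cRe_sum /Q -big_split /= -mulrA mulr_natl -sumr_const -big_split /=.
      apply: ler_sum => t' _; rewrite difx cabs_sqrD cabsN mulrN cReN mulrN.
      have [_ [_ H3]] := HK t'.
      have := H3 z x zr x1; rewrite xs.
      have : g t' = x ^+ 2 * (T2 t').[z] + ((F t'.1 t'.2.1 t'.2.2).[z + x]
        - (F t'.1 t'.2.1 t'.2.2).[z] - x * (T1 t').[z] - x ^+ 2 * (T2 t').[z]) by [].
      move: (_ - x ^+ 2 * (T2 t').[z]) => rem gE Hrem.
      have -> : (dif w z t')^*%C * g t' =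
          (dif w z t')^*%C * (T2 t').[z] * x ^+ 2 + (dif w z t')^*%C * rem.
        by rewrite gE mulrDr [x ^+ 2 * _]mulrC mulrA.
      have -> : - 2 * ((dif w z t')^*%C * (T2 t').[z]) * x ^+ 2 =
          (- 2)%:C%C * ((dif w z t')^*%C * (T2 t').[z] * x ^+ 2).
        by rewrite -mulrA; congr (_ * _); rewrite rmorphN rmorph_nat.
      rewrite cReD [Re (_%:C%C * _)]cReM /= mul0r subr0.
      have : - Re ((dif w z t')^*%C * rem) <= K * s ^+ 3.
        rewrite (le_trans (ler_norm _))// normrN (le_trans (normr_Re _))// cabsM cabs_conj.
        rewrite (le_trans _ Hrem)// ler_piMl ?cabs_ge0//.
        exact: le_trans (difle t') e1.
      have : cabs (g t') ^+ 2 <= 4 * K ^+ 2 * s ^+ 3.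
        rewrite (@le_trans _ _ ((2 * K * s ^+ 2) ^+ 2))//.
          by apply: lerXn2r; rewrite ?nnegrE ?cabs_ge0 ?gle//; rewrite mulr_ge0 ?sqr_ge0 ?mulr_ge0.
        have -> : (2 * K * s ^+ 2) ^+ 2 = 4 * K ^+ 2 * s ^+ 3 * s by ring.
        by rewrite ler_piMr// !mulr_ge0 ?exprn_ge0// ltW.
      lra.
    have := ler_wpM2l (ltW k0) Qx.
    have RZ (h : R) (c : C) : Re (h%:C%C * c) = h * Re c by rewrite cReM /= mul0r subr0.
    rewrite cReD -!mulrA !mulNr cReN !RZ.
    have -> : M * s ^+ 3 = k * (#|{: T}|%:R * ((2 * K + 4 * K ^+ 2) * s ^+ 3)).
      by rewrite ME -!mulrA.
    lra.
  rewrite uE lee_fin.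
  have : M * s ^+ 3 <= d / 2 * s ^+ 2.
    by rewrite [s ^+ 3]exprS mulrA ler_wpM2r ?sqr_ge0.
  lra.
have : S <= Num.max (Num.max (S - 1) (G + d')) (S - d * s ^+ 2 / 2).
  by apply: ge_sup => //; exists v.
have ds : 0 < d * s ^+ 2 by rewrite mulr_gt0// exprn_gt0.
rewrite !le_max -EFinD lee_fin => /orP[/orP[|]|]; lra.
Qed.

End MaxPrinciple.

Section LimInf.
Variable R : realType.
Implicit Types x : (\bar R)^nat.

Lemma limn_einf_ge x (c : \bar R) N :
  (forall n, (N <= n)%N -> (c <= x n)%E) -> (c <= limn_einf x)%E.
Proof.
move=> H; rewrite limn_einf_lim; apply: lime_ge; first exact: is_cvg_einfs.
exists N => // n /= Nn; apply: le_ereal_inf_tmp => _ [k /= nk <-].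
by apply: H; apply: leq_trans nk.
Qed.

Lemma limn_einf_le x (b : \bar R) :
  (forall n, (x n <= b)%E) -> (limn_einf x <= b)%E.
Proof.
move=> H; rewrite limn_einf_lim; apply: lime_le; first exact: is_cvg_einfs.
by exists 0%N => // n _; apply: le_trans (H n); apply: ereal_inf_lbound; exists n => /=.
Qed.

End LimInf.

(** * Arcs of the circle and step functions *)

Section Arcs.
Variable R : realType.
Local Notation C := (R[i]).
Local Notation mu := (@lebesgue_measure R).

Definition in_arc (m j : nat) (t : R) : bool :=
  2 * pi * j%:R / m.+1%:R <= t <= 2 * pi * j.+1%:R / m.+1%:R.

Lemma arc_exists (m : nat) (t : R) : 0 <= t <= 2 * pi ->
  exists j : 'I_m.+1, in_arc m j t.
Proof.
move=> /andP[t0 t2].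
have m0 : 0 < m.+1%:R :> R by rewrite ltr0n.
have ex : exists j, t <= 2 * pi * j.+1%:R / m.+1%:R.
  by exists m; rewrite mulfK// gt_eqF.
case: (ex_minnP ex) => j tj jmin.
have jm : (j < m.+1)%N by rewrite ltnS; apply: jmin; rewrite mulfK// gt_eqF.
exists (Ordinal jm); rewrite /in_arc /= tj andbT.
case: j tj jmin jm => [|j] tj jmin _; first by rewrite mulr0 mul0r.
rewrite leNgt; apply/negP => /ltW /jmin.
by rewrite ltnn.
Qed.

Lemma arc_exists_co (m : nat) (t : R) : 0 <= t < 2 * pi ->
  exists j : 'I_m.+1, 2 * pi * j%:R / m.+1%:R <= t < 2 * pi * j.+1%:R / m.+1%:R.
Proof.
move=> /andP[t0 t2].
have m0 : 0 < m.+1%:R :> R by rewrite ltr0n.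
have ex : exists j, t < 2 * pi * j.+1%:R / m.+1%:R.
  by exists m; rewrite mulfK// gt_eqF.
case: (ex_minnP ex) => j tj jmin.
have jm : (j < m.+1)%N by rewrite ltnS; apply: jmin; rewrite mulfK// gt_eqF.
exists (Ordinal jm); rewrite /= tj andbT.
case: j tj jmin jm => [|j] tj jmin _; first by rewrite mulr0 mul0r.
by rewrite leNgt; apply/negP => /jmin; rewrite ltnn.
Qed.

(* The points [theta + 2 pi j / M] fall one in each of the [M] arcs. *)
Lemma arc_rotation (m : nat) (theta : R) : 0 <= theta <= 2 * pi ->
  exists l : 'I_m.+1, forall j : 'I_m.+1, exists2 t : R, in_arc m ((l + j) %% m.+1)%N t &
    forall s, circ s (theta + 2 * pi * j%:R / m.+1%:R) = circ s t.
Proof.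
move=> /(@arc_exists m)[l /andP[l1 l2]]; exists l => j.
have m0 : 0 < m.+1%:R :> R by rewrite ltr0n.
set a := 2 * pi in l1 l2 *.
have [lj|lj] := ltnP (l + j) m.+1.
  exists (theta + a * j%:R / m.+1%:R) => //.
  rewrite /in_arc /= modn_small// -/a -addSn !natrD !mulrDr !mulrDl.
  by rewrite !lerD2r l1 l2.
exists (theta + a * j%:R / m.+1%:R - a).
  have E : (l + j)%N = ((l + j) %% m.+1 + m.+1)%N.
    rewrite -{2}(subnK lj) modnDr modn_small ?subnK//.
    by rewrite ltn_subLR// -addnS leq_add// ltnW.
  rewrite /in_arc /= -/a; set k := ((l + j) %% m.+1)%N in E *.
  have kE : k%:R = l%:R + j%:R - m.+1%:R :> R.
    by rewrite -natrD E natrD addrK.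
  have aM : a = a * m.+1%:R / m.+1%:R by rewrite mulfK// gt_eqF.
  have split1 (x : R) : a * (x - m.+1%:R) / m.+1%:R = a * x / m.+1%:R - a.
    by rewrite mulrBr mulrBl mulfK// gt_eqF.
  have E1 : k.+1%:R = l.+1%:R + j%:R - m.+1%:R :> R.
    by rewrite -[k.+1%:R]natr1 -[l.+1%:R]natr1 kE; ring.
  have split2 (x y : R) : a * (x + y) / m.+1%:R = a * x / m.+1%:R + a * y / m.+1%:R.
    by rewrite mulrDr mulrDl.
  rewrite /in_arc -/a E1 kE !split1 !split2.
  move: (a * l%:R / m.+1%:R) (a * l.+1%:R / m.+1%:R) (a * j%:R / m.+1%:R) l1 l2 => X Y Z l1 l2.
  by rewrite !lerD2r l1 l2.
move=> s; have := circ_2pi s (theta + a * j%:R / m.+1%:R - a) 1.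
by rewrite mulr1 subrK.
Qed.

End Arcs.

Lemma integral_indic_le (R : realType) (a b : R) (J : set R) : measurable J -> a <= b ->
  (\int[@lebesgue_measure R]_(t in J) (\1_(`[a, b[%classic : set R) t)%:E <= (b - a)%:E)%E.
Proof.
move=> mJ ab.
have mA : measurable (`[a, b[%classic : set R) by exact: measurable_itv.
have ab' : (lebesgue_measure (`[a, b[%classic : set R) <= (b - a)%:E)%E.
  rewrite lebesgue_measure_itv/= lte_fin; case: ifP => _ //.
  by rewrite lee_fin subr_ge0.
apply: le_trans ab'; rewrite integral_indic//.
by apply: le_measure; rewrite ?inE//; apply: measurableI.
Qed.

Section ArcMean.
Variable R : realType.
Local Notation C := (R[i]).
Local Notation mu := (@lebesgue_measure R).
Variables (p q : nat) (D : set 'M[C]_(p, q)) (u : 'M[C]_(p, q) -> \bar R).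
Hypothesis uscu : usc_on D u.
Hypothesis u0 : forall x, D x -> (u x <= 0)%E.

(* Fatou's lemma for the step functions equal, on each of the m + 1 arcs, to the
   supremum of u over a thin tube around the arc. *)
Lemma arcs_submean (g : R -> 'M[C]_(p, q)) (L : R) (v : \bar R) :
  (forall t, D (g t)) -> (forall s t, mxnorm (g s - g t) <= L * `|s - t|) ->
  (forall m (c : 'I_m.+1 -> R),
     (forall (j : 'I_m.+1) t w, in_arc m j t -> mxnorm (w - g t) <= m.+1%:R^-1 ->
        D w -> (u w <= (c j)%:E)%E) ->
     (v <= ((\sum_j c j) / m.+1%:R)%:E)%E) ->
  (v <= ((2 * pi)^-1)%:E * \int[mu]_(t in `[0%R, (2 * pi)%R]) u (g t))%E.
Proof.
move=> Dg lipg Hv.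
have pi2 : 0 < 2 * pi :> R by rewrite mulr_gt0// pi_gt0.
have v0 : (v <= 0)%E.
  have := Hv 0%N (fun _ => 0); rewrite big1// mul0r; apply => j t w _ _ Dw; exact: u0.
case: v Hv v0 => [v| |] Hv v0; [|by rewrite leye_eq in v0|by rewrite leNye].
pose tube m j : set 'M[C]_(p, q) :=
  [set w | D w /\ exists2 t, in_arc m j t & mxnorm (w - g t) <= m.+1%:R^-1].
pose sp m j : \bar R := ereal_sup [set u w | w in tube m j].
(* The supremum may be [-oo]. Truncation at [- (m + 1)] keeps [c] real, and the truncation level
   recedes as [m] grows. *)
pose c m j : R := fine (maxe (- m.+1%:R)%:E (sp m j)).
have sp0 m j : (sp m j <= 0)%E.
  by apply: ge_ereal_sup => _ [w [Dw _] <-]; apply: u0.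
have cE m j : (c m j)%:E = maxe (- m.+1%:R)%:E (sp m j).
  rewrite /c fineK// fin_real//; apply/andP; split.
    by rewrite lt_max ltNyr.
  by rewrite gt_max ltry /= (le_lt_trans (sp0 m j)).
have c0 m j : c m j <= 0.
  by rewrite -lee_fin cE ge_max sp0 lee_fin oppr_le0 ler0n.
have uc m j w : tube m j w -> (u w <= (c m j)%:E)%E.
  move=> tw; rewrite cE le_max; apply/orP; right.
  by apply: ereal_sup_ubound; exists w.
have vc m : v <= (\sum_(j < m.+1) c m j) / m.+1%:R.
  rewrite -lee_fin; apply: Hv => j t w tj wt Dw.
  by apply: uc; split=> //; exists t.
pose A m j : set R := `[2 * pi * j%:R / m.+1%:R, 2 * pi * j.+1%:R / m.+1%:R[%classic.
have mA m j : measurable (A m j) by exact: measurable_itv.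
pose J : set R := `[0%R, (2 * pi)%R[%classic.
have mJ : measurable J by exact: measurable_itv.
pose step m t : \bar R := (\sum_(j < m.+1) (- c m j)%:E * (\1_(A m j) t)%:E)%E.
have ind0 m j t : (0 <= (- c m j)%:E * (\1_(A m j) t)%:E)%E.
  by rewrite mule_ge0// lee_fin ?oppr_ge0.
have mind m j : measurable_fun J (fun t => (\1_(A m j) t)%:E : \bar R).
  by apply/measurable_EFinP; apply: measurable_indic.
have mterm m j : measurable_fun J (fun t => (- c m j)%:E * (\1_(A m j) t)%:E)%E.
  by apply: measurable_funeM; apply: mind.
have mstep m : measurable_fun J (step m) by apply: emeasurable_sum.
have step0 m t : (0 <= step m t)%E by apply: sume_ge0.
have istep m : (\int[mu]_(t in J) step m t <= (2 * pi * - v)%:E)%E.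
  rewrite ge0_integral_sum//; last by move=> j; apply: mterm.
  have le1 (j : 'I_m.+1) : (\int[mu]_(t in J) ((- c m j)%:E * (\1_(A m j) t)%:E)
      <= (- c m j * (2 * pi / m.+1%:R))%:E)%E.
    rewrite ge0_integralZl_EFin; [|exact: mJ|by move=> t _; rewrite lee_fin|exact: mind|by rewrite oppr_ge0].
    rewrite EFinM lee_wpmul2l ?lee_fin ?oppr_ge0//.
    have -> : 2 * pi / m.+1%:R = 2 * pi * j.+1%:R / m.+1%:R - 2 * pi * j%:R / m.+1%:R :> R.
      by rewrite -mulrBl -mulrBr -[j.+1%:R]natr1 addrAC subrr add0r mulr1.
    apply: integral_indic_le => //.
    by rewrite ler_pM2r ?invr_gt0// ler_pM2l// ler_nat.
  apply: (le_trans (lee_sum _ (fun j _ => le1 j))).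
  rewrite sumEFin lee_fin -mulr_suml sumrN mulrCA ler_pM2l// mulNr lerN2.
  exact: vc.
pose f t := (- u (g t))%E.
have mf : measurable_fun setT f by apply: (measurable_curve uscu Dg lipg).
have f0 t : (0 <= f t)%E by rewrite oppe_ge0 u0.
have L0 : 0 < `|L| * (2 * pi) + 1 by apply: ltr_wpDl => //; apply: mulr_ge0 => //; apply: ltW.
have fstep t : J t -> (f t <= limn_einf (step^~ t))%E.
  rewrite /J /= in_itv/= => tJ.
  (* For large [m] the arc containing [t], together with its tube, lies in a neighbourhood of [g t]
     where [u < - a], and the truncation level is below [- a]. So [step m t >= a] from some [m] on.
     The threshold [N] adds the two requirements. *)
  have below (a : R) : (a%:E < f t)%E -> (a%:E <= limn_einf (step^~ t))%E.
    rewrite /f lteNr -EFinN => ua.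
    have [_ usc] := uscu; have [d d0 dP] := usc _ (Dg t) _ ua.
    have [N HN] : exists N : nat, `|a| + (`|L| * (2 * pi) + 1) / d < N%:R.
      exists (Num.truncn (`|a| + (`|L| * (2 * pi) + 1) / d)).+1; exact: truncnS_gt.
    apply: (@limn_einf_ge _ _ _ N) => m Nm.
    have {}HN : `|a| + (`|L| * (2 * pi) + 1) / d < m.+1%:R.
      by rewrite (lt_le_trans HN)// ler_nat (leq_trans Nm).
    have m0 : 0 < m.+1%:R :> R by rewrite ltr0n.
    have ma : `|a| <= m.+1%:R.
      by rewrite (le_trans _ (ltW HN))// lerDl divr_ge0// ltW.
    have md : (`|L| * (2 * pi) + 1) / m.+1%:R < d.
      rewrite ltr_pdivrMr// [d * _]mulrC -ltr_pdivrMr// (le_lt_trans _ HN)//.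
      by rewrite lerDr.
    have [j tj] := arc_exists_co m tJ.
    have cja : c m j <= - a.
      rewrite -lee_fin cE ge_max; apply/andP; split.
        by rewrite lee_fin lerN2 (le_trans (ler_norm _)).
      apply: ge_ereal_sup => _ [w [Dw [t' t'j wt']] <-]; apply: ltW; apply: dP => //.
      apply: le_lt_trans md; rewrite mulrDl mul1r.
      have -> : w - g t = (g t' - g t) + (w - g t') by rewrite [RHS]addrC addrA subrK.
      rewrite (le_trans (ler_mxnormD _ _))// lerD// (le_trans (lipg _ _))//.
      rewrite (@le_trans _ _ (`|L| * `|t' - t|)) ?ler_wpM2r ?ler_norm//.
      rewrite -mulrA ler_wpM2l//.
      move: tj t'j => /andP[tj1 tj2] /andP[t'j1 t'j2].
      have E : 2 * pi * j.+1%:R / m.+1%:R = 2 * pi * j%:R / m.+1%:R + 2 * pi / m.+1%:R :> R.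
        by rewrite -[j.+1%:R]natr1 mulrDr mulr1 mulrDl.
      rewrite E in tj2 t'j2; rewrite ler_norml; apply/andP; clear E HN.
      move: (2 * pi * j%:R / m.+1%:R) (2 * pi / m.+1%:R) tj1 tj2 t'j1 t'j2.
      by move=> X Y *; split; lra.
    rewrite /step (bigD1 j)//= (@le_trans _ _ ((- c m j)%:E * (\1_(A m j) t)%:E)%E)//.
      rewrite indicE mem_set; last by rewrite /A /= in_itv.
      by rewrite mule1 lee_fin lerNr.
    by rewrite leeDl// sume_ge0.
  case ft : (f t) below => [x| |] below; last by rewrite leNye.
    apply: lee_addr => e e0; rewrite -leeBlDr// -EFinB; apply: below.
    by rewrite lte_fin ltrBlDr ltrDl.
  rewrite leye_eq; apply/eqP/eqyP => a _; apply: below; exact: ltry.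
have fJ : (\int[mu]_(t in J) f t <= (2 * pi * - v)%:E)%E.
  apply: (@le_trans _ _ (\int[mu]_(t in J) limn_einf (step^~ t))%E).
    apply: ge0_le_integral => //.
    - exact: measurable_funTS.
    - rewrite (_ : (fun _ => _) = (fun t => - limn_esup (fun m => - step m t))%E).
        apply: measurableT_comp => //; apply: measurable_fun_limn_esup => m.
        by apply: measurableT_comp => //; apply: mstep.
      by apply/funext => t; rewrite (limn_esupN (step^~ t)) oppeK.
  apply: (le_trans (fatou mu mJ mstep (fun m t _ => step0 m t))).
  exact: limn_einf_le.
have : (\int[mu]_(t in `[0%R, (2 * pi)%R]) u (g t) = - \int[mu]_(t in J) f t)%E.
  rewrite integral_itv_bndo_bndc; last exact: measurable_funTS.
  rewrite -integral_ge0N//; by apply: eq_integral => t _; rewrite /f oppeK.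
move=> ->; rewrite muleN leeNr -EFinN.
have -> : - v = (2 * pi)^-1 * (2 * pi * - v) by rewrite mulKf// gt_eqF.
by rewrite EFinM lee_pmul2l// lte_fin invr_gt0.
Qed.

End ArcMean.

(** * Submean inequality along polynomial discs *)

Section PolynomialDiscs.
Variable R : realType.
Local Notation C := (R[i]).
Local Notation mu := (@lebesgue_measure R).

(** [family_max] is applied to the rotates [F (w_j z)], with [w_j] the roots of unity of order
    [m + 1]. For [|z|] near [r] their points lie near one arc each, so the sum of the [c j] bounds
    the sum of [u] there. At [z = 0] all rotates agree, which leaves [m + 1] times [u (F 0)]. *)
Lemma psh_poly_submean (p q : nat) (D : set 'M[C]_(p, q)) (u : 'M[C]_(p, q) -> \bar R)
    (F : 'M[{poly C}]_(p, q)) (r eta : R) :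
  psh_on D u -> (forall x, D x -> (u x <= 0)%E) -> 0 < r -> 0 < eta ->
  (forall z w, cabs z <= r -> mxnorm (w - mxeval F z) <= eta -> D w) ->
  (u (mxeval F 0%R) <= ((2 * pi)^-1)%:E *
     \int[mu]_(t in `[0%R, (2 * pi)%R]) u (mxeval F (circ r t)))%E.
Proof.
move=> pshu u0 r0 eta0 tube; have r0' := ltW r0.
have [L L0 HL] := mxeval_lip F r.
apply: (arcs_submean pshu.1 u0 (g := fun t => mxeval F (circ r t)) (L := L * (2 * r))).
- by move=> t; apply: (tube (circ r t)); rewrite ?cabs_circ// subrr mxnorm0 ltW.
- move=> s t; apply: le_trans (HL _ _ _ _) _; rewrite ?cabs_circ//.
  by rewrite -mulrA ler_wpM2l// circ_lip.
move=> m c Hc.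
have m0 : 0 < m.+1%:R :> R by rewrite ltr0n.
pose Fj (j : 'I_m.+1) : 'M[{poly C}]_(p, q) :=
  map_mx (fun f => f \Po (circ 1 (2 * pi * j%:R / m.+1%:R) *: 'X)) F.
have FjE j z : mxeval (Fj j) z = mxeval F (circ 1 (2 * pi * j%:R / m.+1%:R) * z).
  by apply/matrixP => a b; rewrite !mxE horner_comp hornerZ hornerX.
(* A point within [eps] of the disc at a parameter of modulus at least [r - eps] is within
   [eps (1 + L)] of the boundary curve; this must not exceed the tube width [1 / (m + 1)]. *)
pose eps := Num.min eta (m.+1%:R^-1 / (1 + L)).
have L1 : 0 < 1 + L by rewrite ltr_pwDl.
have eps0 : 0 < eps by rewrite lt_min eta0 divr_gt0// invr_gt0.
have epsL : eps * (1 + L) <= m.+1%:R^-1.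
  by rewrite -ler_pdivlMr// /eps ge_min lexx orbT.
have := @family_max R p q D u pshu u0 _ Fj r eta eps (\sum_j c j) r0 eta0 eps0.
have F0 j : mxeval (Fj j) 0 = mxeval F 0 by rewrite FjE mulr0.
have D0 : D (mxeval F 0).
  by apply: (tube 0); rewrite ?cabs0// subrr mxnorm0 ltW.
move=> H; have {}H : (\sum_(j < m.+1) u (mxeval F 0%R) <= (\sum_j c j)%:E)%E.
  rewrite (eq_bigr (fun j => u (mxeval (Fj j) 0%R))); last by move=> j _; rewrite F0.
  apply: H => [j z w zr|z w /andP[zr1 zr2] wz].
    by rewrite FjE; apply: tube; rewrite cabsM cabs_circ// mul1r.
  have [theta th zE] := polar z; have [l Hl] := arc_rotation m th.
  have uj j : (u (w j) <= (c (l + j))%:E)%E.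
    have [t tj tE] := Hl j.
    have zj : circ 1 (2 * pi * j%:R / m.+1%:R) * z = circ (cabs z) t.
      by rewrite {1}zE circM mul1r addrC tE.
    apply: (Hc (l + j) t) => //.
      have -> : w j - mxeval F (circ r t) =
        (w j - mxeval F (circ (cabs z) t)) + (mxeval F (circ (cabs z) t) - mxeval F (circ r t)).
        by rewrite addrA subrK.
      apply: le_trans epsL; rewrite mulrDr mulr1 (le_trans (ler_mxnormD _ _))// lerD//.
        by rewrite -zj -FjE.
      apply: le_trans (HL _ _ _ _) _; rewrite ?cabs_circ ?cabs_ge0//.
      rewrite mulrC ler_wpM2r// circB.
      have -> : cabs (circ (cabs z - r) t) = r - cabs z.
        have -> : circ (cabs z - r) t = - circ (r - cabs z) t.
          by rewrite -[in RHS]circB opprB circB.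
        by rewrite cabsN cabs_circ// subr_ge0.
      by rewrite lerBlDr addrC -lerBlDr.
    apply: (tube (circ (cabs z) t)); first by rewrite cabs_circ ?cabs_ge0.
    by rewrite -zj -FjE (le_trans (wz j))// ge_min lexx.
  apply: (@le_trans _ _ (\sum_j (c (l + j))%:E)%E); first by apply: lee_sum.
  by rewrite sumEFin lee_fin [leRHS](reindex_inj (addrI l)).
move: H (u0 _ D0); case: (u (mxeval F 0)) => [x| |] H; [|by rewrite leye_eq|by move=> _; rewrite leNye].
move=> _; move: H; rewrite sumEFin !lee_fin sumr_const card_ord.
by rewrite ler_pdivlMr// mulr_natr.
Qed.

(** Compactness of the segment, for a property that is inherited by smaller radii [d]. *)
Lemma segment_uniform (P : R -> R -> Prop) (a b : R) :
  (forall x d e, d <= e -> P x e -> P x d) ->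
  (forall x0, a <= x0 <= b ->
     exists2 d : R, 0 < d & forall x, a <= x <= b -> `|x - x0| < d -> P x d) ->
  exists2 d : R, 0 < d & forall x, a <= x <= b -> P x d.
Proof.
move=> anti loc.
have /compact_near_coveringP/(_ R (0^'+) (fun d x => a <= x <= b -> P x d)) := @segment_compact R a b.
case.
  move=> x0; rewrite /= in_itv/= => /loc[d d0 Hd].
  exists (ball x0 d, [set e | 0 < e < d]).
    split; first exact: nbhsx_ballx.
    by exists d => //= e; rewrite /ball/= sub0r normrN => ed e0; rewrite e0 (le_lt_trans (ler_norm _)).
  move=> [x e] /= [xd /andP[e0 ed]] xab; apply: (anti _ _ d (ltW ed)).
  by apply: Hd => //; rewrite distrC.
move=> e /= e0 He; exists (e / 2); first by rewrite divr_gt0.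
move=> x xab; apply: He => //=; rewrite ?divr_gt0//.
by rewrite /ball/= sub0r normrN gtr0_norm ?divr_gt0// ltr_pdivrMr// ltr_pMr// ltr1n.
Qed.

(** The segment version is used twice, for the imaginary part with the real part near [x0], and then
    for the real part. Points of the square outside the disc have a neighbourhood where nothing is
    asked. *)
Lemma disc_uniform (P : C -> R -> Prop) (r : R) :
  (forall z d e, d <= e -> P z e -> P z d) ->
  (forall z0, cabs z0 <= r ->
     exists2 d : R, 0 < d & forall z, cabs z <= r -> cabs (z - z0) < d -> P z d) ->
  exists2 d : R, 0 < d & forall z, cabs z <= r -> P z d.
Proof.
move=> anti loc.
have loc2 (x0 y0 : R) : exists2 d : R, 0 < d &
    forall x y, `|x - x0| < d -> `|y - y0| < d -> cabs (x +i* y)%C <= r -> P (x +i* y)%C d.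
  have close x y : cabs ((x +i* y) - (x0 +i* y0))%C <= `|x - x0| + `|y - y0|.
    exact: cabs_leD.
  have [z0r|z0r] := leP (cabs (x0 +i* y0)%C) r.
    have [d d0 Hd] := loc _ z0r; exists (d / 2); first by rewrite divr_gt0.
    move=> x y xd yd zr; apply: (anti _ _ d); first by lra.
    by apply: Hd => //; have := close x y; lra.
  exists ((cabs (x0 +i* y0)%C - r) / 2); first by rewrite divr_gt0// subr_gt0.
  move=> x y xd yd zr; exfalso; have := close x y.
  have := ler_distcabs (x0 +i* y0)%C (x +i* y)%C; rewrite cabsB; lra.
have [||d d0 Hd] := @segment_uniform (fun x d => forall y, - r <= y <= r ->
    cabs (x +i* y)%C <= r -> P (x +i* y)%C d) (- r) r.
- by move=> x d e de H y yr zr; apply: (anti _ _ e) => //; apply: H.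
- move=> x0 _.
  have [||d d0 Hd] := @segment_uniform (fun y d => forall x, `|x - x0| < d ->
    cabs (x +i* y)%C <= r -> P (x +i* y)%C d) (- r) r.
  + move=> y d e de H x xd zr; apply: (anti _ _ e) => //.
    by apply: H => //; apply: lt_le_trans de.
  + move=> y0 _; have [d d0 Hd] := loc2 x0 y0; exists d => // y _ yd x xd zr.
    exact: Hd.
  + by exists d => // x _ xd y yr zr; apply: Hd.
exists d => // -[x y] zr.
apply: Hd => //; rewrite -ler_norml.
  exact: le_trans (normr_Re _) zr.
exact: le_trans (normr_Im _) zr.
Qed.

Lemma expr_mix (x y : R) k n : (k <= n)%N -> 0 < x -> x <= y ->
  y ^+ k * x ^+ n <= y ^+ n * x ^+ k.
Proof.
move=> /subnKC <- x0 xy; have y0 : 0 <= y by rewrite (le_trans _ xy)// ltW.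
rewrite !exprD -[leRHS]mulrA [_ ^+ (n - k) * _]mulrC.
rewrite ler_wpM2l ?exprn_ge0// ler_wpM2l ?exprn_ge0 ?(ltW x0)//.
by rewrite lerXn2r ?nnegrE ?(ltW x0).
Qed.

(** For each root, [|z - l| >= |z| - |l| >= (1 - |l| / c) |z|] as soon as [|z| >= c]. *)
Lemma prod_XsubC_lower (s : seq C) (c : R) (z : C) : 0 < c -> c <= cabs z ->
  (forall l, l \in s -> cabs l < c) ->
  (\prod_(l <- s) (1 - cabs l / c)) * cabs z ^+ size s
    <= cabs (\prod_(l <- s) ('X - l%:P)).[z].
Proof.
move=> c0 cz; elim: s => [|l s IH] H; first by rewrite !big_nil hornerC cabs1 expr0 mulr1.
have {}IH := IH (fun k ks => H k (mem_behead (s := l :: s) ks)).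
have lc := H l (mem_head _ _).
rewrite !big_cons /= hornerM hornerXsubC cabsM exprS mulrACA ler_pM//.
- by rewrite mulr_ge0 ?cabs_ge0// subr_ge0 ler_pdivrMr// mul1r ltW.
- rewrite mulr_ge0 ?exprn_ge0 ?cabs_ge0// big_seq; apply: prodr_ge0 => k ks.
  by rewrite subr_ge0 ler_pdivrMr// mul1r ltW// H// inE ks orbT.
- rewrite (le_trans _ (ler_distcabs _ _))// mulrBl mul1r lerD2l lerN2.
  rewrite mulrAC -mulrA ler_peMr ?cabs_ge0//.
  by rewrite ler_pdivlMr// mul1r.
Qed.

(** A quantitative substitute for Rouche's theorem: for [|z| >= c] the reference polynomial is at
    least [K |z|^n], while [f - g] has degree below [n] and is at most [e S |z|^n]. The choice
    [e = K / (S + 1)] excludes roots of [f] there. *)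
Lemma roots_open (s : seq C) (c : R) : 0 < c -> (forall l, l \in s -> cabs l < c) ->
  exists2 e : R, 0 < e & forall f : {poly C}, f \is monic -> size f = (size s).+1 ->
    (forall k, (k < size s)%N -> cabs (f`_k - (\prod_(l <- s) ('X - l%:P))`_k) < e) ->
    forall z, root f z -> cabs z < c.
Proof.
move=> c0 sc; set g := \prod_(l <- s) ('X - l%:P); set n := size s.
have gm : g \is monic by apply: monic_prod_XsubC.
have sg : size g = n.+1 by rewrite size_prod_XsubC.
pose K : R := \prod_(l <- s) (1 - cabs l / c).
have K0 : 0 < K.
  rewrite /K big_seq; apply: prodr_gt0 => l /sc lc.
  by rewrite subr_gt0 ltr_pdivrMr// mul1r.
pose S : R := \sum_(k < n) c ^+ k / c ^+ n.
have S0 : 0 <= S by apply: sumr_ge0 => k _; rewrite divr_ge0 ?exprn_ge0 ?ltW.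
exists (K / (S + 1)); first by rewrite divr_gt0// ltr_wpDl.
move=> f fm sf fg z /rootP fz; rewrite ltNge; apply/negP => cz.
have z0 : 0 < cabs z by apply: lt_le_trans cz.
have lower : K * cabs z ^+ n <= cabs g.[z] by apply: prod_XsubC_lower.
have sfg : (size (f - g)%R <= n)%N.
  apply/leq_sizeP => k; rewrite leq_eqVlt => /predU1P[<-|nk]; rewrite coefB.
    have /monicP := fm; have /monicP := gm; rewrite !lead_coefE sf sg /= => -> ->.
    by rewrite subrr.
  by rewrite !nth_default ?subrr// ?sf ?sg.
have e0 : 0 < K / (S + 1) by rewrite divr_gt0// ltr_wpDl.
have zk (k : 'I_n) : cabs z ^+ k <= cabs z ^+ n * (c ^+ k / c ^+ n).
  by rewrite mulrA ler_pdivlMr ?exprn_gt0// expr_mix// ltnW.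
have upper : cabs (f - g).[z] <= K / (S + 1) * (cabs z ^+ n * S).
  rewrite (horner_coef_wide _ sfg) (le_trans (ler_cabs_sum _ _ _))//.
  rewrite /S !mulr_sumr; apply: ler_sum => k _; rewrite cabsM cabsX.
  rewrite ler_pM ?exprn_ge0 ?cabs_ge0 ?zk//.
  by rewrite coefB; apply: ltW (fg _ (ltn_ord k)).
have : cabs g.[z] = cabs (f - g).[z].
  by rewrite hornerD fz add0r hornerN cabsN.
have zn : 0 < cabs z ^+ n by rewrite exprn_gt0.
have KS : K / (S + 1) * S < K.
  by rewrite mulrAC ltr_pdivrMr ?ltr_wpDl// ltr_pM2l// ltrDl.
have : K / (S + 1) * (cabs z ^+ n * S) < K * cabs z ^+ n.
  by rewrite [cabs z ^+ n * S]mulrC mulrA ltr_pM2r.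
lra.
Qed.

End PolynomialDiscs.

(** * Locally Lipschitz functions of a matrix *)

Section LocallyLipschitz.
Variable R : realType.
Local Notation C := (R[i]).

(** The bound on [f A] itself is carried along so that the class is closed under products. *)
Definition loclip p q (f : 'M[C]_(p, q) -> C) : Prop :=
  forall K : R, exists2 L : R, 0 <= L & forall A B, mxnorm A <= K -> mxnorm B <= K ->
    cabs (f A) <= L /\ cabs (f A - f B) <= L * mxnorm (A - B).

Lemma loclip_ext p q (f g : 'M[C]_(p, q) -> C) : f =1 g -> loclip g -> loclip f.
Proof. by move=> /funext ->. Qed.

Lemma loclip_cst p q (c : C) : loclip (fun _ : 'M[C]_(p, q) => c).
Proof.
move=> K; exists (cabs c) => [|A B _ _]; first exact: cabs_ge0.
by rewrite subrr cabs0 mulr_ge0 ?cabs_ge0 ?mxnorm_ge0.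
Qed.

Lemma loclip_coord p q i j : loclip (fun A : 'M[C]_(p, q) => A i j).
Proof.
move=> K; exists (`|K| + 1) => [|A B AK BK]; first by rewrite addr_ge0.
split; first by have := cabs_mxnorm A i j; have := ler_norm K; lra.
have -> : A i j - B i j = (A - B) i j by rewrite !mxE.
rewrite (le_trans (cabs_mxnorm _ _ _))// ler_peMl ?mxnorm_ge0//.
by rewrite lerDr.
Qed.

Lemma loclipD p q (f g : 'M[C]_(p, q) -> C) :
  loclip f -> loclip g -> loclip (fun A => f A + g A).
Proof.
move=> lf lg K; have [L L0 HL] := lf K; have [M M0 HM] := lg K.
exists (L + M) => [|A B AK BK]; first exact: addr_ge0.
have [f1 f2] := HL A B AK BK; have [g1 g2] := HM A B AK BK.
split; first by rewrite (le_trans (ler_cabsD _ _))// lerD.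
by rewrite opprD addrACA mulrDl (le_trans (ler_cabsD _ _))// lerD.
Qed.

Lemma loclipM p q (f g : 'M[C]_(p, q) -> C) :
  loclip f -> loclip g -> loclip (fun A => f A * g A).
Proof.
move=> lf lg K; have [L L0 HL] := lf K; have [M M0 HM] := lg K.
exists (2 * (L * M)) => [|A B AK BK]; first by rewrite !mulr_ge0.
have [f1 f2] := HL A B AK BK; have [g1 g2] := HM A B AK BK.
have [f3 _] := HL B A BK AK.
split.
  rewrite cabsM; apply: (@le_trans _ _ (L * M)); first by rewrite ler_pM ?cabs_ge0.
  by rewrite ler_peMl ?mulr_ge0// ler1n.
have -> : f A * g A - f B * g B = (f A - f B) * g A + f B * (g A - g B) by ring.
rewrite (le_trans (ler_cabsD _ _))// !cabsM.
have := ler_pM (cabs_ge0 _) (cabs_ge0 _) f2 g1.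
have := ler_pM (cabs_ge0 _) (cabs_ge0 _) f3 g2.
lra.
Qed.

Lemma loclipN p q (f : 'M[C]_(p, q) -> C) : loclip f -> loclip (fun A => - f A).
Proof.
move=> lf; have -> : (fun A => - f A) = (fun A => (-1) * f A).
  by apply/funext => A; rewrite mulN1r.
by apply: loclipM => //; apply: loclip_cst.
Qed.

Lemma loclip_sum p q (I : Type) (s : seq I) (P : pred I) (f : I -> 'M[C]_(p, q) -> C) :
  (forall i, loclip (f i)) -> loclip (fun A => \sum_(i <- s | P i) f i A).
Proof.
move=> lf; elim: s => [|i s IH].
  by under eq_fun do rewrite big_nil; apply: loclip_cst.
under eq_fun do rewrite big_cons; case: (P i) => //.
exact: loclipD.
Qed.

Definition loclipX p q (f : 'M[C]_(p, q) -> {poly C}) : Prop :=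
  forall k, loclip (fun A => (f A)`_k).

Lemma loclipX_prod p q (I : Type) (s : seq I) (P : pred I) (f : I -> 'M[C]_(p, q) -> {poly C}) :
  (forall i, loclipX (f i)) -> loclipX (fun A => \prod_(i <- s | P i) f i A).
Proof.
move=> lf; elim: s => [|i s IH] k.
  by apply: (loclip_ext (g := fun _ => (1 : {poly C})`_k)) => [A|];
    [rewrite big_nil|apply: loclip_cst].
case Pi : (P i); last first.
  by apply: (loclip_ext (g := fun A => (\prod_(i <- s | P i) f i A)`_k)) => [A|];
    [rewrite big_cons Pi|apply: IH].
apply: (loclip_ext (g := fun A =>
  \sum_(j < k.+1) (f i A)`_j * (\prod_(i <- s | P i) f i A)`_(k - j))) => [A|].
  by rewrite big_cons Pi coefM.
by apply: loclip_sum => j; apply: loclipM; [apply: lf|apply: IH].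
Qed.

Lemma loclipX_char_poly n : loclipX (fun A : 'M[C]_n => char_poly A).
Proof.
move=> k; rewrite /char_poly /determinant.
under eq_fun do rewrite coef_sum.
apply: loclip_sum => s.
have -> : (fun A : 'M[C]_n => ((-1) ^+ odd_perm s * \prod_i char_poly_mx A i (s i))`_k) =
  (fun A : 'M[C]_n => (-1) ^+ odd_perm s * (\prod_i char_poly_mx A i (s i))`_k).
  apply/funext => A; case: (odd_perm s); rewrite ?expr0 ?mul1r//.
  by rewrite expr1 !mulN1r coefN.
apply: loclipM; first exact: loclip_cst.
move: k; apply: loclipX_prod => i k.
apply: (loclip_ext (g := fun A : 'M[C]_n =>
  (('X : {poly C}) *+ (i == s i))`_k - (if k == 0%N then A i (s i) else 0))) => [A|].
  by rewrite !mxE coefB coefC.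
apply: loclipD; first exact: loclip_cst.
apply: loclipN; case: (k == 0%N); last exact: loclip_cst.
exact: loclip_coord.
Qed.

Definition loclip_mx p q p' q' (f : 'M[C]_(p, q) -> 'M[C]_(p', q')) : Prop :=
  forall i j, loclip (fun A => f A i j).

Lemma loclip_mxP p q p' q' (f : 'M[C]_(p, q) -> 'M[C]_(p', q')) : loclip_mx f ->
  forall K : R, exists2 L : R, 0 <= L & forall A B, mxnorm A <= K -> mxnorm B <= K ->
    mxnorm (f A) <= L /\ mxnorm (f A - f B) <= L * mxnorm (A - B).
Proof.
move=> lf K.
have [||L L0 HL] := @uniform_bound R ('I_p' * 'I_q')%type (fun ij L =>
  forall A B, mxnorm A <= K -> mxnorm B <= K -> cabs (f A ij.1 ij.2) <= L /\
    cabs (f A ij.1 ij.2 - f B ij.1 ij.2) <= L * mxnorm (A - B)).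
- move=> ij a b ab H A B AK BK; have [H1 H2] := H A B AK BK; split.
    exact: le_trans ab.
  by apply: le_trans H2 _; rewrite ler_wpM2r ?mxnorm_ge0.
- by move=> ij; have [L _ HL] := lf ij.1 ij.2 K; exists L.
exists L => // A B AK BK; split; apply: mxnorm_le => //.
- by move=> i j; have [H _] := HL (i, j) A B AK BK.
- by rewrite mulr_ge0 ?mxnorm_ge0.
- by move=> i j; have [_ H] := HL (i, j) A B AK BK; rewrite !mxE.
Qed.

Lemma loclip_horner_mx n (f : {poly C}) :
  loclip_mx (fun A : 'M[C]_n.+1 => horner_mx A f).
Proof.
elim/poly_ind: f => [|f c IH] i j.
  by under eq_fun do rewrite rmorph0; apply: loclip_cst.
under eq_fun do rewrite rmorphD rmorphM /= horner_mx_X horner_mx_C mxE [X in X + _]mxE.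
apply: loclipD; last exact: loclip_cst.
by apply: loclip_sum => k; apply: loclipM; [apply: IH|apply: loclip_coord].
Qed.

End LocallyLipschitz.

(** * The logarithm of the spectral radius *)

Section SpectralRadius.
Variable R : realType.
Local Notation C := (R[i]).

Definition rho n (A : 'M[C]_n) : R := \big[Num.max/0]_(l <- eigs A) cabs l.

Lemma rho_ge0 n (A : 'M[C]_n) : 0 <= rho A.
Proof.
rewrite /rho; elim: (eigs A) => [|l s IH]; first by rewrite big_nil.
by rewrite big_cons le_max IH orbT.
Qed.

Lemma eigs_rho n (A : 'M[C]_n) l : l \in eigs A -> cabs l <= rho A.
Proof.
rewrite /rho; elim: (eigs A) => [//|k s IH]; rewrite inE big_cons le_max.
by move=> /predU1P[->|/IH ->]; rewrite ?lexx ?orbT.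
Qed.

Lemma rho_le n (A : 'M[C]_n) c : 0 <= c -> (forall l, l \in eigs A -> cabs l <= c) -> rho A <= c.
Proof.
move=> c0; rewrite /rho; elim: (eigs A) => [|k s IH] H; first by rewrite big_nil.
rewrite big_cons ge_max H ?mem_head//= IH// => l ls.
by apply: H; rewrite inE ls orbT.
Qed.

Lemma rho_lt n (A : 'M[C]_n) c : 0 < c -> (forall l, l \in eigs A -> cabs l < c) -> rho A < c.
Proof.
move=> c0; rewrite /rho; elim: (eigs A) => [|k s IH] H; first by rewrite big_nil.
rewrite big_cons gt_max H ?mem_head//= IH// => l ls.
by apply: H; rewrite inE ls orbT.
Qed.

Lemma spectral_radiusE n (A : 'M[C]_n.+1) : spectral_radius A = rho A.
Proof.
have eigE l : eigenvalue A l = (l \in eigs A) by rewrite mem_eigs eigenvalue_root_char.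
have ub : ubound [set cabs l | l in [set l : C | eigenvalue A l]] (rho A).
  by move=> _ [l /= + <-]; rewrite eigE; apply: eigs_rho.
have [l0 l0A] : exists l, l \in eigs A.
  by case E : (eigs A) (size_eigs A) => [//|l s] _; exists l; rewrite mem_head.
apply/le_anti/andP; split.
  by apply: ge_sup => //; exists (cabs l0), l0; rewrite //= eigE.
have ubs l : l \in eigs A -> cabs l <= spectral_radius A.
  by move=> lA; apply: ub_le_sup; [exists (rho A)|exists l; rewrite //= eigE].
by apply: rho_le => //; apply: le_trans (ubs _ l0A); apply: cabs_ge0.
Qed.

Lemma spectral_ballP n (A : 'M[C]_n.+1) :
  spectral_ball n.+1 A <-> forall l, root (char_poly A) l -> cabs l < 1.
Proof.
rewrite /spectral_ball /= spectral_radiusE; split=> [r1 l|H].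
  by rewrite -mem_eigs => /eigs_rho/le_lt_trans; apply.
by apply: rho_lt => // l; rewrite mem_eigs; apply: H.
Qed.

Lemma rho_mxnorm n (A : 'M[C]_n) : rho A <= n%:R * mxnorm A.
Proof.
apply: rho_le => [|l]; first by rewrite mulr_ge0 ?mxnorm_ge0.
rewrite mem_eigs -eigenvalue_root_char => /eigenvalueP[v vA v0].
have nv : 0 < mxnorm v by rewrite mxnorm_gt0.
have := ler_mxnormM v A; rewrite vA mxnormZ [mxnorm v * _]mulrC mulrA.
by rewrite ler_pM2r.
Qed.

Lemma mxtrace_pow n (A : 'M[C]_n.+1) N : \tr (A ^+ N) = \sum_(l <- eigs A) l ^+ N.
Proof.
have -> : A ^+ N = horner_mx A 'X^N by rewrite rmorphXn /= horner_mx_X.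
transitivity (\sum_(l <- [seq ('X^N).[l] | l <- eigs A]) l).
  by rewrite mxtrace_eigs; apply: perm_big; apply: eigs_horner.
rewrite big_map; apply: eq_bigr => l _; exact: hornerXn.
Qed.

Lemma mxtrace_pow_le n (A : 'M[C]_n.+1) N : cabs (\tr (A ^+ N)) <= n.+1%:R * rho A ^+ N.
Proof.
rewrite mxtrace_pow (le_trans (ler_cabs_sum _ _ _))//.
have -> : n.+1%:R * rho A ^+ N = \sum_(l <- eigs A) rho A ^+ N.
  by rewrite big_const_seq count_predT size_eigs iter_addr_0 mulr_natl.
rewrite big_seq [leRHS]big_seq; apply: ler_sum => l lA.
by rewrite cabsX lerXn2r ?nnegrE ?cabs_ge0 ?rho_ge0 ?eigs_rho.
Qed.

Lemma bernoulli (t : R) N : 1 <= t -> 1 + N%:R * (t - 1) <= t ^+ N.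
Proof.
move=> t1; elim: N => [|N IH]; first by rewrite mul0r addr0 expr0.
rewrite exprS -[N.+1%:R]natr1.
have : t * (1 + N%:R * (t - 1)) <= t * t ^+ N by rewrite ler_wpM2l//; lra.
have : 0 <= N%:R * ((t - 1) * (t - 1)) by rewrite mulr_ge0// -expr2 sqr_ge0.
lra.
Qed.

(** If [x > y > 0], then [(x / y)^N] would stay below [K / c], against Bernoulli's inequality. *)
Lemma geometric_le (x y c K : R) : 0 < c -> 0 <= x -> 0 <= y ->
  (forall N, c * x ^+ N <= K * y ^+ N) -> x <= y.
Proof.
move=> c0 x0 y0 H; rewrite leNgt; apply/negP => yx.
have [y00|yp] := eqVneq y 0.
  by have := H 1%N; rewrite y00 !expr1 mulr0 leNgt mulr_gt0// -y00.
have {}yp : 0 < y by rewrite lt_def yp.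
have t1 : 0 < x / y - 1 by rewrite subr_gt0 ltr_pdivlMr// mul1r.
pose N := (Num.truncn (K / c / (x / y - 1))).+1.
have KN : K / c / (x / y - 1) < N%:R by exact: truncnS_gt.
have := H N; rewrite -ler_pdivrMr ?exprn_gt0// -mulrA -expr_div_n mulrC -ler_pdivlMr//.
have := @bernoulli (x / y) N; rewrite -subr_ge0 => /(_ (ltW t1)).
move: KN; rewrite ltr_pdivrMr// => KN H1 H2.
move: KN H1 H2; move: (N%:R * _) ((x / y) ^+ N) (K / c) => X Y Z; lra.
Qed.

(* A polynomial vanishing at the other eigenvalues isolates [l ^ N] as a fixed
   combination of the traces of consecutive powers. *)
Lemma rho_trace n (A : 'M[C]_n.+1) (K B : R) : 0 <= B ->
  (forall N, cabs (\tr (A ^+ N)) <= K * B ^+ N) -> rho A <= B.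
Proof.
move=> B0 H; apply: rho_le => // l0 l0A.
pose P := \prod_(l <- eigs A | l != l0) ('X - l%:P).
have P0 : P.[l0] != 0.
  rewrite /P horner_prod prodf_seq_neq0; apply/allP => l _; apply/implyP => ll0.
  by rewrite hornerXsubC subr_eq0 eq_sym.
have Pl l : l \in eigs A -> l != l0 -> P.[l] = 0.
  move=> lA ll0; apply/eqP; rewrite /P horner_prod prodf_seq_eq0.
  by apply/hasP; exists l => //; rewrite ll0 hornerXsubC subrr eqxx.
pose k := count_mem l0 (eigs A).
have k0 : (0 < k)%N by rewrite -has_count has_pred1.
have iso N : \sum_(i < size P) P`_i * \tr (A ^+ (N + i)) = k%:R * (l0 ^+ N * P.[l0]).
  transitivity (\sum_(l <- eigs A) l ^+ N * P.[l]).
    under eq_bigr do rewrite mxtrace_pow mulr_sumr.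
    rewrite exchange_big /=; apply: eq_bigr => l _.
    rewrite horner_coef mulr_sumr; apply: eq_bigr => i _.
    by rewrite exprD mulrCA.
  have Z : \sum_(l <- eigs A | l != l0) l ^+ N * P.[l] = 0.
    by rewrite big_seq_cond big1// => l /andP[lA ll0]; rewrite Pl// mulr0.
  rewrite (bigID (pred1 l0)) /= Z addr0.
  rewrite (eq_bigr (fun _ => l0 ^+ N * P.[l0])); last by move=> l /eqP ->.
  by rewrite big_const_seq iter_addr_0 mulr_natl.
apply: (@geometric_le _ _ (k%:R * cabs P.[l0]) (\sum_(i < size P) cabs P`_i * (K * B ^+ i))) => //.
- by rewrite mulr_gt0 ?ltr0n// cabs_gt0.
- exact: cabs_ge0.
move=> N; have -> : k%:R * cabs P.[l0] * cabs l0 ^+ N = cabs (k%:R * (l0 ^+ N * P.[l0])).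
  by rewrite cabsM (cabsM (_ ^+ _)) cabsX cabs_nat mulrCA mulrC.
rewrite -iso (le_trans (ler_cabs_sum _ _ _))// mulr_suml; apply: ler_sum => i _.
rewrite cabsM -!mulrA ler_wpM2l ?cabs_ge0// (le_trans (H _))//.
by rewrite addnC exprD.
Qed.

Lemma rho_usc n (A : 'M[C]_n.+1) (c : R) : rho A < c ->
  exists2 d : R, 0 < d & forall B, mxnorm (B - A) < d -> rho B < c.
Proof.
move=> Ac; have c0 : 0 < c by apply: le_lt_trans Ac; apply: rho_ge0.
have [|e e0 He] := @roots_open R (eigs A) c c0.
  by move=> l /eigs_rho /le_lt_trans; apply.
have [||L L0 HL] := @uniform_bound R 'I_n.+1 (fun (k : 'I_n.+1) (L : R) => forall B B' : 'M[C]_n.+1,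
   mxnorm B <= mxnorm A + 1 -> mxnorm B' <= mxnorm A + 1 ->
   cabs ((char_poly B)`_k - (char_poly B')`_k) <= L * mxnorm (B - B')).
- move=> k a b ab H B B' B1 B2; apply: le_trans (H _ _ B1 B2) _.
  by rewrite ler_wpM2r ?mxnorm_ge0.
- move=> k; have [L _ HL] := @loclipX_char_poly R n.+1 k (mxnorm A + 1).
  by exists L => B B' B1 B2; have [] := HL _ _ B1 B2.
have L1 : 0 < L + 1 by rewrite ltr_wpDl.
exists (Num.min 1 (e / (L + 1))); first by rewrite lt_min ltr01 divr_gt0.
move=> B; rewrite lt_min => /andP[B1 Be]; apply: rho_lt => // l; rewrite mem_eigs.
apply: He; rewrite ?char_poly_monic ?size_char_poly ?size_eigs// => k kn.
rewrite -char_poly_eigs (le_lt_trans (HL (Ordinal kn) _ _ _ _))//=.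
- have -> : B = B - A + A by rewrite subrK.
  by rewrite addrC (le_trans (ler_mxnormD _ _))// lerD2l ltW.
- by rewrite lerDl.
- move: Be; rewrite ltr_pdivlMr// => Be; apply: le_lt_trans Be.
  by rewrite mulrC ler_wpM2l ?mxnorm_ge0// lerDl.
Qed.

End SpectralRadius.

(** * Polynomial functions on a line and their maximum principle *)

Section PolynomialFunctions.
Variable R : realType.
Local Notation C := (R[i]).

Definition polyfun (f : C -> C) : Prop := exists T : {poly C}, forall z, f z = T.[z].

Lemma polyfun_cst c : polyfun (fun _ => c).
Proof. by exists c%:P => z; rewrite hornerC. Qed.

Lemma polyfunD f g : polyfun f -> polyfun g -> polyfun (fun z => f z + g z).
Proof. by move=> [S HS] [T HT]; exists (S + T) => z; rewrite hornerD HS HT. Qed.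

Lemma polyfunM f g : polyfun f -> polyfun g -> polyfun (fun z => f z * g z).
Proof. by move=> [S HS] [T HT]; exists (S * T) => z; rewrite hornerM HS HT. Qed.

Lemma polyfun_sum (I : Type) (s : seq I) (f : I -> C -> C) :
  (forall i, polyfun (f i)) -> polyfun (fun z => \sum_(i <- s) f i z).
Proof.
move=> H; elim: s => [|i s IH].
  by exists 0 => z; rewrite big_nil horner0.
have [T HT] := polyfunD (H i) IH.
by exists T => z; rewrite big_cons HT.
Qed.

Lemma polyfun_mxtrace n (a b : 'M[C]_n.+1) (f : {poly C}) :
  polyfun (fun z => \tr (horner_mx (a + z *: b) f)).
Proof.
have line i j : polyfun (fun z => (a + z *: b) i j).
  by exists ((a i j)%:P + b i j *: 'X) => z; rewrite !mxE !hornerE mulrC.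
have H i j : polyfun (fun z => horner_mx (a + z *: b) f i j).
  elim/poly_ind: f i j => [|f c IH] i j.
    by exists 0 => z; rewrite rmorph0 mxE horner0.
  have [T HT] := polyfunD (polyfun_sum (index_enum 'I_n.+1)
    (fun k => polyfunM (IH i k) (line k j))) (polyfun_cst ((c%:M : 'M_n.+1) i j)).
  exists T => z; rewrite -HT rmorphD rmorphM /= horner_mx_X horner_mx_C.
  by rewrite mxE [X in X + _]mxE.
have [T HT] := polyfun_sum (index_enum 'I_n.+1) (fun i => H i i).
by exists T => z; rewrite -HT.
Qed.

Lemma cos_lt1 (x : R) : 0 < x < 2 * pi -> cos x != 1.
Proof.
move=> /andP[x0 x2]; have -> : x = x / 2 + x / 2 by lra.
have : 0 < sin (x / 2) by apply: sin_gt0_pi; apply/andP; split; lra.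
have := cos2Dsin2 (x / 2); rewrite cosD -!expr2 => E s0; apply/eqP => c1.
have : 0 < sin (x / 2) ^+ 2 by rewrite exprn_gt0.
lra.
Qed.

Lemma sum_roots_of_unity (r : R) (M k : nat) : (0 < k < M.+1)%N ->
  \sum_(j < M.+1) circ r (2 * pi * j%:R / M.+1%:R) ^+ k = 0 :> C.
Proof.
move=> /andP[k0 kM].
have M0 : 0 < M.+1%:R :> R by rewrite ltr0n.
pose eta : C := circ 1 (2 * pi * k%:R / M.+1%:R).
have etaM : eta ^+ M.+1 = 1.
  rewrite /eta circX expr1n -[_ *+ M.+1]mulr_natr divfK ?gt_eqF//.
  by rewrite -[2 * _ * _]add0r circ_2pi circ_real.
have eta1 : eta - 1 != 0.
  rewrite subr_eq0; apply/eqP => /(congr1 (@complex.Re R)) /=; rewrite mul1r.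
  have pi0 : 0 < 2 * pi :> R by rewrite mulr_gt0 ?pi_gt0.
  have x2 : 0 < (2 * pi * k%:R / M.+1%:R : R) < 2 * pi.
    rewrite ltr_pdivrMr// ltr_pM2l// ltr_nat kM andbT.
    by rewrite divr_gt0// mulr_gt0// ltr0n.
  exact/eqP/(cos_lt1 x2).
have : (eta - 1) * \sum_(j < M.+1) eta ^+ j = 0 by rewrite -subrX1 etaM subrr.
move/eqP; rewrite mulf_eq0 (negbTE eta1) /= => /eqP E.
transitivity ((r ^+ k)%:C%C * \sum_(j < M.+1) eta ^+ j); last by rewrite E mulr0.
rewrite mulr_sumr; apply: eq_bigr => j _.
rewrite /eta !circX expr1n circZ mulr1; congr circ.
by rewrite -[LHS]mulr_natr -[RHS]mulr_natr mulrAC [RHS]mulrAC; congr (_ * _); apply: mulrAC.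
Qed.

(** The mean over [size f + 1] equally spaced points of the circle annihilates every positive power
    that occurs and leaves [f.[0]]. Hence one of these points has modulus at least that of the
    centre value. *)
Lemma poly_max_circle (f : {poly C}) (r : R) : 0 < r ->
  exists2 t : R, 0 <= t <= 2 * pi & cabs f.[0] <= cabs f.[circ r t].
Proof.
move=> r0; set M := size f; pose t j : R := 2 * pi * j%:R / M.+1%:R.
have M0 : 0 < M.+1%:R :> R by rewrite ltr0n.
have pi0 : 0 <= 2 * pi :> R by rewrite mulr_ge0 ?pi_ge0.
have mean : \sum_(j < M.+1) f.[circ r (t j)] = M.+1%:R * f.[0].
  under eq_bigr do rewrite (horner_coef_wide _ (leqnSn M)).
  rewrite exchange_big /= horner_coef0 big_ord_recl /= [X in _ + X]big1 ?addr0.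
    under eq_bigr do rewrite expr0 mulr1.
    by rewrite sumr_const card_ord mulr_natl.
  move=> i _; rewrite -mulr_sumr /t sum_roots_of_unity ?mulr0//.
  by rewrite /bump /= add1n /= ltnS ltn_ord.
have [[j jle]|no] := pselect (exists j : 'I_M.+1, cabs f.[0] <= cabs f.[circ r (t j)]).
  exists (t j) => //; rewrite /t divr_ge0 ?mulr_ge0 ?pi_ge0//= ler_pdivrMr//.
  by rewrite ler_wpM2l// ler_nat ltnW.
exfalso; have : cabs (M.+1%:R * f.[0]) < M.+1%:R * cabs f.[0].
  rewrite -mean (le_lt_trans (ler_cabs_sum _ _ _))//.
  apply: (@lt_le_trans _ _ (\sum_(j < M.+1) cabs f.[0])).
    apply: ltr_sum; first by apply/hasP; exists ord0; rewrite ?mem_index_enum.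
    by move=> j _; rewrite ltNge; apply/negP => jle; apply: no; exists j.
  by rewrite sumr_const card_ord mulr_natl.
by rewrite cabsM cabs_nat ltxx.
Qed.

End PolynomialFunctions.

Section LogSpectralRadius.
Variable R : realType.
Local Notation C := (R[i]).
Local Notation mu := (@lebesgue_measure R).
Variables (n : nat) (q : {poly C}) (C0 : R).

(** [lne] supplies the value [-oo] where [q M] is nilpotent. [C0] is a normalization, chosen later
    to make the function negative on the ball. *)
Definition ln_rho (M : 'M[C]_n.+1) : \bar R :=
  (lne (rho (horner_mx M q))%:E - C0%:E)%E.

Lemma ln_rho_le M (g : R) : (ln_rho M <= g%:E)%E = (rho (horner_mx M q) <= expR (g + C0)).
Proof.
rewrite /ln_rho leeBlDr// -EFinD.
have := rho_ge0 (horner_mx M q); rewrite le_eqVlt => /predU1P[<-|r0].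
  by rewrite le0_lneNy// leNye expR_ge0.
by rewrite lne_EFin// lee_fin -[in LHS]ler_expR lnK.
Qed.

Lemma ln_rho_lt M (g : R) : (ln_rho M < g%:E)%E = (rho (horner_mx M q) < expR (g + C0)).
Proof.
rewrite /ln_rho lteBlDr// -EFinD.
have := rho_ge0 (horner_mx M q); rewrite le_eqVlt => /predU1P[<-|r0].
  by rewrite le0_lneNy// ltNyr expR_gt0.
by rewrite lne_EFin// lte_fin -[in LHS]ltr_expR lnK.
Qed.

Lemma ln_rho_usc (D : set 'M[C]_n.+1) : (forall M, D M -> (ln_rho M <= 0)%E) ->
  usc_on D ln_rho.
Proof.
move=> u0; split=> [x /u0 ux|x Dx c ux]; first exact: le_lt_trans ux _.
have /rho_usc[d d0 Hd] : rho (horner_mx x q) < expR (c + C0) by rewrite -ln_rho_lt.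
have [L L0 HL] := loclip_mxP (@loclip_horner_mx R n q) (mxnorm x + 1).
have L1 : 0 < L + 1 by rewrite ltr_wpDl.
exists (Num.min 1 (d / (L + 1))); first by rewrite lt_min ltr01 divr_gt0.
move=> y _; rewrite lt_min => /andP[y1 yd]; rewrite ln_rho_lt; apply: Hd.
have yx : mxnorm y <= mxnorm x + 1.
  have -> : y = y - x + x by rewrite subrK.
  by rewrite addrC (le_trans (ler_mxnormD _ _))// lerD2l ltW.
have xx : mxnorm x <= mxnorm x + 1 by rewrite lerDl.
have [_ H] := HL y x yx xx; rewrite (le_lt_trans H)//.
move: yd; rewrite ltr_pdivlMr// => yd; apply: le_lt_trans yd.
by rewrite mulrC ler_wpM2l ?mxnorm_ge0// lerDl.
Qed.

(* On each circle the maximum principle is applied to the polynomial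
   [prod_j tr (q(a + w_j z b) ^ N)], [w_j] running over the roots of unity;
   [N] tends to infinity through [rho_trace]. *)
Lemma ln_rho_psh (D : set 'M[C]_n.+1) : (forall M, D M -> (ln_rho M <= 0)%E) ->
  psh_on D ln_rho.
Proof.
move=> u0; have uscu := ln_rho_usc u0; split=> // a b r Da r0 Dab; have r0' := ltW r0.
apply: (arcs_submean uscu u0 (g := fun t => a + circ r t *: b) (L := 2 * r * mxnorm b)).
- by move=> t; apply: Dab; rewrite cabs_circ.
- by move=> s t; apply: circle_lip.
move=> m c Hc.
have m0 : 0 < m.+1%:R :> R by rewrite ltr0n.
have mi0 : 0 <= m.+1%:R^-1 :> R by rewrite invr_ge0 ltW.
have bound (j : 'I_m.+1) t : in_arc m j t ->
    rho (horner_mx (a + circ r t *: b) q) <= expR (c j + C0).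
  move=> tj; rewrite -ln_rho_le; apply: (Hc j t) => //.
    by rewrite subrr mxnorm0.
  by apply: Dab; rewrite cabs_circ.
rewrite ln_rho_le.
pose S := \sum_j (c j + C0).
have -> : (\sum_j c j) / m.+1%:R + C0 = S / m.+1%:R.
  rewrite /S big_split /= mulrDl sumr_const card_ord -[C0 *+ _]mulr_natr.
  by rewrite mulfK// gt_eqF.
(* It suffices to bound the trace of every power [N]. The maximum principle bounds the [(m + 1)]-th
   power of that trace by a product over the arcs, hence the mean [S / (m + 1)] in the exponent; the
   factor [n + 1] is independent of [N], and [rho_trace] discards it. *)
apply: (@rho_trace _ _ _ n.+1%:R); first exact: expR_ge0.
move=> N; rewrite -rmorphXn /=.
have [T HT] := polyfun_mxtrace a b (q ^+ N).
have := HT 0; rewrite scale0r addr0 => ->.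
pose w (j : 'I_m.+1) : C := circ 1 (2 * pi * j%:R / m.+1%:R).
pose P := \prod_(j < m.+1) (T \Po (w j *: 'X)).
have PE z : P.[z] = \prod_(j < m.+1) T.[w j * z].
  by rewrite /P horner_prod; apply: eq_bigr => j _; rewrite horner_comp hornerZ hornerX.
have [t t2] := poly_max_circle P r0; rewrite !PE.
under eq_bigr do rewrite mulr0.
rewrite prodr_const card_ord cabsX cabs_prod => Hmax.
have [l Hl] := arc_rotation m t2.
have fac (j : 'I_m.+1) : cabs T.[w j * circ r t] <= n.+1%:R * expR (c (l + j)%R + C0) ^+ N.
  have [s sj sE] := Hl j.
  rewrite /w circM mul1r addrC sE -HT rmorphXn /=.
  rewrite (le_trans (mxtrace_pow_le _ _))// ler_wpM2l// lerXn2r ?nnegrE ?rho_ge0 ?expR_ge0//.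
  exact: bound.
have : cabs T.[0] ^+ m.+1 <= (n.+1%:R * expR (S / m.+1%:R) ^+ N) ^+ m.+1.
  apply: (le_trans Hmax).
  apply: (@le_trans _ _ (\prod_(j < m.+1) (n.+1%:R * expR (c (l + j)%R + C0) ^+ N))).
    by apply: ler_prod => j _; rewrite cabs_ge0 fac.
  rewrite big_split /= prodr_const card_ord exprMn ler_wpM2l ?exprn_ge0//.
  have SE : \prod_(j < m.+1) expR (c (l + j)%R + C0) = expR S.
    by rewrite /S [in RHS](reindex_inj (addrI l)) /= (big_morph expR (@expRD R) (@expR0 R)).
  rewrite prodrXl SE -exprM mulnC exprM -[X in _ <= X ^+ N]expRM_natl.
  by rewrite [_ * (S / _)]mulrC divfK// gt_eqF.
by rewrite ler_pXn2r ?nnegrE ?cabs_ge0 ?mulr_ge0 ?exprn_ge0 ?expR_ge0.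
Qed.

End LogSpectralRadius.

(** * Constancy on the fibres of sigma *)

Section AffineChange.
Variable R : realType.
Local Notation C := (R[i]).

Lemma psh_comp_affine p q p' q' (D : set 'M[C]_(p, q)) (D' : set 'M[C]_(p', q'))
    (u : 'M[C]_(p, q) -> \bar R) (L L0 : 'M[C]_(p', q') -> 'M[C]_(p, q)) (K : R) :
  (forall x z y, L (x + z *: y) = L x + z *: L0 y) -> 0 <= K ->
  (forall x y, mxnorm (L x - L y) <= K * mxnorm (x - y)) ->
  (forall x, D' x -> D (L x)) -> psh_on D u -> psh_on D' (fun x => u (L x)).
Proof.
move=> affL K0 lipL DL [[uoo usc] sub]; split; [split|].
- by move=> x /DL; apply: uoo.
- move=> x /DL Dx c /(usc _ Dx)[d d0 Hd].
  have K1 : 0 < K + 1 by rewrite ltr_wpDl.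
  exists (d / (K + 1)); first by rewrite divr_gt0.
  move=> y /DL Dy; rewrite ltr_pdivlMr// => yd; apply: Hd => //.
  apply: le_lt_trans (lipL _ _) _; apply: le_lt_trans yd.
  by rewrite mulrC ler_wpM2l ?mxnorm_ge0// lerDl.
- move=> a b r /DL Da r0 Dab.
  have Lab z : cabs z <= r -> D (L a + z *: L0 b) by move=> zr; rewrite -affL; apply/DL/Dab.
  have := sub (L a) (L0 b) r Da r0 Lab.
  have -> : (fun t => u (L (a + circ r t *: b))) = (fun t => u (L a + circ r t *: L0 b)).
    by apply/funext => t; rewrite affL.
  by [].
Qed.

(** The spectral ball in terms of the characteristic polynomial alone, so that it is visibly a union
    of fibres of [sigma]. *)
Definition char_ball n : set 'M[C]_n :=
  [set A | forall l, root (char_poly A) l -> cabs l < 1].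

Lemma spectral_ballE n : @spectral_ball R n.+1 = @char_ball n.+1.
Proof. by apply/seteqP; split=> A /spectral_ballP. Qed.

Lemma char_ball_eq n (A B : 'M[C]_n) : char_poly A = char_poly B -> char_ball A -> char_ball B.
Proof. by rewrite /char_ball /= => ->. Qed.

Lemma psh_conj n (u : 'M[C]_n -> \bar R) (S : 'M[C]_n) : S \in unitmx ->
  psh_on (@char_ball n) u -> psh_on (@char_ball n) (fun M => u (invmx S *m M *m S)).
Proof.
move=> uS; apply: (@psh_comp_affine _ _ _ _ _ _ _ _ (fun M => invmx S *m M *m S)
   (n%:R * (n%:R * mxnorm (invmx S)) * mxnorm S)).
- by move=> x z y; rewrite mulmxDr mulmxDl -scalemxAr -scalemxAl.
- by rewrite !mulr_ge0 ?mxnorm_ge0.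
- move=> x y; rewrite -mulmxBl -mulmxBr (le_trans (ler_mxnormM _ _))//.
  rewrite -!mulrA ler_wpM2l// mulrCA [mxnorm (invmx S) * _]mulrCA !mulrA.
  rewrite [leRHS]mulrAC ler_wpM2r ?mxnorm_ge0//.
  by rewrite (le_trans (ler_mxnormM _ _))// mulrA.
- by move=> x; apply: char_ball_eq; rewrite char_poly_conj.
Qed.

Lemma gl_gen_unitmx n (S : 'M[C]_n) : gl_gen S -> S \in unitmx.
Proof.
elim=> {n S} [n d d0|n N _ NN|n N _ NN|n A B _ uA _ uB].
- by rewrite unitmxE det_diag unitfE; apply/prodf_neq0 => i _; apply: d0.
- by have [] := gen_conj_diag 0 NN.
- by have [] := gen_conj_diag 0 NN.
- by rewrite unitmx_mul uA.
Qed.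

(** Induction on the generators. [u] is quantified after [S] because, for a product [A B], the
    hypothesis on [A] is applied to [M |-> u (B^-1 M B)], again negative and plurisubharmonic. *)
Lemma psh_gl_gen_diag n (S : 'M[C]_n) : gl_gen S ->
  forall u : 'M[C]_n -> \bar R, psh_on (@char_ball n) u ->
  (forall M, char_ball M -> (u M <= 0)%E) ->
  forall d, char_ball (diag_mx d) -> u (invmx S *m diag_mx d *m S) = u (diag_mx d).
Proof.
elim=> {n S} [n d d0|n N lN NN|n N lN NN|n A B gA IHA gB IHB] u pshu u0 e De.
- have /gl_gen_unitmx ud := gen_diag d0.
  by rewrite -mulmxA diag_mxC mulKmx.
- have [_ ->] := gen_conj_diag e NN.
  apply: (psh_line_eq pshu u0) => z.
  by apply: char_ball_eq De; rewrite char_poly_diag_low.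
- have [_ ->] := gen_conj_diag e NN.
  apply: (psh_line_eq pshu u0) => z.
  by apply: char_ball_eq De; rewrite char_poly_diag_up.
- have uA := gl_gen_unitmx gA; have uB := gl_gen_unitmx gB.
  have -> : invmx (A *m B) = invmx B *m invmx A.
    have uAB : A *m B \in unitmx by rewrite unitmx_mul uA.
    have E : invmx B *m invmx A *m (A *m B) = 1%:M by rewrite -mulmxA mulKmx// mulVmx.
    by rewrite -[RHS](mulmxK uAB) E mul1mx.
  have -> : invmx B *m invmx A *m diag_mx e *m (A *m B) =
    invmx B *m (invmx A *m diag_mx e *m A) *m B by rewrite !mulmxA.
  rewrite (IHA (fun M => u (invmx B *m M *m B)))//; first exact: IHB.
    exact: psh_conj.
  by move=> M DM; apply: u0; apply: char_ball_eq DM; rewrite char_poly_conj.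
Qed.

Lemma psh_unit_diag n (S : 'M[C]_n) (u : 'M[C]_n -> \bar R) d : S \in unitmx ->
  psh_on (@char_ball n) u -> (forall M, char_ball M -> (u M <= 0)%E) ->
  char_ball (diag_mx d) -> u (invmx S *m diag_mx d *m S) = u (diag_mx d).
Proof. by move=> /unitmx_gl_gen/psh_gl_gen_diag H ? ? ?; apply: H. Qed.

(** Scaling the strictly triangular part by [z] leaves the diagonal, hence the characteristic
    polynomial, unchanged: the line through [D] and [T] stays in the fibre. *)
Lemma psh_trig n (u : 'M[C]_n -> \bar R) (T : 'M[C]_n) :
  psh_on (@char_ball n) u -> (forall M, char_ball M -> (u M <= 0)%E) ->
  is_trig_mx T -> char_ball T -> u T = u (diag_mx (\row_i T i i)).
Proof.
move=> pshu u0 /is_trig_mxP tT DT; set D := diag_mx _.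
have DE i j : D i j = T i i *+ (i == j) by rewrite !mxE.
have entry z i j : (D + z *: (T - D)) i j = D i j + z * (T i j - D i j).
  by move: (D) => E; rewrite !mxE.
rewrite -{1}(subrK D T) addrC; apply: (psh_line_eq pshu u0) => z.
apply: char_ball_eq DT; rewrite !char_poly_trig//; last 2 first.
- apply/is_trig_mxP => i j ij; rewrite entry DE (tT _ _ ij).
  by rewrite -val_eqE/= ltn_eqF// mulr0n subr0 mulr0 addr0.
- exact/is_trig_mxP.
apply: eq_bigr => i _; rewrite entry DE eqxx mulr1n.
by rewrite subrr mulr0 addr0.
Qed.

(** Each matrix is linked to a diagonal one through its triangular form; the diagonals of the two
    matrices are permutations of the same list, and permutation matrices are invertible. *)
Lemma psh_fibre_const n (u : 'M[C]_n.+1 -> \bar R) (A B : 'M[C]_n.+1) :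
  psh_on (@char_ball n.+1) u -> (forall M, char_ball M -> (u M <= 0)%E) ->
  char_ball A -> char_poly A = char_poly B -> u A = u B.
Proof.
move=> pshu u0 DA AB; have DB := char_ball_eq AB DA.
have diagE M : char_ball M -> exists2 d : 'rV[C]_n.+1,
    u M = u (diag_mx d) /\ char_ball (diag_mx d) &
    perm_eq [seq d 0 i | i <- enum 'I_n.+1] (eigs M).
  move=> DM; have [P [T [uP tT ME]]] := triangularize M.
  have DT : char_ball T by apply: char_ball_eq DM; rewrite ME char_poly_conj.
  have DD : char_ball (diag_mx (\row_i T i i)).
    apply: char_ball_eq DT; rewrite !char_poly_trig ?diag_mx_is_trig//.
    by apply: eq_bigr => i _; rewrite !mxE eqxx mulr1n.
  exists (\row_i T i i); last first.
    rewrite perm_sym (permPl (eigs_trig uP tT ME)).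
    by under [X in perm_eq _ X]eq_map do rewrite mxE.
  split=> //; rewrite ME.
  rewrite (@psh_trig _ (fun M => u (invmx P *m M *m P)))//; last 2 first.
  - exact: psh_conj.
  - by move=> N DN; apply: u0; apply: char_ball_eq DN; rewrite char_poly_conj.
  exact: psh_unit_diag.
have [d [ud Dd] pd] := diagE A DA; have [e [ue De] pe] := diagE B DB.
have eAB : eigs A = eigs B by rewrite /eigs AB.
have [|S uS dS] := @diag_perm _ _ d e.
  by apply: (perm_trans pe); rewrite -eAB perm_sym; exact: pd.
by rewrite ud ue dS psh_unit_diag.
Qed.

End AffineChange.

(** * Cyclic matrices *)

Section SigmaMap.
Variable R : realType.
Local Notation C := (R[i]).

Lemma sigma_poly_sigma n (A : 'M[C]_n) : sigma_poly (sigma A) = char_poly A.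
Proof.
apply/polyP => k; have [kn|nk] := ltnP k n.
  rewrite (coef_sigma_poly (sigma A) (Ordinal kn)) /sigma_coef mxE /=.
  rewrite mulrA -exprD subnSK// subnBA ?(ltnW kn)// addnC addnK.
  by rewrite -signr_odd oddD addbb mul1r.
have [->|neq] := eqVneq k n.
  have := monicP (sigma_poly_monic (sigma A)); rewrite lead_coefE size_sigma_poly /= => ->.
  by have := monicP (char_poly_monic A); rewrite lead_coefE size_char_poly.
have nk' : (n < k)%N by rewrite ltn_neqAle eq_sym neq.
by rewrite !nth_default ?size_sigma_poly ?size_char_poly.
Qed.

Lemma sigma_mxK n (s : 'rV[C]_n.+1) : sigma (sigma_mx s) = s.
Proof.
apply/rowP => j; rewrite mxE char_poly_sigma_mx.
have -> : (n.+1 - j.+1)%N = rev_ord j by [].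
rewrite coef_sigma_poly /sigma_coef rev_ordK mulrA -exprD /=.
rewrite subKn ?ltn_ord//.
by rewrite -signr_odd oddD addbb mul1r.
Qed.

Lemma symm_polydisc_sigma n (A : 'M[C]_n.+1) :
  char_ball A -> symm_polydisc n.+1 (sigma A).
Proof. by move=> DA; exists A => //; rewrite spectral_ballE. Qed.

Lemma char_ball_sigma_mx n (s : 'rV[C]_n.+1) :
  symm_polydisc n.+1 s -> char_ball (sigma_mx s).
Proof.
move=> [A]; rewrite spectral_ballE => DA <-; apply: char_ball_eq DA.
by rewrite char_poly_sigma_mx sigma_poly_sigma.
Qed.

Definition sigma_mx_lin n (s : 'rV[C]_n.+1) : 'M[C]_n.+1 :=
  \matrix_(i, j) if j == ord_max then - sigma_coef s i else 0.

Lemma sigma_mx_affine n (x : 'rV[C]_n.+1) z (y : 'rV[C]_n.+1) :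
  sigma_mx (x + z *: y) = sigma_mx x + z *: sigma_mx_lin y.
Proof.
apply/matrixP => i j; rewrite !mxE; case: ifP => _; last by rewrite mulr0 addr0.
by rewrite /sigma_coef !mxE mulrDr opprD mulrN mulrCA.
Qed.

Lemma cabs_mxnormB p q (A B : 'M[C]_(p, q)) i j : cabs (A i j - B i j) <= mxnorm (A - B).
Proof. by have := cabs_mxnorm (A - B) i j; rewrite !mxE. Qed.

Lemma mxnorm_sigma_mxB n (x y : 'rV[C]_n.+1) :
  mxnorm (sigma_mx x - sigma_mx y) <= 1 * mxnorm (x - y).
Proof.
rewrite mul1r; apply: mxnorm_le; first exact: mxnorm_ge0.
move=> i j; rewrite !mxE; case: ifP => _; last by rewrite subrr cabs0 mxnorm_ge0.
rewrite /sigma_coef opprK addrC -mulrBr cabsM cabsX cabsN cabs1 expr1n mul1r cabsB.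
exact: cabs_mxnormB.
Qed.

Lemma loclip_sigma n : loclip_mx (@sigma R n).
Proof.
move=> i j; pose e : C := (-1) ^+ j.+1.
apply: (@loclip_ext _ _ _ _ (fun A : 'M[C]_n => e * (char_poly A)`_(n - j.+1))).
  by move=> A; rewrite mxE.
apply: loclipM; [exact: loclip_cst|exact: loclipX_char_poly].
Qed.

(** The polynomials are the signed coefficients of the characteristic polynomial of [a + 'X b], a
    matrix over [{poly C}]; evaluation at [z] commutes with [char_poly]. *)
Lemma sigma_pencil n (a b : 'M[C]_n) :
  exists F : 'M[{poly C}]_(1, n), forall z, mxeval F z = sigma (a + z *: b).
Proof.
pose A : 'M[{poly C}]_n := map_mx polyC a + 'X *: map_mx polyC b.
exists (\row_j (((-1) ^+ j.+1)%:P * (char_poly A)`_(n - j.+1))) => z.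
apply/matrixP => i j; rewrite !mxE hornerM hornerC; congr (_ * _).
have -> : a + z *: b = map_mx (horner_eval z) A.
  apply/matrixP => k l; rewrite !mxE /horner_eval hornerD hornerM hornerX !hornerC.
  by [].
by rewrite -map_char_poly coef_map.
Qed.

(** Any [s] is the image of its companion matrix, so only the roots of [sigma_poly s] matter, and
    [roots_open] keeps them in the unit disc. *)
Lemma symm_polydisc_open n (A : 'M[C]_n.+1) : char_ball A ->
  exists2 d : R, 0 < d & forall s, mxnorm (s - sigma A) < d -> symm_polydisc n.+1 s.
Proof.
move=> DA; have [|d d0 Hd] := @roots_open R (eigs A) 1 ltr01.
  by move=> l; rewrite mem_eigs; apply: DA.
exists d => // s sd; rewrite -(sigma_mxK s); apply: symm_polydisc_sigma => l.
rewrite char_poly_sigma_mx; apply: Hd; rewrite ?sigma_poly_monic ?size_sigma_poly ?size_eigs//.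
move=> k kn; rewrite -char_poly_eigs -sigma_poly_sigma.
rewrite !(coef_sigma_poly _ (Ordinal kn)) /sigma_coef -mulrBr cabsM cabsX cabsN cabs1.
rewrite expr1n mul1r (le_lt_trans _ sd)//.
exact: cabs_mxnormB.
Qed.

Lemma loclip_mx_near p q p' q' (f : 'M[C]_(p, q) -> 'M[C]_(p', q')) (x : 'M[C]_(p, q)) :
  loclip_mx f -> exists2 L : R, 0 < L & forall y, mxnorm (y - x) < 1 ->
    mxnorm (f y - f x) <= L * mxnorm (y - x).
Proof.
move=> /loclip_mxP /(_ (mxnorm x + 1))[L L0 HL].
exists (L + 1) => [|y yx]; first by rewrite ltr_wpDl.
have y1 : mxnorm y <= mxnorm x + 1.
  have -> : y = x + (y - x) by rewrite addrC subrK.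
  by rewrite (le_trans (ler_mxnormD _ _))// lerD2l ltW.
have x1 : mxnorm x <= mxnorm x + 1 by rewrite lerDl.
have [_ H] := HL y x y1 x1; rewrite (le_trans H)//.
by rewrite ler_wpM2r ?mxnorm_ge0// lerDl.
Qed.

Lemma usc_comp p q p' q' (D : set 'M[C]_(p, q)) (D' : set 'M[C]_(p', q'))
    (f : 'M[C]_(p, q) -> 'M[C]_(p', q')) (u : 'M[C]_(p', q') -> \bar R) :
  loclip_mx f -> (forall x, D x -> D' (f x)) -> usc_on D' u -> usc_on D (fun x => u (f x)).
Proof.
move=> lf Df [uoo usc]; split=> [x /Df|x Dx c ux]; first exact: uoo.
have [d d0 Hd] := usc _ (Df _ Dx) _ ux; have [L L0 HL] := loclip_mx_near x lf.
exists (Num.min 1 (d / L)); first by rewrite lt_min ltr01 divr_gt0.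
move=> y Dy; rewrite lt_min ltr_pdivlMr// => /andP[y1 yd].
by apply: Hd; [exact: Df|apply: le_lt_trans (HL _ y1) _; rewrite mulrC].
Qed.

(* A function with a logarithmic pole is [-oo] at the pole itself, by the
   submean inequality on small circles. *)
Lemma green_class_center p q (D : set 'M[C]_(p.+1, q.+1)) P u (e : R) :
  0 < e -> (forall x, mxnorm (x - P) < e -> D x) -> green_class D P u -> u P = -oo%E.
Proof.
move=> e0 De [neg [pshu [c [d d0 pole]]]].
pose b : 'M[C]_(p.+1, q.+1) := const_mx 1.
have b0 : 0 < mxnorm b.
  by rewrite mxnorm_gt0; apply/eqP => /matrixP/(_ 0 0)/eqP; rewrite !mxE oner_eq0.
have DP : D P by apply: De; rewrite subrr mxnorm0.
have bound (A : R) : (u P <= A%:E)%E.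
  have [s s0 [se sd sA]] : exists2 s : R, 0 < s & [/\ s < e, s < d & s <= expR (A - c)].
    have m0 : 0 < Num.min (Num.min e d) (expR (A - c)) by rewrite !lt_min e0 d0 expR_gt0.
    have hm : Num.min (Num.min e d) (expR (A - c)) / 2 < Num.min (Num.min e d) (expR (A - c)).
      by rewrite ltr_pdivrMr// ltr_pMr// ltr1n.
    exists (Num.min (Num.min e d) (expR (A - c)) / 2); first by rewrite divr_gt0.
    by move: hm; rewrite !lt_min => /andP[/andP[-> ->] /ltW ->].
  have r0 : 0 < s / mxnorm b by rewrite divr_gt0.
  have norm_circ t : mxnorm (P + circ (s / mxnorm b) t *: b - P) = s.
    rewrite addrC addKr mxnormZ cabs_circ ?divfK ?gt_eqF//; exact: ltW.
  have Dw (w : C) : cabs w <= s / mxnorm b -> D (P + (0 + w) *: b).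
    move=> ws; apply: De; rewrite add0r addrC addKr mxnormZ (le_lt_trans _ se)//.
    by rewrite -ler_pdivlMr.
  have := psh_submean_at pshu (fun x Dx => ltW (neg x Dx)) r0 Dw => /(_ A 0 0); rewrite scale0r addr0; apply => t.
  rewrite !mul0r addr0 raddf0 addr0 add0r.
  have w0 : P + circ (s / mxnorm b) t *: b != P.
    by rewrite -subr_eq0 -mxnorm_gt0 norm_circ.
  apply: le_trans (pole _ _ w0 _) _.
  - by apply: De; rewrite norm_circ.
  - by rewrite norm_circ.
  - by rewrite lee_fin norm_circ -lerBrDr -ler_expR lnK.
case uP : (u P) bound => [x| |] bound //.
- by have := bound (x - 1)%R; rewrite lee_fin lerBrDr gerDl ler10.
- by have := bound 0.
Qed.

(** An affine disc becomes a polynomial one, handled by [psh_poly_submean]; the tube it demands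
    comes from openness of the polydisk and compactness of the disc. The pole estimate is
    transported by the Lipschitz bound for [sigma] at [V]. *)
Lemma green_class_comp_sigma n (V : 'M[C]_n.+1) u : char_ball V ->
  green_class (@symm_polydisc R n.+1) (sigma V) u ->
  green_class (@char_ball R n.+1) V (fun M => u (sigma M)).
Proof.
move=> DV gu; have [e e0 De] := symm_polydisc_open DV.
have uV := green_class_center e0 De gu.
have [neg [pshu [c [d d0 pole]]]] := gu.
have sB := @symm_polydisc_sigma n.
split; first by move=> x /sB; apply: neg.
split; first split.
- by have [uscu _] := pshu; apply: usc_comp uscu; [exact: loclip_sigma|exact: sB].
- move=> a b r Da r0 Dab; have [F FE] := sigma_pencil a b.
  have [eta eta0 Heta] : exists2 eta : R, 0 < eta & forall z, cabs z <= r ->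
      forall w, mxnorm (w - mxeval F z) <= eta -> symm_polydisc n.+1 w.
    apply: disc_uniform => [z d1 d2 d12 H w wd|z0 z0r]; first by apply: H; apply: le_trans d12.
    have [d1 d10 Hd1] := symm_polydisc_open (Dab _ z0r).
    have [L L0 HL] := mxeval_lip F r.
    have L2 : 0 < L + 2 by rewrite ltr_wpDl.
    exists (d1 / (L + 2)); first by rewrite divr_gt0.
    move=> z zr zz0 w wz; apply: Hd1; rewrite -FE.
    have -> : w - mxeval F z0 = (w - mxeval F z) + (mxeval F z - mxeval F z0).
      by rewrite addrA subrK.
    rewrite (le_lt_trans (ler_mxnormD _ _))//.
    have E : d1 = d1 / (L + 2) + (L * (d1 / (L + 2)) + d1 / (L + 2)) by field; lra.
    rewrite [ltRHS]E ler_ltD// (le_lt_trans (HL _ _ zr z0r))//.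
    have x0 : 0 < d1 / (L + 2) by rewrite divr_gt0.
    by have := ler_wpM2l L0 (ltW zz0); lra.
  have := @psh_poly_submean R _ _ _ _ F r eta pshu (fun x Dx => ltW (neg x Dx)) r0 eta0.
  rewrite FE scale0r addr0.
  under eq_integral do rewrite FE.
  by apply => z w zr wz; apply: Heta wz.
have [L L0 HL] := loclip_mx_near V (@loclip_sigma n.+1).
exists (ln L + c), (Num.min 1 (d / L)); first by rewrite lt_min ltr01 divr_gt0.
move=> w Dw wV; rewrite lt_min ltr_pdivlMr// => /andP[w1 wd].
have wV0 : 0 < mxnorm (w - V) by rewrite mxnorm_gt0 subr_eq0.
(* A point [w] other than [V] may lie in the fibre of [V]. There the pole estimate says nothing, and
   the value [-oo] at the centre is what is needed. *)
have [->|sw] := eqVneq (sigma w) (sigma V); first by rewrite uV leNye.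
apply: le_trans (pole _ (sB _ Dw) sw _) _.
  by apply: le_lt_trans (HL _ w1) _; rewrite mulrC.
rewrite lee_fin addrA lerD2r -lnM ?posrE// ler_ln ?posrE ?mulr_gt0//.
  by rewrite mulrC; apply: HL.
by rewrite mxnorm_gt0 subr_eq0.
Qed.

(** The section [sigma_mx] is affine but in general misses [V], where the pole sits. Its conjugate
    [M s = K (sigma_mx s) K^-1] passes through [V] and is Lipschitz, and [u] takes the same values
    on both by constancy on fibres. *)
Lemma green_class_sigma_mx n (V K : 'M[C]_n.+1) u : char_ball V -> K \in unitmx ->
  V *m K = K *m sigma_mx (sigma V) ->
  green_class (@char_ball R n.+1) V u ->
  green_class (@symm_polydisc R n.+1) (sigma V) (fun s => u (sigma_mx s)).
Proof.
move=> DV uK VK [neg [pshu [c [d d0 pole]]]].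
have Gs := @char_ball_sigma_mx n.
split; first by move=> x /Gs; apply: neg.
split.
  by apply: (psh_comp_affine (@sigma_mx_affine n) ler01 (@mxnorm_sigma_mxB n) Gs pshu).
pose M s := K *m sigma_mx s *m invmx K.
have MV : M (sigma V) = V by rewrite /M -VK mulmxK.
have cM s : char_poly (M s) = char_poly (sigma_mx s).
  by have := char_poly_conj (sigma_mx s) (_ : invmx K \in unitmx); rewrite unitmx_inv invmxK; apply.
pose L := n.+1%:R * (n.+1%:R * mxnorm K) * mxnorm (invmx K) + 1.
have L0 : 0 < L by rewrite ltr_wpDl// !mulr_ge0 ?mxnorm_ge0.
have HL s : mxnorm (M s - V) <= L * mxnorm (s - sigma V).
  rewrite -[X in M s - X]MV /M -mulmxBl -mulmxBr (le_trans (ler_mxnormM _ _))//.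
  rewrite /L mulrDl mul1r ler_wpDr ?mxnorm_ge0// -!mulrA ler_wpM2l//.
  rewrite mulrCA [leRHS]mulrCA.
  rewrite (@le_trans _ _ ((n.+1%:R * (mxnorm K * mxnorm (sigma_mx s - sigma_mx (sigma V)))) *
    mxnorm (invmx K)))//.
    by rewrite ler_wpM2r ?mxnorm_ge0// ler_mxnormM.
  rewrite -!mulrA ler_wpM2l// ler_wpM2l ?mxnorm_ge0// mulrC ler_wpM2l ?mxnorm_ge0//.
  by have := mxnorm_sigma_mxB s (sigma V); rewrite mul1r.
exists (ln L + c), (d / L); first by rewrite divr_gt0.
move=> w Dw wV; rewrite ltr_pdivlMr// => wd.
have wV0 : 0 < mxnorm (w - sigma V) by rewrite mxnorm_gt0 subr_eq0.
have DM : char_ball (M w) by apply: char_ball_eq (Gs _ Dw); rewrite cM.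
have MwV : M w != V.
  by apply: contra_neq wV => MwV; rewrite -MwV /sigma cM -/(sigma _) sigma_mxK.
have -> : u (sigma_mx w) = u (M w).
  by apply/esym/(psh_fibre_const pshu _ DM (cM w)) => N DN; apply/ltW/neg.
apply: le_trans (pole _ DM MwV _) _.
  by apply: le_lt_trans (HL _) _; rewrite mulrC.
rewrite lee_fin addrA lerD2r -lnM ?posrE// ler_ln ?posrE ?mulr_gt0//.
  by rewrite mulrC; apply: HL.
by rewrite mxnorm_gt0 subr_eq0.
Qed.

Lemma green_cyclic n (V M : 'M[C]_n.+1) : char_ball V -> cyclic_mx V -> char_ball M ->
  green (@char_ball R n.+1) V M = green (@symm_polydisc R n.+1) (sigma V) (sigma M).
Proof.
move=> DV [v uK] DM; apply/eqP; rewrite eq_le; apply/andP; split.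
  apply: ge_ereal_sup => _ [u gu <-].
  have VK := cyclic_sigma_mx v (esym (sigma_poly_sigma V)).
  have -> : u M = u (sigma_mx (sigma M)).
    have [neg [pshu _]] := gu; apply: (psh_fibre_const pshu _ DM).
      by move=> N DN; apply/ltW/neg.
    by rewrite char_poly_sigma_mx sigma_poly_sigma.
  apply: ereal_sup_ubound; exists (fun s => u (sigma_mx s)) => //.
  exact: (green_class_sigma_mx DV uK VK gu).
apply: ge_ereal_sup => _ [u gu <-]; apply: ereal_sup_ubound.
by exists (fun N => u (sigma N)) => //; apply: green_class_comp_sigma.
Qed.

End SigmaMap.

(** * Derogatory matrices *)

(** The factorization of [X^(m+1) - 1] with [(X - l) / z] substituted for [X]. *)
Lemma prod_XsubC_roots (F : fieldType) (l z w : F) m : z != 0 -> (m.+1).-primitive_root w ->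
  \prod_(k < m.+1) ('X - (l + z * w ^+ k)%:P) = ('X - l%:P) ^+ m.+1 - (z ^+ m.+1)%:P.
Proof.
move=> z0 pw; have /(congr1 (fun p => p \Po (z^-1 *: ('X - l%:P)))) := factor_Xn_sub_1 pw.
rewrite big_mkord rmorph_prod rmorphB rmorphXn /= comp_polyX rmorph1 exprZn => E.
have -> : ('X - l%:P) ^+ m.+1 - (z ^+ m.+1)%:P =
    z ^+ m.+1 *: (z^-1 ^+ m.+1 *: ('X - l%:P) ^+ m.+1 - 1).
  by rewrite scalerBr scalerA -exprMn divff// expr1n scale1r alg_polyC.
rewrite -E -[in z ^+ _](card_ord m.+1) -prodr_const -scaler_prod.
apply: eq_bigr => k _; rewrite rmorphB /= comp_polyX comp_polyC.
by rewrite scalerBr scalerA divff// scale1r -mul_polyC -polyCM polyCD opprD addrA.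
Qed.

Section RootsOfUnity.
Variable R : realType.
Local Notation C := (R[i]).

Lemma circ_primitive_root m : (m.+1).-primitive_root (circ 1 (2 * pi / m.+1%:R) : C).
Proof.
have M0 : 0 < m.+1%:R :> R by rewrite ltr0n.
have pi0 : 0 < 2 * pi :> R by rewrite mulr_gt0 ?pi_gt0.
rewrite /primitive_root_of_unity /=; apply/forallP => i; apply/eqP.
rewrite unity_rootE circX expr1n -[_ *+ i.+1]mulr_natr.
have [im|im] := eqVneq i.+1 m.+1.
  rewrite im divfK ?lt0r_neq0//.
  by have := @circ_2pi R 1 0 1; rewrite add0r mulr1 => ->; rewrite circ_real eqxx.
apply/negbTE/eqP => /(congr1 (@complex.Re R)) /=; rewrite mul1r.
have x2 : 0 < (2 * pi / m.+1%:R * i.+1%:R : R) < 2 * pi.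
  rewrite mulrAC ltr_pdivrMr// ltr_pM2l// ltr_nat ltn_neqAle im (ltn_ord i) andbT.
  by rewrite divr_gt0// mulr_gt0// ltr0n.
exact/eqP/(cos_lt1 x2).
Qed.

End RootsOfUnity.

Section Derogatory.
Variable R : realType.
Local Notation C := (R[i]).
Variables (n : nat) (V P T : 'M[C]_n.+1) (l : C) (r : {poly C}).
Hypotheses (uP : P \in unitmx) (tT : is_trig_mx T) (VE : V = invmx P *m T *m P).
Hypotheses (Vr : char_poly V = ('X - l%:P) * r) (r0 : horner_mx V r = 0).

Let mult : nat := #|[pred i | T i i == l]|.
Let chi' : {poly C} := \prod_(i | T i i != l) ('X - (T i i)%:P).

Lemma char_poly_split : char_poly V = ('X - l%:P) ^+ mult * chi'.
Proof.
rewrite VE char_poly_conj// char_poly_trig// (bigID (fun i => T i i == l)) /=.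
congr (_ * _); rewrite /mult -prodr_const; apply: eq_big => // i.
by move=> /eqP ->.
Qed.

Lemma cofactor_neq0 : chi'.[l] != 0.
Proof.
rewrite horner_prod; apply/prodf_neq0 => i Ti.
by rewrite !(hornerD, hornerN, hornerX, hornerC) subr_eq0 eq_sym.
Qed.

Lemma mult_gt0 : (0 < mult)%N.
Proof.
have : (char_poly V).[l] = 0 by rewrite Vr hornerM hornerXsubC subrr mul0r.
rewrite char_poly_split hornerM; case: mult => // /eqP.
by rewrite expr0 hornerC mul1r (negbTE cofactor_neq0).
Qed.

Lemma size_cofactor : (size chi' + mult = n.+2)%N.
Proof.
have := size_char_poly V; rewrite char_poly_split size_Mmonic ?expf_neq0 ?polyXsubC_eq0//.
  by rewrite size_exp_XsubC => <-; rewrite addSn /= addnC.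
exact: monic_prod_XsubC.
Qed.

Lemma cofactor_monic : chi' \is monic. Proof. exact: monic_prod_XsubC. Qed.

Lemma reduced_annihilator : horner_mx V (('X - l%:P) ^+ mult.-1 * chi') = 0.
Proof.
suff <- : r = ('X - l%:P) ^+ mult.-1 * chi' by [].
apply: (@mulfI _ ('X - l%:P)); first by rewrite polyXsubC_eq0.
by rewrite -Vr char_poly_split mulrA -exprS prednK// mult_gt0.
Qed.

Lemma horner_mx_XsubC_exp k : horner_mx V (('X - l%:P) ^+ k) = (V - l%:M) ^+ k.
Proof. by rewrite rmorphXn rmorphB /= horner_mx_X horner_mx_C. Qed.

Lemma mlam_min x : (V - l%:M) ^+ n.+1 *m x = 0 -> (V - l%:M) ^+ mlam V l *m x = 0 :> 'cV_n.+1.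
Proof. by rewrite /mlam; case: ex_minnP => m /asboolP H _; apply: H. Qed.

Lemma power_annihilator : horner_mx V (('X - l%:P) ^+ n.+1 * chi') = 0.
Proof.
have mn : (mult <= n.+1)%N by rewrite -[n.+1]card_ord max_card.
rewrite -[X in _ ^+ X](subnK mn) exprD -mulrA -char_poly_split rmorphM /= Cayley_Hamilton.
exact: mulr0.
Qed.

(** [(X - l)^(mult-1) * chi'] annihilates [V]. By Bezout, [chi' V] is invertible on the kernel of
    [(V - l)^(n+1)], so [(V - l)^(mult-1)] already vanishes there. *)
Lemma mlam_lt_mult : (mlam V l < mult)%N.
Proof.
rewrite -(prednK mult_gt0) ltnS /mlam; case: ex_minnP => m _; apply; apply/asboolP => x Vx.
have /Bezout_eq1_coprimepP[[a b] /= ab] : coprimep chi' (('X - l%:P) ^+ n.+1).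
  by rewrite coprimep_expr// coprimep_XsubC; apply: cofactor_neq0.
have -> : x = horner_mx V (a * chi' + b * ('X - l%:P) ^+ n.+1) *m x.
  by rewrite ab rmorph1 mul1mx.
rewrite -horner_mx_XsubC_exp mulmxA -[_ *m horner_mx _ _]/(_ * _) -rmorphM /=.
have -> : ('X - l%:P) ^+ mult.-1 * (a * chi' + b * ('X - l%:P) ^+ n.+1) =
   a * (('X - l%:P) ^+ mult.-1 * chi') + b * ('X - l%:P) ^+ mult.-1 * ('X - l%:P) ^+ n.+1.
  by rewrite mulrDr; congr (_ + _); [exact: mulrCA|rewrite mulrA [_ * b]mulrC].
rewrite rmorphD rmorphM /= reduced_annihilator mulr0 add0r rmorphM /=.
by rewrite horner_mx_XsubC_exp -[_ * _]/(_ *m _) -mulmxA Vx mulmx0.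
Qed.

Lemma rank_horner_ge (p : {poly C}) :
  (#|[pred i | p.[T i i] != 0%R]| <= \rank (horner_mx V p))%N.
Proof.
have [tp dp] := horner_trig p tT.
rewrite VE horner_mx_uconjC// mxrankMfree ?row_free_unit//.
rewrite (eqmxMfull _ (_ : row_full (invmx P))); last by rewrite row_full_unit unitmx_inv.
by apply: leq_trans (trig_rank_ge tp); apply/eq_leq/eq_card => i; rewrite !inE dp.
Qed.

(** The rank of [(V - l)^(n+1)] is at least the number of diagonal entries of [T] other than [l].
    Conversely its product with [chi' V], of rank at least [mult], is zero, so the two ranks add up
    to at most the size. *)
Lemma nlamE : nlam V l = mult.
Proof.
rewrite /nlam mxrank_ker mxrank_tr -horner_mx_XsubC_exp.
have N : (#|[pred i | T i i != l]| + mult = n.+1)%N.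
  by rewrite addnC -[RHS]card_ord -(cardC [pred i | T i i == l]).
have lo : (n.+1 - mult <= \rank (horner_mx V (('X - l%:P) ^+ n.+1)))%N.
  apply: leq_trans (rank_horner_ge _); rewrite -{1}N addnK.
  apply/eq_leq/eq_card => i; rewrite !inE horner_exp hornerXsubC expf_eq0 /=.
  by rewrite subr_eq0.
have hi : (\rank (horner_mx V (('X - l%:P) ^+ n.+1)) + mult <= n.+1)%N.
  have := rank_horner_ge chi' => H.
  have M : (mult <= \rank (horner_mx V chi'))%N.
    apply: leq_trans H; apply/subset_leq_card/fintype.subsetP => i; rewrite !inE => /eqP ->.
    exact: cofactor_neq0.
  apply: (leq_trans (leq_add (leqnn _) M)); apply: mulmx0_rank_max.
  rewrite -[_ *m _]/(_ * _) -rmorphM /=.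
  exact: power_annihilator.
have mn : (mult <= n.+1)%N by rewrite -N leq_addl.
have -> : \rank (horner_mx V (('X - l%:P) ^+ n.+1)) = (n.+1 - mult)%N.
  by apply/eqP; rewrite eqn_leq lo andbT -(leq_add2r mult) subnK.
exact: subKn.
Qed.

(** [chi' V] maps the whole space into the kernel of [(V - l)^(n+1)], on which [(V - l)^m(l)] is
    zero. *)
Lemma mlam_annihilator : horner_mx V (('X - l%:P) ^+ mlam V l * chi') = 0.
Proof.
apply/matrixP => i j; rewrite mxE.
suff : horner_mx V (('X - l%:P) ^+ mlam V l * chi') *m delta_mx j 0 = 0 :> 'cV_n.+1.
  by move=> /matrixP/(_ i 0); rewrite -colE !mxE.
rewrite rmorphM /= -[_ * _]/(_ *m _) -mulmxA horner_mx_XsubC_exp.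
apply: mlam_min; rewrite -horner_mx_XsubC_exp mulmxA -[_ *m horner_mx _ _]/(_ * _) -rmorphM /=.
by rewrite power_annihilator mul0mx.
Qed.

Lemma derogatory_direction : exists2 X : 'M[C]_n.+1, X != 0 &
  forall z, z != 0 -> char_poly (V + z *: X) = (('X - l%:P) ^+ mult - (z ^+ mult)%:P) * chi'.
Proof.
pose s := enum [pred i | T i i == l].
have [m mE] : exists m, mult = m.+1 by exists mult.-1; rewrite prednK// mult_gt0.
have ss : size s = m.+1 by rewrite -mE -cardE.
pose w : C := circ 1 (2 * pi / m.+1%:R).
have pw : (m.+1).-primitive_root w := @circ_primitive_root R m.
pose d : 'rV[C]_n.+1 := \row_i (if T i i == l then w ^+ index i s else 0).
pose X := invmx P *m diag_mx d *m P.
have XE z : z != 0 -> char_poly (V + z *: X) = (('X - l%:P) ^+ mult - (z ^+ mult)%:P) * chi'.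
  move=> z0; have -> : V + z *: X = invmx P *m (T + z *: diag_mx d) *m P.
    by rewrite VE mulmxDr mulmxDl -scalemxAr -scalemxAl.
  rewrite char_poly_conj// char_poly_trig; last first.
    apply/is_trig_mxP => i j ij; move/is_trig_mxP: tT => /(_ i j ij) Tij.
    by rewrite !mxE Tij -val_eqE ltn_eqF// mulr0n mulr0 addr0.
  have dE i : (T + z *: diag_mx d) i i = T i i + z * d 0 i.
    by rewrite !mxE eqxx mulr1n.
  rewrite (bigID (fun i => T i i == l)) /=; congr (_ * _); last first.
    by apply: eq_bigr => i Ti; rewrite dE mxE (negbTE Ti) mulr0 addr0.
  rewrite mE -(prod_XsubC_roots l z0 pw).
  transitivity (\prod_(i <- s) ('X - (l + z * w ^+ index i s)%:P)).
    rewrite /s big_enum; apply: eq_big => // i Ti.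
    by rewrite dE mxE Ti (eqP Ti).
  case sE : s => [|i0 s']; first by rewrite sE in ss.
  rewrite -sE (big_nth i0) big_mkord ss; apply: eq_bigr => k _.
  by rewrite index_uniq ?enum_uniq// ss.
(* If [X] were zero, the formula at [z = 1] would equate two characteristic polynomials that differ
   by [chi']. *)
exists X => //; apply/eqP => X0.
have := XE 1 (oner_neq0 _); rewrite X0 scaler0 addr0 char_poly_split.
move/(mulIf (monic_neq0 cofactor_monic))/eqP.
by rewrite -subr_eq0 opprB addrC subrK expr1n polyC_eq0 oner_eq0.
Qed.

Lemma cofactor_lower : exists k d : R, [/\ 0 < k, 0 < d &
  forall z, cabs z < d -> k <= cabs chi'.[l + z]].
Proof.
have [L L0 HL] := poly_lip chi' (cabs l + 1).
have [c c0 cE] : exists2 c : R, 0 < c & cabs chi'.[l] = c.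
  by exists (cabs chi'.[l]); rewrite // cabs_gt0 cofactor_neq0.
have L1 : 0 < L + 1 by rewrite ltr_wpDl.
exists (c / 2), (Num.min 1 (c / 2 / (L + 1))); split; first by rewrite divr_gt0.
  by rewrite lt_min ltr01 !divr_gt0.
move=> z; rewrite lt_min ltr_pdivlMr// => /andP[z1 zL].
have := ler_distcabs chi'.[l] chi'.[l + z]; rewrite cabsB cE => H.
have zl : cabs (l + z) <= cabs l + 1 by rewrite (le_trans (ler_cabsD _ _))// lerD2l ltW.
have ll : cabs l <= cabs l + 1 by rewrite lerDl.
have := HL (l + z) l zl ll; rewrite [l + z - l]addrAC subrr add0r.
have := cabs_ge0 z; move: H zL L0.
move: (cabs (_ - _)) (cabs chi'.[_]) (cabs z) => a b y.
rewrite mulrDr mulr1 [y * L]mulrC; move: (L * y) => Ly; lra.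
Qed.

End Derogatory.

(** * Bounds for the two Green functions *)

Section GreenEstimates.
Variable R : realType.
Local Notation C := (R[i]).

(** The eigenvalues of [q M] are the [q l] with [|l| < 1], so the bound [K] of [q] on the unit disc
    serves as [C0], and [K < expR K] gives strict negativity. For the pole, [rho] is at most a
    multiple of the norm of [q w - q V]. *)
Lemma green_class_ln_rho n (V : 'M[C]_n.+1) (q : {poly C}) : horner_mx V q = 0 ->
  exists C0 : R, green_class (@char_ball R n.+1) V (@ln_rho R n q C0).
Proof.
move=> qV; have [K K0 HK] := poly_bound q 1.
have neg M : char_ball M -> (@ln_rho R n q K M < 0)%E.
  move=> DM; rewrite ln_rho_lt add0r; apply: (@le_lt_trans _ _ K); last first.
    by have := expR_ge1Dx K; lra.
  apply: rho_le => // _ /[!(perm_mem (eigs_horner M q))] /mapP[l lM ->].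
  by apply: HK; apply/ltW/DM; rewrite -mem_eigs.
exists K; split => //; split; first by apply: ln_rho_psh => M /neg /ltW.
have [L L0 HL] := loclip_mx_near V (@loclip_horner_mx R n q).
exists (n.+1%:R * L - K), 1 => // w _ wV w1.
have w0 : 0 < mxnorm (w - V) by rewrite mxnorm_gt0 subr_eq0.
rewrite ln_rho_le addrA subrK expRD lnK ?posrE//.
rewrite (le_trans (rho_mxnorm _))//.
have := HL w w1; rewrite qV subr0 => H.
apply: (@le_trans _ _ (mxnorm (w - V) * (n.+1%:R * L))).
  by rewrite mulrCA ler_wpM2l// mulrC.
rewrite ler_wpM2l ?mxnorm_ge0//.
by have := expR_ge1Dx (n.+1%:R * L); lra.
Qed.

(** Rescaling [b] by [s] places the disc of radius 2 inside the polydisk. Then [green_class_pole]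
    bounds every competitor by [ln |z^m / s|], with the same constant [- ln s] for all. *)
Lemma green_symm_polydisc_le n (V : 'M[C]_n.+1) (b : 'rV[C]_n.+1) (m : nat) :
  char_ball V -> b != 0 -> (0 < m)%N ->
  exists c : R, exists2 d : R, 0 < d & forall z, z != 0 -> cabs z < d ->
    (green (@symm_polydisc R n.+1) (sigma V) (sigma V + z ^+ m *: b)
       <= (m%:R * ln (cabs z) + c)%:E)%E.
Proof.
move=> DV b0 m0; have [e e0 De] := symm_polydisc_open DV.
have nb : 0 < mxnorm b by rewrite mxnorm_gt0.
have [s s0 sE] : exists2 s : R, 0 < s & s * mxnorm b * 2 < e.
  exists (e / (mxnorm b * 3)); first by rewrite divr_gt0// mulr_gt0.
  have -> : e / (mxnorm b * 3) * mxnorm b * 2 = e * (2 / 3) by field; lra.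
  by lra.
exists (- ln s), (Num.min 1 s) => [|z z0]; first by rewrite lt_min ltr01 s0.
rewrite lt_min => /andP[z1 zs]; apply: ge_ereal_sup => _ [u gu <-].
have zc : 0 < cabs z by rewrite cabs_gt0.
have s0' : (s%:C)%C != 0 :> C by rewrite -cabs_eq0 cabs_real gt_eqF// gtr0_norm.
have sb : (s%:C)%C *: b != 0 by rewrite scaler_eq0 (negbTE s0') (negbTE b0).
have line w : cabs w <= 2 -> symm_polydisc n.+1 (sigma V + w *: ((s%:C)%C *: b)).
  move=> w2; apply: De; rewrite addrC addKr !mxnormZ cabs_real gtr0_norm//.
  apply: le_lt_trans sE; rewrite mulrC ler_wpM2l//.
  by rewrite mulr_ge0// ltW.
have zm : cabs (z ^+ m / (s%:C)%C) = cabs z ^+ m / s.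
  by rewrite cabsM cabsV cabsX cabs_real gtr0_norm.
have zms : 0 < cabs z ^+ m / s <= 1.
  rewrite divr_gt0 ?exprn_gt0//= ler_pdivrMr// mul1r (le_trans _ (ltW zs))//.
  by rewrite -[leRHS]expr1 ler_wiXn2l// ltW.
have R2 : (1 : R) < 2 by rewrite ltr1n.
have := green_class_pole gu sb R2 line => /(_ (z ^+ m / (s%:C)%C)).
rewrite zm scalerA divfK// => /(_ zms) H; apply: (le_trans H).
by rewrite lee_fin ln_div ?posrE ?exprn_gt0// lnXn// mulr_natl.
Qed.

Lemma noncyclic_annihilator n (V : 'M[C]_n.+1) : ~ cyclic_mx V ->
  exists l (r : {poly C}), char_poly V = ('X - l%:P) * r /\ horner_mx V r = 0.
Proof.
move=> nc; apply: contrapT => no; apply/nc/cyclic_criterion => l r Vr.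
by apply/eqP => r0; apply: no; exists l, r.
Qed.

Lemma green_noncyclic n (V : 'M[C]_n.+1) : char_ball V -> ~ cyclic_mx V ->
  exists l : C, eigenvalue V l /\ (mlam V l < nlam V l)%N /\
  exists X : 'M[C]_n.+1, X != 0 /\
  (exists c : R, exists2 d : R, 0 < d & forall z : C, z != 0 -> cabs z < d ->
     (((mlam V l)%:R * ln (cabs z) + c)%:E
        <= green (@char_ball R n.+1) V (V + z *: X))%E) /\
  (exists c : R, exists2 d : R, 0 < d & forall z : C, z != 0 -> cabs z < d ->
     (green (@symm_polydisc R n.+1) (sigma V) (sigma (V + z *: X))
        <= ((nlam V l)%:R * ln (cabs z) + c)%:E)%E).
Proof.
move=> DV /noncyclic_annihilator[l [r [Vr r0]]].
have [P [T [uP tT VE]]] := triangularize V.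
have mlt := mlam_lt_mult uP tT VE Vr r0.
have nE := nlamE l uP tT VE.
have [X X0 XE] := derogatory_direction uP tT VE Vr.
have qV := mlam_annihilator l uP tT VE.
have [k [d1 [k0 d10 Hk]]] := cofactor_lower T l.
have split := char_poly_split l uP tT VE.
have chim := cofactor_monic T l.
have sizechi := size_cofactor l uP tT VE.
rewrite -nE in mlt XE split sizechi.
move: (\prod_(i | T i i != l) _) => chi in qV Hk split chim sizechi XE *.
exists l; split; first by rewrite eigenvalue_root_char Vr rootM root_XsubC eqxx.
split=> //; exists X; split=> //; split.
  have [C0 gu] := green_class_ln_rho qV.
  exists (ln k - C0), d1 => // z z0 zd.
  apply: (@le_trans _ _ (@ln_rho R n (('X - l%:P) ^+ mlam V l * chi) C0 (V + z *: X))); last first.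
    by apply: ereal_sup_ubound; eexists; first exact: gu.
  have zc : 0 < cabs z by rewrite cabs_gt0.
  rewrite leNgt ln_rho_lt -leNgt addrA subrK expRD lnK ?posrE// expRM_natl lnK ?posrE//.
  apply: le_trans (eigs_rho (l := (('X - l%:P) ^+ mlam V l * chi).[l + z]) _).
    rewrite hornerM horner_exp hornerXsubC addrC addKr cabsM cabsX.
    by rewrite ler_wpM2l ?exprn_ge0 ?cabs_ge0// Hk.
  rewrite (perm_mem (eigs_horner _ _)); apply: map_f.
  rewrite mem_eigs XE// rootM; apply/orP; left.
  by rewrite rootE hornerD hornerN hornerC horner_exp hornerXsubC [l + z]addrC addrK subrr.
have mu0 : (0 < nlam V l)%N by apply: leq_ltn_trans mlt.
pose b : 'rV[C]_n.+1 := \row_j ((-1) ^+ j.+1 * - chi`_(n.+1 - j.+1)).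
have bE z : z != 0 -> sigma (V + z *: X) = sigma V + z ^+ nlam V l *: b.
  move=> z0; apply/rowP => j; rewrite !mxE XE// split mulrBl coefB coefCM.
  by rewrite mulrBr !mulrN mulrCA.
(* The cofactor is monic of degree [n + 1 - k], with [k] the multiplicity of [l]. Its leading
   coefficient is therefore read at index [k - 1] of [b]. *)
have b0 : b != 0.
  have mn : ((nlam V l).-1 < n.+1)%N.
    move: sizechi; have : (0 < size chi)%N by rewrite size_poly_gt0 monic_neq0.
    by case: (size chi) => // s _; case: (nlam V l) mu0 => // t _; rewrite addSn addnS => -[<-] /=;
      rewrite ltnS leq_addl.
  apply/eqP => /rowP/(_ (Ordinal mn))/eqP; rewrite !mxE /= prednK//.
  have -> : (n.+1 - nlam V l)%N = (size chi).-1.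
    have E : ((size chi).-1 + nlam V l)%N = n.+1.
      apply: succn_inj; rewrite -sizechi -addSn prednK//.
      by rewrite size_poly_gt0 monic_neq0.
    by rewrite -[X in (X - _)%N]E addnK.
  rewrite -lead_coefE (monicP chim) mulrN1 oppr_eq0 expf_eq0 oppr_eq0 oner_eq0.
  by rewrite andbF.
have [c [d d0 Hd]] := green_symm_polydisc_le DV b0 mu0.
by exists c, d => // z z0 zd; rewrite bE//; apply: Hd.
Qed.

End GreenEstimates.

Theorem theorem1p1 (R : realType) (n : nat) (V : 'M[R[i]]_n) :
  (2 <= n)%N -> spectral_ball n V ->
  (cyclic_mx V ->
     forall M : 'M[R[i]]_n, spectral_ball n M ->
       green (spectral_ball n) V M
       = green (symm_polydisc n) (sigma V) (sigma M)) /\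
  (~ cyclic_mx V ->
     exists l : R[i], eigenvalue V l /\ (mlam V l < nlam V l)%N /\
     exists X : 'M[R[i]]_n, X != 0 /\
     (exists c : R, exists2 d : R, 0 < d & forall z : R[i], z != 0 -> cabs z < d ->
        ((((mlam V l)%:R * ln (cabs z) + c)%:E
           <= green (spectral_ball n) V (V + z *: X))%E)) /\
     (exists c : R, exists2 d : R, 0 < d & forall z : R[i], z != 0 -> cabs z < d ->
        ((green (symm_polydisc n) (sigma V) (sigma (V + z *: X))
           <= ((nlam V l)%:R * ln (cabs z) + c)%:E)%E))).
Proof.
case: n V => // n V _; rewrite spectral_ballE => DV.
split=> [cV M DM|]; first exact: green_cyclic.
exact: green_noncyclic.
Qed.
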